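(* Let $n\geq 4$, and suppose that $G\cong K_4$, with vertices $p_0,p_1,p_2,p_3$, and $H\cong K_n$ are disjointly embedded, weakly linked graphs in $\mathbb{R}^3$. Let $C_0=p_1p_2p_3$, $C_1=p_3p_2p_0$, $C_2=p_0p_1p_3$, $C_3=p_2p_1p_0$ be the oriented triangles of $G$. Then exactly one of the following holds: (B1) There is a vertex $q$ of $H$ common to all triangles of $H$ linking a cycle in $G$. Then there are pairwise disjoint sets $I_0,I_1,I_2,I_3$ (at most two of them empty) such that $I_0\cup I_1\cup I_2\cup I_3=H-\{q\}$, and, after reversing the orientation of $\mathbb{R}^3$ (if necessary), each $C_i$ links $H$ in the star $qO_iI_i$, where $O_i=H-\{q\}-I_i$. (B2) There is no vertex of $H$ common to all triangles of $H$ linking a cycle in $G$. Then $n\geq 5$ and there are distinct vertices $q_1,q_2,q_3$ in $H$ such that, after relabelling the vertices of $G$ and reversing the orientation of $\mathbb{R}^3$ (if necessary), $C_0$ does not link $H$ and $C_1,C_2,C_3$ link $H$ in the stars $$q_1\{q_2,q_3\}I,\qquad q_2\{q_1,q_3\}I,\qquad q_3\{q_1,q_2\}I,$$ respectively, where $I=H-\{q_1,q_2,q_3\}$. In particular, the vertex $p_0$ of $G$ is common to all triangles of $G$ linking $H$; and a triangle $T$ of $H$ links $G$ if and only if it shares exactly one edge with $T^*=q_1q_2q_3$.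
   Context: A complete graph and its vertex set are denoted by the same symbol, so $H-S$ denotes the set of vertices of $H$ not in $S$. An embedded graph is identified with its image in $\mathbb{R}^3$. $\operatorname{Lk}(C,D)$ denotes the linking number of disjoint oriented simple closed curves; reversing the orientation of $\mathbb{R}^3$ changes the sign of every linking number. $C,D$ are linked if $\operatorname{Lk}(C,D)\neq 0$ and strongly linked if $|\operatorname{Lk}(C,D)|\geq 2$. Disjointly embedded graphs are weakly linked if some cycle in one links a cycle in the other, but no cycle in one strongly links a cycle in the other. A cycle links a graph if it links some cycle of that graph. For distinct vertices $p,q,r$, $pqr$ denotes the oriented triangle $p\to q\to r\to p$, and $-T$ is $T$ reversed. Star: given an ordered partition $(\{q\},O,I)$ of the vertices of $H$, the star $qOI$ consists of all oriented triangles $qrs$ with $r\in O$, $s\in I$. ''$C$ links $H$ in the star $qOI$'' means that for all oriented triangles $T$ of $H$: $\operatorname{Lk}(C,T)=+1$ if $T\in qOI$, $-1$ if $-T\in qOI$, and $0$ otherwise. Here $O$ or $I$ is allowed to be empty, in which case the condition says that $C$ does not link any triangle of $H$. In (B2), after relabelling the vertices of $G$ the triangles $C_i$ are given by the same formulas in terms of the new labels. *)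

(* Defs.v *)
From HB Require Import structures.
From mathcomp Require Import all_boot all_order all_algebra all_fingroup.
From mathcomp Require Import all_classical all_reals all_analysis.
Import Order.TTheory GRing.Theory Num.Theory.
Import numFieldNormedType.Exports.

Set Implicit Arguments.
Unset Strict Implicit.
Unset Printing Implicit Defensive.

Local Open Scope classical_set_scope.
Local Open Scope ring_scope.

(* The complete graph on V topologically embedded in R^3. [edge p q] is the
   edge joining p and q, traversed from p to q over the time interval [0, 1];
   [edge p p] is junk. Wild (non-polygonal) arcs are allowed. *)
Record complete_graph_embedding (R : realType) (V : finType) := {
  vertex : V -> 'rV[R]_3 ;
  edge : V -> V -> R -> 'rV[R]_3 ;
  vertex_inj : injective vertex ;
  edge_continuous : forall p q, p != q ->
    {within `[0, 1], continuous (edge p q)} ;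
  edge_source : forall p q, p != q -> edge p q 0 = vertex p ;
  edge_target : forall p q, p != q -> edge p q 1 = vertex q ;
  edge_reverse : forall p q (t : R), p != q -> 0 <= t <= 1 ->
    edge q p t = edge p q (1 - t) ;
  (* an interior point of an edge lies on no other edge and is visited once;
     t = 0 and t = 1 also exclude that the edge runs through a vertex *)
  edge_inj : forall p q p' q' (s t : R), p != q -> p' != q' ->
    0 < s < 1 -> 0 <= t <= 1 -> edge p q s = edge p' q' t ->
    [/\ p' = p, q' = q & t = s] \/ [/\ p' = q, q' = p & t = 1 - s]
}.

Definition embedded_image (R : realType) (V : finType)
    (E : complete_graph_embedding R V) : set 'rV[R]_3 :=
  [set x | exists p, x = vertex E p] `|`
  [set x | exists p q t, [/\ p != q, 0 <= t <= 1 & x = edge E p q t]].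

Definition disjointly_embedded (R : realType) (V W : finType)
    (G : complete_graph_embedding R V) (H : complete_graph_embedding R W) :=
  embedded_image G `&` embedded_image H = set0.

(** * Linking numbers *)

(* Signed crossing of the segments [a, b] and [c, d], seen in the projection
   along u, counted only when [c, d] passes over [a, b] (u points upwards).
   The sign is the usual one: positive when (over-strand, under-strand, up) is
   a positively oriented frame. *)
Definition crossing (R : realType) (u a b c d : 'rV[R]_3) : int :=
  if `[< exists s t h : R, [/\ 0 < s < 1, 0 < t < 1, 0 < h &
           a + s *: (b - a) + h *: u = c + t *: (d - c)] >]
  then sgz (\det (\matrix_(i < 3) [:: d - c; b - a; u]`_i)) else 0.

(* f parametrizes a closed curve over [0, 1]; [sample f m i], i <= m, are the
   successive vertices of its inscribed closed m-gon. *)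
Definition sample (R : realType) (f : R -> 'rV[R]_3) (m i : nat) : 'rV[R]_3 :=
  f (i%:R / m%:R).

(* The projection along u maps no vertex of one polygon onto the other polygon,
   so that the projected polygons meet only in transversal crossings of open
   edges. *)
Definition generic_direction (R : realType) (f g : R -> 'rV[R]_3) (m n : nat)
    (u : 'rV[R]_3) : Prop :=
  u != 0 /\
  forall i j (h t : R), (i <= m)%N -> (j <= n)%N -> 0 <= t <= 1 ->
    ((j < n)%N -> sample f m i + h *: u !=
       sample g n j + t *: (sample g n j.+1 - sample g n j)) /\
    ((i < m)%N -> sample g n j + h *: u !=
       sample f m i + t *: (sample f m i.+1 - sample f m i)).

Definition crossing_number (R : realType) (f g : R -> 'rV[R]_3) (m n : nat)
    (u : 'rV[R]_3) : int :=
  \sum_(i < m) \sum_(j < n)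
    crossing u (sample f m i) (sample f m i.+1) (sample g n j) (sample g n j.+1).

(* The linking number of two disjoint closed curves, for the standard
   orientation of R^3: the number of signed crossings where g passes over f, in
   any generic projection of any sufficiently fine inscribed polygons (the
   degree of (s, t) |-> g t - f s, up to the sign convention). This number
   exists and is unique for continuous disjoint closed curves; 0 is junk. *)
Definition standard_linking_number (R : realType) (f g : R -> 'rV[R]_3) : int :=
  xget 0 [set k | exists N : nat, forall m n u, (N <= m)%N -> (N <= n)%N ->
    generic_direction f g m n u -> crossing_number f g m n u = k].

(* An orientation of R^3 is encoded as a boolean, [false] being the standard
   one. *)
Definition linking_number (R : realType) (o : bool) (f g : R -> 'rV[R]_3) : int :=
  (-1) ^+ o * standard_linking_number f g.

(** * Cycles *)

(* The oriented cycle p_0 -> p_1 -> ... -> p_(k-1) -> p_0 is the sequence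
   [:: p_0; ...; p_(k-1)], up to rotation; [rev] reverses its orientation. *)
Definition is_cycle (V : finType) (c : seq V) : bool := uniq c && (2 < size c)%N.

Definition is_triangle (V : finType) (c : seq V) : bool :=
  uniq c && (size c == 3)%N.

Definition cycle_edges (V : finType) (c : seq V) : {set {set V}} :=
  [set [set x; next c x]%SET | x in c]%SET.

(* Unit speed along each of the k edges, rescaled from [0, k] to [0, 1]. *)
Definition cycle_curve (R : realType) (V : finType)
    (E : complete_graph_embedding R V) (c : seq V) : R -> 'rV[R]_3 :=
  if c is p :: _ then fun t =>
    let k := size c in
    let i := Num.truncn (k%:R * t) in
    edge E (nth p c (i %% k)) (nth p c (i.+1 %% k)) (k%:R * t - i%:R)
  else fun=> 0.

(** * Linking of embedded graphs *)

Section GraphLinking.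
Variables (R : realType) (V W : finType).
Variables (G : complete_graph_embedding R V) (H : complete_graph_embedding R W).

(* Linking numbers are always taken with the cycle of G first; this is
   harmless since linking numbers are symmetric. *)
Definition Lk (o : bool) (c : seq V) (d : seq W) : int :=
  linking_number o (cycle_curve G c) (cycle_curve H d).

(* These two notions do not depend on the orientation of R^3, nor on those of
   the cycles. *)
Definition linked (c : seq V) (d : seq W) : Prop := Lk false c d != 0.

Definition strongly_linked (c : seq V) (d : seq W) : Prop :=
  2 <= `|Lk false c d|.

Definition weakly_linked : Prop :=
  (exists c d, [/\ is_cycle c, is_cycle d & linked c d]) /\
  (forall c d, is_cycle c -> is_cycle d -> ~ strongly_linked c d).

Definition links_right (c : seq V) : Prop :=
  exists2 d : seq W, is_cycle d & linked c d.

Definition links_left (d : seq W) : Prop :=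
  exists2 c : seq V, is_cycle c & linked c d.

Definition in_star (q : W) (O I : {set W}) (T : seq W) : Prop :=
  exists r s k, [/\ r \in O, s \in I & rot k T = [:: q; r; s]].

Definition links_in_star (o : bool) (c : seq V) (q : W) (O I : {set W}) : Prop :=
  forall T : seq W, is_triangle T ->
    [/\ in_star q O I T -> Lk o c T = 1,
        in_star q O I (rev T) -> Lk o c T = -1 &
        ~ in_star q O I T -> ~ in_star q O I (rev T) -> Lk o c T = 0].

Definition common_linking_vertex (q : W) : Prop :=
  forall T : seq W, is_triangle T -> links_left T -> q \in T.

End GraphLinking.

(** * The two cases *)

Section Cases.
Variables (R : realType) (n : nat).
Variables (G : complete_graph_embedding R 'I_4).
Variables (H : complete_graph_embedding R 'I_n).

(* The oriented triangles of K_4 for the labelling p of its vertices; the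
   numerals are elements of 'I_4. *)
Definition face (p : 'I_4 -> 'I_4) (i : 'I_4) : seq 'I_4 :=
  tnth [tuple [:: p 1; p 2; p 3];
              [:: p 3; p 2; p 0];
              [:: p 0; p 1; p 3];
              [:: p 2; p 1; p 0]] i.

Definition common_vertex_case : Prop :=
  (exists q, common_linking_vertex G H q) /\
  (forall q, common_linking_vertex G H q ->
    exists I : 'I_4 -> {set 'I_n},
      [/\ forall i j, i != j -> (I i :&: I j)%SET = finset.set0,
          (#|[set i | I i == finset.set0]%SET| <= 2)%N,
          (\bigcup_i I i)%SET = [set~ q]%SET &
          exists o : bool, forall i,
            links_in_star G H o (face id i) q ([set~ q] :\: I i)%SET (I i)]).

Definition no_common_vertex_case : Prop :=
  ~ (exists q, common_linking_vertex G H q) /\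
  (5 <= n)%N /\
  exists q1 q2 q3 : 'I_n, uniq [:: q1; q2; q3] /\
  exists (p : {perm 'I_4}) (o : bool),
    let I := (~: [set q1; q2; q3])%SET in
    [/\ [/\ ~ links_right G H (face p 0),
            links_in_star G H o (face p 1) q1 [set q2; q3]%SET I,
            links_in_star G H o (face p 2) q2 [set q1; q3]%SET I &
            links_in_star G H o (face p 3) q3 [set q1; q2]%SET I],
        forall T, is_triangle T -> links_right G H T -> p 0 \in T &
        forall T, is_triangle T ->
          (links_left G H T <->
           #|(cycle_edges T :&: cycle_edges [:: q1; q2; q3])%SET| = 1%N)].

End Cases.

Definition exactly_one (P Q : Prop) : Prop := (P /\ ~ Q) \/ (~ P /\ Q).

(* Main.v *)
(* Project along u. The signed number of crossings of a segment [p, q] over the boundary of a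
   triangle is the intersection number of [p, q] with the triangle, plus a term telescoping
   along closed polygons. Coning a polygon from a generic apex thus expresses the crossing
   number of two disjoint closed polygons through intersection numbers, which do not involve u,
   and shows that it vanishes when the first polygon lies in a ball disjoint from the second.
   Hence all sufficiently fine inscribed polygons of two disjoint closed curves have the same
   crossing number. Sampling a cycle with the same number of points on every edge, the linking
   number of two cycles becomes a sum over pairs of edges, antisymmetric in each edge.

   The rest is combinatorial. An antisymmetric function on the edges of K_n whose values on
   all cycles lie in {-1, 0, 1} is a star on triangles: if abc has value 1, every other vertex d
   forms a triangle of value 1 with exactly one edge of abc, and cycles of length 5 and 6
   prevent all three edges from being used. This applies to the four faces of G and, since
   C_i + C_j is a 4-cycle, to their pairwise sums. *)

(* A linking number is defined as a value shared by all fine samples, so its existence must be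
   proved before it can be computed. Two samplings are compared through a common refinement:
   replacing a short arc by its chord changes the crossing number by that of a small closed loop,
   which lies in a ball away from the other curve. A generic direction may still be parallel to an
   edge; the degenerate cone triangles over such edges need their own count.

   In the combinatorial part a star with centre [q] is a 0-1 potential on the other vertices, and
   the four faces give four stars with sum zero. If none of them vanishes, any two have a common
   vertex: otherwise these two and the sum of the other two form the configuration of (B2), which
   the bounds on other pairs exclude. As a nonvanishing form has at most two common vertices, all
   four then share one. So without a shared vertex one face does not link [H], and the other three
   are arranged as in (B2). With a shared vertex the four potentials add up to a constant; the
   bounds on pairs exclude the value 2 with no potential constant. *)
Require Import Defs.
From mathcomp Require Import all_boot all_order all_algebra all_fingroup.
From mathcomp Require Import all_classical all_reals all_analysis.
From mathcomp Require Import ring lra zify.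
Import Order.TTheory GRing.Theory Num.Theory.
Import numFieldNormedType.Exports.

Set Implicit Arguments.
Unset Strict Implicit.
Unset Printing Implicit Defensive.

Local Open Scope ring_scope.

(** * Affine functions on the unit interval *)

Section AffineTransitions.
Variables (R : realFieldType) (K : finType).
Implicit Types (A B : K -> R).

Definition crosses A B k : Prop := exists t, [/\ 0 < t < 1, A k + t * B k = 0 &
  forall j, j != k -> 0 < A j + t * B j].

(** Geometrically, the path [A + t B] meets the boundary of the closed orthant only in the relative
    interior of facets and only at interior times. *)
Definition generic_affine A B := forall t, 0 <= t <= 1 ->
  (forall k, 0 <= A k + t * B k) ->
  (forall j k, A j + t * B j = 0 -> A k + t * B k = 0 -> j = k) /\
  (t = 0 \/ t = 1 -> forall k, A k + t * B k != 0).

(** The open orthant is convex and contains the path at time [t0], so the path enters it at most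
    once, and exactly once if it starts outside. The entry time is the last root of a coordinate
    with positive slope. *)
Lemma affine_entries A B t0 : generic_affine A B -> 0 <= t0 <= 1 ->
  (forall k, 0 < A k + t0 * B k) ->
  (\sum_k (if (0 < B k) && `[<crosses A B k>] then 1 else 0) : int) =
  1 - `[<forall k, 0 < A k>]%:R.
Proof.
move=> gen /andP[t00 t01] pos.
have uniq_cross k k' : 0 < B k -> 0 < B k' -> crosses A B k -> crosses A B k' -> k = k'.
  move=> Bk Bk' [t [/andP[t0' t1] e p]] [t' [/andP[t0'' t1'] e' p']].
  apply/eqP/negPn/negP => ne.
  have := p k' _; rewrite eq_sym ne => /(_ isT) q.
  have := p' k ne => q'.
  have : t' < t by rewrite -(ltr_pM2r Bk'); lra.
  have : t < t' by rewrite -(ltr_pM2r Bk); lra.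
  lra.
case: asboolP => [in0|nin0].
  rewrite big1 ?subrr // => k _; case: ifP => // /andP[Bk /asboolP[t [/andP[t0' _] e _]]].
  exfalso.
  have := in0 k; have : 0 < t * B k by [rewrite mulr_gt0]; lra.
have [k0 Ak0] : exists k, A k <= 0.
  apply: contrapT => /forallNP h; apply: nin0 => k; rewrite ltNge; exact/negP.
have Bk0 : 0 < B k0.
  have := pos k0 => h; have : 0 < t0 * B k0 by lra.
  by rewrite pmulr_rgt0 // lt_neqAle t00 andbT; apply/eqP => e; move: h; rewrite -e; lra.
pose r k := - A k / B k.
have rE k : 0 < B k -> r k * B k = - A k by move=> h; rewrite /r divfK // gt_eqF.
pose k1 := [arg max_(k > k0 | 0 < B k) r k]%O.
have [Bk1 max1] : 0 < B k1 /\ forall k, 0 < B k -> r k <= r k1.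
  by rewrite /k1; case: arg_maxP => // i; split.
have r1 : r k1 < t0 by rewrite -(ltr_pM2r Bk1) rE //; have := pos k1; lra.
have r0 : 0 <= r k1.
  apply: le_trans (max1 _ Bk0); rewrite -(ler_pM2r Bk0) rE //; lra.
have all0 k : 0 <= A k + r k1 * B k.
  have [Bk|Bk] := ltP 0 (B k).
    by have := max1 k Bk; rewrite -(ler_pM2r Bk) rE //; lra.
  have := pos k; have : (t0 - r k1) * B k <= 0 by (rewrite mulr_ge0_le0 //; lra).
  lra.
have z1 : A k1 + r k1 * B k1 = 0 by rewrite rE // subrr.
have [||u1 u2] := gen (r k1) _ _; [lra|exact: all0|].
have cr1 : crosses A B k1.
  exists (r k1); split=> //.
    apply/andP; split; last by lra.
    rewrite lt_neqAle r0 andbT eq_sym; apply/eqP => e.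
    by have := u2 (or_introl e) k1; rewrite z1 eqxx.
  move=> j ne; rewrite lt_neqAle all0 andbT eq_sym; apply: contraNneq ne => e.
  by rewrite (u1 j k1).
rewrite (bigD1 k1) //= Bk1 (asboolT cr1) /= big1 ?addr0 ?subr0 // => k ne.
case: ifP => // /andP[Bk /asboolP ck]; case/eqP: ne; exact: uniq_cross.
Qed.

(** Exits are entries of the reversed path, so [affine_entries] counts both. If the path misses the
    open orthant, both indicators vanish, and a crossing with nonzero slope is impossible, since a
    small change of time would bring the path inside. *)
Lemma affine_transitions A B : generic_affine A B ->
  \sum_k (if `[<crosses A B k>] then sgz (B k) else 0) =
  `[<forall k, 0 < A k + B k>]%:R - `[<forall k, 0 < A k>]%:R.
Proof.
move=> gen.
pose A' k := A k + B k; pose B' k := - B k.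
have E t k : A' k + t * B' k = A k + (1 - t) * B k by rewrite /A' /B'; ring.
have crE k : `[<crosses A' B' k>] = `[<crosses A B k>].
  apply: asbool_equiv_eq; split => -[t [t01 e p]]; exists (1 - t); split; try lra.
  - by rewrite -E.
  - by move=> j /p; rewrite E.
  - by rewrite E subKr.
  - by move=> j /p; rewrite E subKr.
have gen' : generic_affine A' B'.
  move=> t t01 h; have [||u1 u2] := gen (1 - t) _ _; [lra|by move=> k; rewrite -E|].
  split=> [j k|t' k]; first by rewrite !E; exact: u1.
  by rewrite E; apply: u2; case: t' => ->; [right|left]; lra.
have split_sum : \sum_k (if `[<crosses A B k>] then sgz (B k) else 0) =
   \sum_k (if (0 < B k) && `[<crosses A B k>] then 1 else 0)
   - \sum_k (if (0 < B' k) && `[<crosses A' B' k>] then 1 else 0).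
  rewrite -sumrB; apply: eq_bigr => k _; rewrite crE /B' oppr_gt0.
  case: asboolP => _; rewrite ?andbT ?andbF //.
  by case: (sgzP (B k)); rewrite ?subrr ?subr0 ?sub0r.
have [[t0 [t01 pos]]|nopos] := pselect (exists t0, 0 <= t0 <= 1 /\ forall k, 0 < A k + t0 * B k).
  rewrite split_sum (affine_entries gen t01 pos).
  rewrite (affine_entries gen' (_ : 0 <= 1 - t0 <= 1)); first last.
  - by move=> k; rewrite E subKr.
  - lra.
  by rewrite /A'; ring.
rewrite big1 => [|k _]; last first.
  case: asboolP => // -[t [/andP[t0 t1] e p]]; apply: contrapT => /eqP.
  rewrite sgz_eq0 => Bk0; apply: nopos.
  (* [S] exceeds the reciprocals of [t] and [1 - t] and every ratio of [|B j|] to the value of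
     coordinate [j] at time [t]. Hence a time shift by [S^-1] stays in the interval and keeps the
     other coordinates positive. *)
  pose S := 1 + t^-1 + (1 - t)^-1 + \sum_(j | j != k) `|B j| / (A j + t * B j).
  have tV : 0 < t^-1 by rewrite invr_gt0.
  have t1V : 0 < (1 - t)^-1 by rewrite invr_gt0 subr_gt0.
  have sum0 (P : pred K) : {subset P <= [pred j | j != k]} ->
      0 <= \sum_(j | P j) `|B j| / (A j + t * B j).
    by move=> PS; rewrite sumr_ge0 // => j /PS jk; rewrite divr_ge0 // ltW // p.
  have S0 : 0 < S by rewrite /S; have := sum0 (fun j => j != k) (fun=> id); lra.
  have le_S x y : 0 < y -> x / y < S -> x / S < y.
    by move=> y0; rewrite !ltr_pdivrMr // mulrC.
  have St : S^-1 < t.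
    rewrite -(div1r S) le_S // div1r /S; have := sum0 (fun j => j != k) (fun=> id); lra.
  have St1 : S^-1 < 1 - t.
    rewrite -(div1r S) le_S ?subr_gt0 // div1r /S.
    by have := sum0 (fun j => j != k) (fun=> id); lra.
  have S_B j : j != k -> `|B j| / S < A j + t * B j.
    move=> jk; rewrite le_S ?p // /S (bigD1 j) //=.
    by have := sum0 (fun i => (i != k) && (i != j)) (fun i => @proj1 _ _ \o andP); lra.
  exists (t + S^-1 * Num.sg (B k)); split.
    by have SV : 0 < S^-1 by [rewrite invr_gt0]; case: sgrP => _; lra.
  move=> j; have [->|jk] := eqVneq j k.
    rewrite mulrDl addrA e add0r -mulrA mulr_gt0 ?invr_gt0 //.
    by rewrite -normrEsg normr_gt0.
  have := S_B j jk; have : `|S^-1 * Num.sg (B k) * B j| <= `|B j| / S.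
    by rewrite !normrM normr_sg Bk0 mulr1 mulrC (@ger0_norm _ S^-1) ?lexx // invr_ge0 ltW.
  rewrite ler_norml mulrDl addrA => /andP[+ _]; lra.
have nA : `[<forall k, 0 < A k>] = false.
  apply/asboolPn => h; apply: nopos; exists 0; split; first lra.
  by move=> k; rewrite mul0r addr0.
have nB : `[<forall k, 0 < A k + B k>] = false.
  apply/asboolPn => h; apply: nopos; exists 1; split; first lra.
  by move=> k; rewrite mul1r.
by rewrite nA nB subrr.
Qed.
End AffineTransitions.

(** * Crossings and triangles *)

Lemma ord4P (i : 'I_4) : [\/ i = 0, i = 1, i = 2 | i = 3].
Proof.
case: i => -[|[|[|[|//]]]] ?; [apply: Or41|apply: Or42|apply: Or43|apply: Or44]; exact/val_inj.
Qed.

Section Crossing.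
Variable R : realType.
Implicit Types (a b c d p q u v w x y z : 'rV[R]_3).

Definition coord x (i : nat) : R := x ord0 (inord i).

Lemma mx_coord x i j : x i j = coord x j.
Proof. by rewrite (ord1 i) /coord inord_val. Qed.

Lemma coordD i x y : coord (x + y) i = coord x i + coord y i.
Proof. by rewrite /coord mxE. Qed.
Lemma coordN i x : coord (- x) i = - coord x i.
Proof. by rewrite /coord mxE. Qed.
Lemma coordZ i (k : R) x : coord (k *: x) i = k * coord x i.
Proof. by rewrite /coord mxE. Qed.
Lemma coord0 i : coord 0 i = 0.
Proof. by rewrite /coord mxE. Qed.
Definition coordE := (coordD, coordN, coordZ, coord0).

Lemma coordP x y : x = y <->
  [/\ coord x 0 = coord y 0, coord x 1 = coord y 1 & coord x 2 = coord y 2].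
Proof.
split=> [-> //|[e0 e1 e2]]; apply/rowP => -[[|[|[|//]]] ?]; by rewrite !mx_coord.
Qed.

Definition det3 x y z : R :=
  coord x 0 * (coord y 1 * coord z 2 - coord y 2 * coord z 1) -
  coord x 1 * (coord y 0 * coord z 2 - coord y 2 * coord z 0) +
  coord x 2 * (coord y 0 * coord z 1 - coord y 1 * coord z 0).

Lemma det3E x y z : \det (\matrix_(i < 3) [:: x; y; z]`_i) = det3 x y z.
Proof.
rewrite (expand_det_row _ ord0) !big_ord_recl big_ord0 /cofactor.
rewrite !(expand_det_row _ ord0) !big_ord_recl !big_ord0 /cofactor !det_mx11 !mxE /=.
by rewrite !mx_coord /= /bump /= /det3; ring.
Qed.

Lemma cramer3 x y z v : det3 x y z != 0 -> v = (det3 v y z / det3 x y z) *: x +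
  (det3 x v z / det3 x y z) *: y + (det3 x y v / det3 x y z) *: z.
Proof.
move=> D; apply/coordP; rewrite !coordE; split; move: D; rewrite /det3 => D; field; exact: D.
Qed.

Definition meets u a b c d : Prop :=
  exists s t h : R, [/\ 0 < s < 1, 0 < t < 1, 0 < h &
    a + s *: (b - a) + h *: u = c + t *: (d - c)].

Lemma crossingE u a b c d : crossing u a b c d =
  if `[< meets u a b c d >] then sgz (det3 (d - c) (b - a) u) else 0.
Proof. by rewrite /crossing det3E. Qed.

Lemma det3NNr u x y : det3 x y (- u) = det3 y x u.
Proof. by rewrite /det3 !coordE; ring. Qed.

(** Seen from the opposite side, over and under are exchanged, and the determinant stays the
    same. *)
Lemma crossing_swap u a b c d : crossing (- u) c d a b = crossing u a b c d.
Proof.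
rewrite !crossingE det3NNr; congr (if _ then _ else _).
apply: asbool_equiv_eq; split => -[s [t [h [s01 t01 h0 e]]]]; exists t, s, h; split=> //.
  by rewrite -e scalerN subrK.
by rewrite -e scalerN addrK.
Qed.

Lemma crossing_rev u a b c d : crossing u b a c d = - crossing u a b c d.
Proof.
rewrite !crossingE.
have -> : `[< meets u b a c d >] = `[< meets u a b c d >].
  apply: asbool_equiv_eq; split => -[s [t [h [s01 t01 h0 e]]]]; exists (1 - s), t, h;
    (split=> //; first by lra); by rewrite -e; apply/coordP; rewrite !coordE; split; ring.
case: ifP => _; rewrite ?oppr0 // -sgzN; congr sgz; rewrite /det3 !coordE; ring.
Qed.

(** The height [h] may have either sign: only the projections of [x] and of the segment are
    compared. *)
Definition under u x a b : Prop :=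
  exists t h : R, 0 <= t <= 1 /\ x = a + t *: (b - a) + h *: u.

Definition in_triangle a b c x : Prop :=
  exists s t : R, [/\ 0 <= s, 0 <= t, s + t <= 1 &
                  x = a + s *: (b - a) + t *: (c - a)].

Definition pierces a b c p q : Prop :=
  exists r s t : R, [/\ 0 < r < 1, [/\ 0 < s, 0 < t & s + t < 1] &
    p + r *: (q - p) = a + s *: (b - a) + t *: (c - a)].

Definition piercing a b c p q : int :=
  if `[< pierces a b c p q >] then sgz (det3 (b - a) (c - a) (q - p)) else 0.

Definition above u a b c p : Prop :=
  exists s t h : R, [/\ [/\ 0 < s, 0 < t & s + t < 1], 0 < h &
    p = a + s *: (b - a) + t *: (c - a) + h *: u].

Definition above_sign u a b c p : int :=
  if `[< above u a b c p >] then sgz (det3 (b - a) (c - a) u) else 0.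

Definition seg_disjoint a b c d : Prop := forall s t : R, 0 <= s <= 1 -> 0 <= t <= 1 ->
  a + s *: (b - a) <> c + t *: (d - c).

(* Along [p, q], follow the barycentric coordinates of the projection to the
   plane of the triangle, and the height above this plane. *)
Lemma triangle_crossing_transversal u a b c p q :
  det3 (b - a) (c - a) u != 0 ->
  (forall x, x = a \/ x = b \/ x = c -> ~ under u x p q) ->
  (forall x, x = p \/ x = q ->
     [/\ ~ under u x a b, ~ under u x b c, ~ under u x c a & ~ in_triangle a b c x]) ->
  seg_disjoint a b p q -> seg_disjoint b c p q -> seg_disjoint c a p q ->
  crossing u a b p q + crossing u b c p q + crossing u c a p q =
  above_sign u a b c p - above_sign u a b c q + piercing a b c p q.
Proof.
move=> D0 nabc npq ab bc ca.
pose e1 := b - a; pose e2 := c - a; pose D := det3 e1 e2 u.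
pose Y1 v := det3 v e2 u / D; pose Y2 v := det3 e1 v u / D; pose Y3 v := det3 e1 e2 v / D.
have YE v : v = Y1 v *: e1 + Y2 v *: e2 + Y3 v *: u by exact: cramer3.
have Yuniq k1 k2 k3 v : v = k1 *: e1 + k2 *: e2 + k3 *: u ->
    [/\ Y1 v = k1, Y2 v = k2 & Y3 v = k3].
  move=> ->; split; apply: (mulIf D0); rewrite /Y1 /Y2 /Y3 divfK //;
    by rewrite /D /det3 !coordE; ring.
(* Coordinates 0, 1, 2 vanish in the vertical planes over [ab], [bc], [ca], and coordinate 3 is the
   height over the plane of the triangle. All four are positive exactly in the open prism above the
   triangle, so its facets record the three crossings and the piercing. *)
pose A k := nth 0 [:: Y2 (p - a); 1 - Y1 (p - a) - Y2 (p - a); Y1 (p - a); Y3 (p - a)] (k : 'I_4).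
pose B k := nth 0 [:: Y2 (q - p); - Y1 (q - p) - Y2 (q - p); Y1 (q - p); Y3 (q - p)] (k : 'I_4).
pose Z1 t := Y1 (p - a) + t * Y1 (q - p).
pose Z2 t := Y2 (p - a) + t * Y2 (q - p).
pose Z3 t := Y3 (p - a) + t * Y3 (q - p).
have ZE t : p + t *: (q - p) = a + Z1 t *: e1 + Z2 t *: e2 + Z3 t *: u.
  have -> : p + t *: (q - p) = a + ((p - a) + t *: (q - p)).
    by apply/coordP; rewrite !coordE; split; ring.
  rewrite {1}(YE (p - a)) {1}(YE (q - p)) /Z1 /Z2 /Z3.
  by apply/coordP; rewrite !coordE; split; ring.
have Zuniq t k1 k2 k3 : p + t *: (q - p) = a + k1 *: e1 + k2 *: e2 + k3 *: u ->
    [/\ Z1 t = k1, Z2 t = k2 & Z3 t = k3].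
  move=> e; have [] := @Yuniq k1 k2 k3 (p - a + t *: (q - p)).
    have -> : p - a + t *: (q - p) = p + t *: (q - p) - a.
      by apply/coordP; rewrite !coordE; split; ring.
    by rewrite e; apply/coordP; rewrite !coordE; split; ring.
  have lin (f := fun v => (Y1 v, Y2 v, Y3 v)) v w :
    [/\ Y1 (v + t *: w) = Y1 v + t * Y1 w, Y2 (v + t *: w) = Y2 v + t * Y2 w
     & Y3 (v + t *: w) = Y3 v + t * Y3 w].
    by split; rewrite /Y1 /Y2 /Y3 /det3 !coordE; ring.
  by have [-> -> ->] := lin (p - a) (q - p).
pose l (k : 'I_4) t := A k + t * B k.
have lE t : [/\ l 0 t = Z2 t, l 1 t = 1 - Z1 t - Z2 t, l 2 t = Z1 t & l 3 t = Z3 t].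
  by split; rewrite /l /A /B /Z1 /Z2 /Z3 /=; ring.
have gen : generic_affine A B.
  move=> t t01 pos.
  have [z1 z2 z3 z4] := lE t.
  have pz1 : 0 <= Z2 t by rewrite -z1; exact: pos.
  have pz2 : 0 <= 1 - Z1 t - Z2 t by rewrite -z2; exact: pos.
  have pz3 : 0 <= Z1 t by rewrite -z3; exact: pos.
  have n12 : Z2 t = 0 -> 1 - Z1 t - Z2 t = 0 -> False.
    move=> h2 h1; apply: (nabc b); first by right; left.
    exists t, (- Z3 t); split=> //; rewrite ZE h2 (_ : Z1 t = 1); last lra.
    by apply/coordP; rewrite !coordE; split; ring.
  have n13 : Z2 t = 0 -> Z1 t = 0 -> False.
    move=> h2 h1; apply: (nabc a); first by left.
    exists t, (- Z3 t); split=> //; rewrite ZE h2 h1.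
    by apply/coordP; rewrite !coordE; split; ring.
  have n23 : 1 - Z1 t - Z2 t = 0 -> Z1 t = 0 -> False.
    move=> h2 h1; apply: (nabc c); first by right; right.
    exists t, (- Z3 t); split=> //; rewrite ZE h1 (_ : Z2 t = 1); last lra.
    by apply/coordP; rewrite !coordE; split; ring.
  have n14 : Z2 t = 0 -> Z3 t = 0 -> False.
    move=> h2 h3; apply: (ab (Z1 t) t) => //; first lra.
    rewrite ZE h2 h3; by apply/coordP; rewrite !coordE; split; ring.
  have n24 : 1 - Z1 t - Z2 t = 0 -> Z3 t = 0 -> False.
    move=> h2 h3; apply: (bc (Z2 t) t) => //; first lra.
    rewrite ZE h3 (_ : Z1 t = 1 - Z2 t); last lra.
    by apply/coordP; rewrite !coordE; split; ring.
  have n34 : Z1 t = 0 -> Z3 t = 0 -> False.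
    move=> h2 h3; apply: (ca (1 - Z2 t) t) => //; first lra.
    by rewrite ZE h2 h3; apply/coordP; rewrite !coordE; split; ring.
  split.
    move=> j k; rewrite -/(l j t) -/(l k t).
    by case: (ord4P j) => ->; case: (ord4P k) => ->; rewrite ?z1 ?z2 ?z3 ?z4 // => h h'; exfalso; auto.
  move=> t_end k; have [x [xE xpq]] : exists x, x = p + t *: (q - p) /\ (x = p \/ x = q).
    exists (p + t *: (q - p)); split=> //.
    by case: t_end => ->; [left|right]; apply/coordP; rewrite !coordE; split; ring.
  have [xab xbc xca xabc] := npq x xpq.
  apply/eqP; rewrite -/(l k t); case: (ord4P k) => ->; rewrite ?z1 ?z2 ?z3 ?z4 => h.
  - apply: xab; exists (Z1 t), (Z3 t); split; first lra.
    by rewrite xE ZE h; apply/coordP; rewrite !coordE; split; ring.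
  - apply: xbc; exists (Z2 t), (Z3 t); split; first lra.
    rewrite xE ZE (_ : Z1 t = 1 - Z2 t); last lra.
    by apply/coordP; rewrite !coordE; split; ring.
  - apply: xca; exists (1 - Z2 t), (Z3 t); split; first lra.
    by rewrite xE ZE h; apply/coordP; rewrite !coordE; split; ring.
  - apply: xabc; exists (Z1 t), (Z2 t); split=> //; first lra.
    by rewrite xE ZE h; apply/coordP; rewrite !coordE; split; ring.
have D0' : D != 0 by [].
have c1 : crossing u a b p q = - sgz D * (if `[<crosses A B 0>] then sgz (B 0) else 0).
  rewrite crossingE (_ : `[<crosses A B 0>] = `[<meets u a b p q>]).
    case: ifP => _; rewrite ?mulr0 // mulNr -sgzM -sgzN /B /=; congr sgz.
    by rewrite mulrC /Y2 divfK // /det3 !coordE; ring.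
  apply: asbool_equiv_eq; split=> [[t [t01 e h]]|[s [t [k [s01 t01 k0 e]]]]].
    have [z1 z2 z3 z4] := lE t.
    have h1 : 0 < l 1 t := h 1 isT.
    have h2 : 0 < l 2 t := h 2 isT.
    have h3 : 0 < l 3 t := h 3 isT.
    have h0 : l 0 t = 0 := e.
    rewrite z1 in h0; rewrite z2 in h1; rewrite z3 in h2; rewrite z4 in h3.
    exists (Z1 t), t, (Z3 t); split=> //; first lra.
    by rewrite ZE h0; apply/coordP; rewrite !coordE; split; ring.
  have [z1 z2 z3 z4] := lE t.
  have [y1 y2 y3] : [/\ Z1 t = s, Z2 t = 0 & Z3 t = k].
    by apply: Zuniq; rewrite -e; apply/coordP; rewrite !coordE; split; ring.
  exists t; split; [by []|exact: etrans z1 y2|].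
  by move=> j; rewrite -/(l j t); case: (ord4P j) => ->; rewrite ?z1 ?z2 ?z3 ?z4 // => _; lra.
have c2 : crossing u b c p q = - sgz D * (if `[<crosses A B 1>] then sgz (B 1) else 0).
  rewrite crossingE (_ : `[<crosses A B 1>] = `[<meets u b c p q>]).
    case: ifP => _; rewrite ?mulr0 // mulNr -sgzM -sgzN /B /=; congr sgz.
    rewrite mulrC mulrBl mulNr /Y1 /Y2 !divfK //.
    by rewrite /det3 !coordE; ring.
  apply: asbool_equiv_eq; split=> [[t [t01 e h]]|[s [t [k [s01 t01 k0 e]]]]].
    have [z1 z2 z3 z4] := lE t.
    have h1 : l 1 t = 0 := e.
    have h2 : 0 < l 2 t := h 2 isT.
    have h3 : 0 < l 3 t := h 3 isT.
    have h0 : 0 < l 0 t := h 0 isT.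
    rewrite z1 in h0; rewrite z2 in h1; rewrite z3 in h2; rewrite z4 in h3.
    exists (Z2 t), t, (Z3 t); split=> //; first lra.
    rewrite ZE (_ : Z1 t = 1 - Z2 t); last lra.
    by apply/coordP; rewrite !coordE; split; ring.
  have [z1 z2 z3 z4] := lE t.
  have [y1 y2 y3] : [/\ Z1 t = 1 - s, Z2 t = s & Z3 t = k].
    by apply: Zuniq; rewrite -e; apply/coordP; rewrite !coordE; split; ring.
  exists t; split; [by []|by apply: etrans z2 _; lra|].
  by move=> j; rewrite -/(l j t); case: (ord4P j) => ->; rewrite ?z1 ?z2 ?z3 ?z4 // => _; lra.
have c3 : crossing u c a p q = - sgz D * (if `[<crosses A B 2>] then sgz (B 2) else 0).
  rewrite crossingE (_ : `[<crosses A B 2>] = `[<meets u c a p q>]).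
    case: ifP => _; rewrite ?mulr0 // mulNr -sgzM -sgzN /B /=; congr sgz.
    by rewrite mulrC /Y1 divfK // /det3 !coordE; ring.
  apply: asbool_equiv_eq; split=> [[t [t01 e h]]|[s [t [k [s01 t01 k0 e]]]]].
    have [z1 z2 z3 z4] := lE t.
    have h1 : 0 < l 1 t := h 1 isT.
    have h2 : l 2 t = 0 := e.
    have h3 : 0 < l 3 t := h 3 isT.
    have h0 : 0 < l 0 t := h 0 isT.
    rewrite z1 in h0; rewrite z2 in h1; rewrite z3 in h2; rewrite z4 in h3.
    exists (1 - Z2 t), t, (Z3 t); split=> //; first lra.
    by rewrite ZE h2; apply/coordP; rewrite !coordE; split; ring.
  have [z1 z2 z3 z4] := lE t.
  have [y1 y2 y3] : [/\ Z1 t = 0, Z2 t = 1 - s & Z3 t = k].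
    by apply: Zuniq; rewrite -e; apply/coordP; rewrite !coordE; split; ring.
  exists t; split; [by []|exact: etrans z3 y1|].
  by move=> j; rewrite -/(l j t); case: (ord4P j) => ->; rewrite ?z1 ?z2 ?z3 ?z4 // => _; lra.
have c4 : piercing a b c p q = sgz D * (if `[<crosses A B 3>] then sgz (B 3) else 0).
  rewrite /piercing (_ : `[<crosses A B 3>] = `[<pierces a b c p q>]).
    by case: ifP => _; rewrite ?mulr0 // -sgzM /B /= mulrC /Y3 divfK.
  apply: asbool_equiv_eq; split=> [[t [t01 e h]]|[t [s [s' [t01 [s0 s0' s1] e]]]]].
    have [z1 z2 z3 z4] := lE t.
    have h1 : 0 < l 1 t := h 1 isT.
    have h2 : 0 < l 2 t := h 2 isT.
    have h3 : l 3 t = 0 := e.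
    have h0 : 0 < l 0 t := h 0 isT.
    rewrite z1 in h0; rewrite z2 in h1; rewrite z3 in h2; rewrite z4 in h3.
    exists t, (Z1 t), (Z2 t); split=> //; first by split=> //; lra.
    by rewrite ZE h3 scale0r addr0.
  have [z1 z2 z3 z4] := lE t.
  have [y1 y2 y3] : [/\ Z1 t = s, Z2 t = s' & Z3 t = 0].
    by apply: Zuniq; rewrite e scale0r addr0.
  exists t; split; [by []|exact: etrans z4 y3|].
  by move=> j; rewrite -/(l j t); case: (ord4P j) => ->; rewrite ?z1 ?z2 ?z3 ?z4 // => _; lra.
have above_l x t : x = p + t *: (q - p) ->
    above_sign u a b c x = sgz D * (`[<forall k, 0 < l k t>])%:R.
  move=> xE; have [z1 z2 z3 z4] := lE t.
  rewrite /above_sign (_ : `[<above u a b c x>] = `[<forall k, 0 < l k t>]).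
    by case: ifP => _; rewrite ?mulr1 ?mulr0.
  apply: asbool_equiv_eq; split=> [[s [s' [k [[s0 s0' s1] k0 e]]]] j|pos].
    have [y1 y2 y3] : [/\ Z1 t = s, Z2 t = s' & Z3 t = k] by apply: Zuniq; rewrite -xE.
    by case: (ord4P j) => ->; rewrite ?z1 ?z2 ?z3 ?z4 // ?y1 ?y2 ?y3 //; lra.
  have := pos 0; have := pos 1; have := pos 2; have := pos 3.
  rewrite z1 z2 z3 z4 => ? ? ? ?.
  exists (Z1 t), (Z2 t), (Z3 t); split=> //; last by rewrite xE ZE.
  by split=> //; lra.
have := affine_transitions gen.
rewrite !big_ord_recl big_ord0 addr0.
rewrite (_ : lift ord0 ord0 = 1 :> 'I_4); last exact/val_inj.
rewrite (_ : lift ord0 (lift ord0 ord0) = 2 :> 'I_4); last exact/val_inj.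
rewrite (_ : lift ord0 (lift ord0 (lift ord0 ord0)) = 3 :> 'I_4); last exact/val_inj.
rewrite c1 c2 c3 c4 (above_l p 0) ?scale0r ?addr0 // (above_l q 1); last by rewrite scale1r subrKC.
have -> : `[<forall k, 0 < l k 0>] = `[<forall k, 0 < A k>].
  by congr asbool; apply: eq_forall => k; rewrite /l mul0r addr0.
have -> : `[<forall k, 0 < l k 1>] = `[<forall k, 0 < A k + B k>].
  by congr asbool; apply: eq_forall => k; rewrite /l mul1r.
set X1 := (if _ then _ else _); set X2 := (if _ then _ else _).
set X3 := (if _ then _ else _); set X4 := (if _ then _ else _).
move=> e; transitivity (- sgz D * (X1 + (X2 + (X3 + X4))) + sgz D * X4); first by ring.
by rewrite e; ring.
Qed.
End Crossing.

(** * Triangles with a side parallel to the projection *)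

Section ParallelTriangle.
Variable R : realType.
Implicit Types (a b c d p q u v w x y z : 'rV[R]_3).

(** The triangle projects to a segment, the image of both [bc] and [ca]. Where [[p, q]] crosses it,
    the triangle is pierced exactly when [[p, q]] passes above one of these sides and below the
    other. The two crossings have opposite signs and cancel otherwise. *)
Lemma triangle_crossing_parallel u a b c p q (m : R) : b - a = m *: u ->
  seg_disjoint b c p q -> seg_disjoint c a p q ->
  crossing u a b p q + crossing u b c p q + crossing u c a p q = piercing a b c p q.
Proof.
move=> bE; have {bE} -> : b = a + m *: u by rewrite -bE subrKC.
move=> bc ca.
pose E := det3 (q - p) (c - a) u.
have -> : crossing u a (a + m *: u) p q = 0.
  rewrite crossingE (_ : det3 _ _ _ = 0) ?sgz0 ?if_same //.
  by rewrite /det3 !coordE; ring.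
have dbc : det3 (q - p) (c - (a + m *: u)) u = E by rewrite /E /det3 !coordE; ring.
have dca : det3 (q - p) (a - c) u = - E by rewrite /E /det3 !coordE; ring.
have dI : det3 (a + m *: u - a) (c - a) (q - p) = - (m * E).
  by rewrite /E /det3 !coordE; ring.
rewrite add0r !crossingE /piercing dbc dca dI.
have [->|E0] := eqVneq E 0; first by rewrite mulr0 oppr0 sgz0 !if_same.
have uniq_sol s t k s' t' k' : a + s *: (c - a) + k *: u = p + t *: (q - p) ->
    a + s' *: (c - a) + k' *: u = p + t' *: (q - p) -> [/\ s = s', t = t' & k = k'].
  move=> e e'.
  have e0 : a + s *: (c - a) + k *: u - (a + s' *: (c - a) + k' *: u) =
     p + t *: (q - p) - (p + t' *: (q - p)) by rewrite e e'.
  move/coordP: e0; rewrite !coordE => -[a0 a1 a2].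
  have e1 : (s - s') *: (c - a) = (t - t') *: (q - p) - (k - k') *: u.
    by apply/coordP; rewrite !coordE; split; lra.
  have e2 : (t - t') *: (q - p) = (s - s') *: (c - a) + (k - k') *: u.
    by rewrite e1 subrK.
  have e3 : (k - k') *: u = (t - t') *: (q - p) - (s - s') *: (c - a).
    by rewrite e1 subKr.
  have d1 : (s - s') * E = 0.
    transitivity (det3 (q - p) ((s - s') *: (c - a)) u).
      by rewrite /E /det3 !coordE; ring.
    by rewrite e1 /det3 !coordE; ring.
  have d2 : (t - t') * E = 0.
    transitivity (det3 ((t - t') *: (q - p)) (c - a) u).
      by rewrite /E /det3 !coordE; ring.
    by rewrite e2 /det3 !coordE; ring.
  have d3 : (k - k') * E = 0.
    transitivity (det3 (q - p) (c - a) ((k - k') *: u)).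
      by rewrite /E /det3 !coordE; ring.
    by rewrite e3 /det3 !coordE; ring.
  by move/eqP: d1; move/eqP: d2; move/eqP: d3; rewrite !mulf_eq0 (negPf E0) !orbF !subr_eq0
    => /eqP-> /eqP-> /eqP->.
have bcE s k : a + m *: u + s *: (c - (a + m *: u)) + k *: u =
    a + s *: (c - a) + (k + (1 - s) * m) *: u.
  by apply/coordP; rewrite !coordE; split; ring.
have caE s k : c + s *: (a - c) + k *: u = a + (1 - s) *: (c - a) + k *: u.
  by apply/coordP; rewrite !coordE; split; ring.
have IE s s' : a + s *: (a + m *: u - a) + s' *: (c - a) = a + s' *: (c - a) + (s * m) *: u.
  by apply/coordP; rewrite !coordE; split; ring.
have [[s [t [k [s01 t01 e]]]]|none] := pselect (exists s t k : R, [/\ 0 < s < 1, 0 < t < 1 &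
   a + s *: (c - a) + k *: u = p + t *: (q - p)]); last first.
  rewrite !asboolF //.
  - by move=> [r [y [y' [r01 [y0 y0' y1] e']]]]; apply: none; exists y', r, (y * m);
      split=> //; [lra | rewrite e' IE].
  - by move=> [s [t [k [s01 t01 k0 e]]]]; apply: none; exists (1 - s), t, k;
      split=> //; [lra | rewrite -e caE].
  - by move=> [s [t [k [s01 t01 k0 e]]]]; apply: none; exists s, t, (k + (1 - s) * m);
      split=> //; rewrite -e bcE.
(* At the common projected point [k] is the height of [[p, q]] over [ca], and [k - (1 - s) * m] its
   height over [bc]; disjointness makes both nonzero. *)
have k0 : k != 0.
  apply/eqP => k0; apply: (ca (1 - s) t); [lra|lra|].
  by rewrite -e k0 scale0r addr0; apply/coordP; rewrite !coordE; split; ring.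
have k1 : k - (1 - s) * m != 0.
  apply/eqP => k1; apply: (bc s t); [lra|lra|].
  rewrite -e (_ : k = (1 - s) * m); last lra.
  by apply/coordP; rewrite !coordE; split; ring.
have -> : `[<meets u (a + m *: u) c p q>] = (0 < k - (1 - s) * m).
  apply/asboolP/idP => [[s' [t' [k' [s01' t01' k0' e']]]]|kpos].
    rewrite bcE in e'; have [-> _ ->] := uniq_sol _ _ _ _ _ _ e e'; lra.
  by exists s, t, (k - (1 - s) * m); split=> //; rewrite bcE subrK.
have -> : `[<meets u c a p q>] = (0 < k).
  apply/asboolP/idP => [[s' [t' [k' [s01' t01' k0' e']]]]|kpos].
    by rewrite caE in e'; have [_ _ ->] := uniq_sol _ _ _ _ _ _ e e'.
  by exists (1 - s), t, k; split=> //; [lra|rewrite caE subKr].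
have -> : `[<pierces a (a + m *: u) c p q>] = (0 < k * m) && (0 < ((1 - s) * m - k) * m).
  apply/asboolP/andP => [[t' [y [s' [t01' [y0 s0' ys] e']]]]|[km1 km2]].
    rewrite IE in e'; have [es et ek] := uniq_sol _ _ _ _ _ _ e (esym e').
    have m0 : m != 0 by apply: contraNneq k0 => m0; rewrite ek m0 mulr0.
    have m2 : 0 < m * m by rewrite -expr2 exprn_even_gt0.
    rewrite ek es; split; first by rewrite -mulrA mulr_gt0.
    by rewrite -mulrBl -mulrA mulr_gt0 //; lra.
  have m0 : m != 0 by apply: contraTneq km1 => ->; rewrite mulr0 ltxx.
  have m2 : 0 < m * m by rewrite -expr2 exprn_even_gt0.
  have kmE : k / m * m = k by rewrite divfK.
  exists t, (k / m), s; split=> //; last by rewrite IE kmE.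
  split; [|lra|].
    by rewrite -(ltr_pM2r m2) mul0r mulrA kmE.
  suff : 0 < 1 - s - k / m by lra.
  rewrite -(ltr_pM2r m2) mul0r mulrA.
  by rewrite (_ : (1 - s - k / m) * m = (1 - s) * m - k) // mulrBl kmE.
have s1 : 0 < 1 - s by lra.
rewrite !sgzN sgzM.
have [m0|m0|->] := ltgtP m 0; last first.
- by rewrite !mulr0 ltxx sgz0 mul0r subr0 oppr0 /=; case: ifP; rewrite ?subrr ?addr0 // addrN.
- rewrite (gtr0_sgz m0) !(pmulr_lgt0 _ m0).
  have h : 0 < (1 - s) * m by rewrite mulr_gt0.
  have [kp|kn|ke] := ltgtP k 0; last by rewrite ke eqxx in k0.
    rewrite subr_gt0 lt_gtF ?(lt_trans kp h) //=; ring.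
  rewrite !subr_gt0 /=; case: ltgtP => //= [_|_|e']; rewrite ?mul1r; try ring.
  by move: k1; rewrite -e' subrr eqxx.
- rewrite (ltr0_sgz m0) !(nmulr_lgt0 _ m0).
  have h : (1 - s) * m < 0 by rewrite pmulr_rlt0.
  have [kp|kn|ke] := ltgtP k 0; last by rewrite ke eqxx in k0.
    rewrite subr_lt0 subr_gt0.
    by case: ltgtP => //= _; ring.
  rewrite subr_gt0 (lt_trans h kn) /=; ring.
Qed.
End ParallelTriangle.

(** * Points off finitely many planes, and cones *)

Section GenericApex.
Variable R : realType.
Implicit Types (a b c d p q u v w x y z : 'rV[R]_3).

Definition off_plane w x v1 v2 : Prop := forall s t : R, w <> x + s *: v1 + t *: v2.

Lemma normal_vector v1 v2 : exists n, [/\ n != 0,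
  coord n 0 * coord v1 0 + coord n 1 * coord v1 1 + coord n 2 * coord v1 2 = 0 &
  coord n 0 * coord v2 0 + coord n 1 * coord v2 1 + coord n 2 * coord v2 2 = 0].
Proof.
pose M : 'M[R]_(3, 1 + 1) := row_mx v1^T v2^T.
have : kermx M != 0.
  rewrite -mxrank_eq0 mxrank_ker subn_eq0 -ltnNge.
  by apply: leq_ltn_trans (rank_leq_col M) _.
case/rowV0Pn => n /sub_kermxP nM n0; exists n.
move: nM; rewrite /M mul_mx_row => /eqP; rewrite row_mx_eq0 => /andP[/eqP e1 /eqP e2].
have dot v : n *m v^T = 0 ->
    coord n 0 * coord v 0 + coord n 1 * coord v 1 + coord n 2 * coord v 2 = 0.
  move/matrixP/(_ ord0 ord0); rewrite !mxE !big_ord_recl big_ord0 !mxE !mx_coord /=.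
  by rewrite addr0 addrA.
by split=> //; exact: dot.
Qed.

(** The moment curve [(t, t^2, t^3)], translated to start at [c], meets each plane only at roots of
    a nonzero polynomial whose coefficients come from a normal vector. A non-root of the product of
    these polynomials, taken small enough, gives [w]. *)
Lemma exists_off_planes (S : seq ('rV[R]_3 * 'rV[R]_3 * 'rV[R]_3)) c (r : R) : 0 < r ->
  exists w, `|w - c| < r /\ forall s, s \in S -> off_plane w s.1.1 s.1.2 s.2.
Proof.
move=> r0.
pose curve (t : R) : 'rV[R]_3 := \row_i t ^+ i.+1.
have coord_curve t i : (i < 3)%N -> coord (curve t) i = t ^+ i.+1.
  by move=> i3; rewrite /coord mxE inordK.
have [f [f0 fS]] : exists f : {poly R}, f != 0 /\ forall t, f.[t] != 0 ->
   forall s, s \in S -> off_plane (c + curve t) s.1.1 s.1.2 s.2.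
  elim: S => [|[[x v1] v2] S [f [f0 fS]]]; first by exists 1; rewrite oner_eq0.
  have [n [n0 n1 n2]] := normal_vector v1 v2.
  pose k := coord n 0 * coord (c - x) 0 + coord n 1 * coord (c - x) 1 + coord n 2 * coord (c - x) 2.
  pose g : {poly R} := Poly [:: k; coord n 0; coord n 1; coord n 2].
  have g0 : g != 0.
    apply: contraNneq n0 => e; apply/eqP/coordP; rewrite !coord0.
    have ge i : g`_i = 0 by rewrite e coef0.
    by have := ge 1; have := ge 2; have := ge 3; rewrite !coef_Poly /=.
  exists (g * f); split=> [|t]; first by rewrite mulf_neq0.
  rewrite hornerM mulf_eq0 negb_or => /andP[gt ft] s; rewrite inE => /predU1P[->|]; last exact: fS.
  move=> /= s1 s2 e; move/eqP: gt; apply.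
  rewrite /g horner_Poly /=.
  move/coordP: e; rewrite !coordE !coord_curve // => -[e0 e1 e2].
  transitivity (coord n 0 * (coord c 0 + t ^+ 1 - coord x 0) + coord n 1 * (coord c 1 + t ^+ 2 - coord x 1)
     + coord n 2 * (coord c 2 + t ^+ 3 - coord x 2)).
    by rewrite /k !coordE; ring.
  rewrite e0 e1 e2.
  transitivity (s1 * (coord n 0 * coord v1 0 + coord n 1 * coord v1 1 + coord n 2 * coord v1 2) +
    s2 * (coord n 0 * coord v2 0 + coord n 1 * coord v2 1 + coord n 2 * coord v2 2)); first by ring.
  by rewrite n1 n2 !mulr0 addr0.
pose d := Num.min r 1.
have d0 : 0 < d by rewrite lt_min r0 ltr01.
(* These are [size f] distinct points, too many to be all roots of [f]; the denominators start at 2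
   so that the points lie strictly below [d]. *)
pose ts := [seq d / i.+2%:R | i <- iota 0 (size f)].
have uts : uniq ts.
  rewrite map_inj_uniq ?iota_uniq // => i j /(mulfI (lt0r_neq0 d0)) /invr_inj /eqP.
  by rewrite eqr_nat => /eqP [].
have [t tts ft] : exists2 t, t \in ts & f.[t] != 0.
  apply: contrapT => h; have : all (root f) ts.
    apply/allP => t tts; apply/rootP/eqP/negPn/negP => ft; apply: h; by exists t.
  by move/(max_poly_roots f0)/(_ uts); rewrite size_map size_iota ltnn.
exists (c + curve t); split; last exact: fS.
have [i _ tE] := mapP tts.
have t01 : 0 < t < d.
  by rewrite tE divr_gt0 ?ltr0n //= ltr_pdivrMr ?ltr0n // ltr_pMr // ltr1n.
have [t0 td] := andP t01.
have t1 : t < 1 by apply: lt_le_trans td _; rewrite ge_min lexx orbT.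
have tr : t < r by apply: lt_le_trans td _; rewrite ge_min lexx.
rewrite addrC addKr; apply: le_lt_trans tr.
rewrite [leLHS]/Num.Def.normr /= mx_normrE; apply/bigmax_leP; split=> [|[k l] _]; first exact: ltW.
have t0w := ltW t0; have t1w := ltW t1.
by rewrite mxE ger0_norm ?exprn_ge0 // exprS -[leRHS]mulr1 ler_wpM2l // exprn_ile1.
Qed.

Lemma det3_eq0_span x y z : z != 0 -> det3 x y z = 0 ->
  (exists m : R, x = m *: z) \/ exists s t : R, y = s *: x + t *: z.
Proof.
move=> z0 D0.
(* Up to sign, the coordinates of the cross product of [x] and [z]. If one of them is nonzero, [y]
   can be solved for; if all vanish, [x] is a multiple of [z]. *)
pose n0 := coord x 1 * coord z 2 - coord x 2 * coord z 1.
pose n1 := coord x 0 * coord z 2 - coord x 2 * coord z 0.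
pose n2 := coord x 0 * coord z 1 - coord x 1 * coord z 0.
have solve (n s t : R) : n != 0 ->
    n *: y = s *: x + t *: z -> exists s t : R, y = s *: x + t *: z.
  move=> nz e; exists (s / n), (t / n); apply: (scalerI nz).
  by rewrite e scalerDr !scalerA ![n * _]mulrC !divfK.
have [e0|e0] := eqVneq n0 0; last first.
  right; apply: (solve _ (coord y 1 * coord z 2 - coord y 2 * coord z 1)
    (coord x 1 * coord y 2 - coord x 2 * coord y 1) e0).
  apply/coordP; rewrite !coordE; split.
  - by rewrite -[LHS]addr0 -D0 /n0 /det3; ring.
  - by rewrite /n0; ring.
  - by rewrite /n0; ring.
have [e1|e1] := eqVneq n1 0; last first.
  right; apply: (solve _ (coord y 0 * coord z 2 - coord y 2 * coord z 0)
    (coord x 0 * coord y 2 - coord x 2 * coord y 0) e1).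
  apply/coordP; rewrite !coordE; split.
  - by rewrite /n1; ring.
  - by rewrite -[LHS]subr0 -D0 /n1 /det3; ring.
  - by rewrite /n1; ring.
have [e2|e2] := eqVneq n2 0; last first.
  right; apply: (solve _ (coord y 0 * coord z 1 - coord y 1 * coord z 0)
    (coord x 0 * coord y 1 - coord x 1 * coord y 0) e2).
  apply/coordP; rewrite !coordE; split.
  - by rewrite /n2; ring.
  - by rewrite /n2; ring.
  - by rewrite -[LHS]addr0 -D0 /n2 /det3; ring.
left; rewrite /n0 in e0; rewrite /n1 in e1; rewrite /n2 in e2; have par (n k : R) : n != 0 -> n *: x = k *: z -> exists m : R, x = m *: z.
  move=> nz e; exists (k / n); apply: (scalerI nz).
  by rewrite e scalerA [n * _]mulrC divfK.
have [z0'|z0'] := eqVneq (coord z 0) 0; last first.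
  by apply: (par _ (coord x 0) z0'); apply/coordP; rewrite !coordE; split; lra.
have [z1'|z1'] := eqVneq (coord z 1) 0; last first.
  by apply: (par _ (coord x 1) z1'); apply/coordP; rewrite !coordE; split; lra.
have [z2'|z2'] := eqVneq (coord z 2) 0; last first.
  by apply: (par _ (coord x 2) z2'); apply/coordP; rewrite !coordE; split; lra.
by case/eqP: z0; apply/coordP; rewrite !coord0.
Qed.

Definition seg_generic u x a b : Prop := forall h t : R, 0 <= t <= 1 -> x + h *: u <> a + t *: (b - a).

Lemma seg_genericN u x a b : seg_generic u x a b -> ~ under u x a b.
Proof.
move=> g [t [h [t01 e]]]; apply: (g (- h) t t01).
by rewrite e scaleNr addrK.
Qed.

Section Cone.
Variables (u a b p q w : 'rV[R]_3).
Hypothesis u0 : u != 0.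
Hypothesis ap : seg_generic u a p q.
Hypothesis bp : seg_generic u b p q.
Hypothesis pab : seg_generic u p a b.
Hypothesis qab : seg_generic u q a b.
Hypothesis abpq : seg_disjoint a b p q.
Hypothesis off_u : forall x y, x \in [:: a; b; p; q] -> y \in [:: a; b; p; q] -> off_plane w x (y - x) u.
Hypothesis off : forall x y z, x \in [:: a; b; p; q] -> y \in [:: a; b; p; q] ->
  z \in [:: a; b; p; q] -> off_plane w x (y - x) (z - x).

(** Each degeneracy that [triangle_crossing_transversal] excludes would either put [w] in a
    forbidden plane or contradict the position of the two segments. If the triangle is parallel to
    [u], then since [w] avoids the planes parallel to [u], the side [ab] itself must be parallel to
    [u]. *)
Lemma triangle_crossing_cone :
  crossing u a b p q + crossing u b w p q + crossing u w a p q =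
  above_sign u a b w p - above_sign u a b w q + piercing a b w p q.
Proof.
have bpq : forall x, x = a \/ x = b -> seg_generic u x p q by move=> x [] ->.
have xab : forall x, x = p \/ x = q -> seg_generic u x a b by move=> x [] ->.
have pq_ab x y : x = p \/ x = q -> y = a \/ y = b -> ~ under u x y y.
  move=> hx hy [t [h [_]]]; rewrite subrr scaler0 addr0 => e.
  have := bpq y hy h; case: hx => hx.
    by move/(_ 0); rewrite lexx ler01 => /(_ isT); rewrite scale0r addr0 -e hx.
  by move/(_ 1); rewrite lexx ler01 => /(_ isT); rewrite scale1r subrKC -e hx.
have inpq x : x = p \/ x = q -> x \in [:: a; b; p; q] by case=> ->; rewrite !(in_cons, eqxx, orbT).
have inab x : x = a \/ x = b -> x \in [:: a; b; p; q] by case=> ->; rewrite !(in_cons, eqxx, orbT).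
have x_yw x y : x = p \/ x = q -> y = a \/ y = b -> ~ under u x y w.
  move=> hx hy [t [h [t01 e]]]; have [t0|t0] := eqVneq t 0.
    apply: (pq_ab x y hx hy); exists 0, h; split; first lra.
    by rewrite e t0 scale0r subrr scaler0.
  apply: (@off_u y x (inab _ hy) (inpq _ hx) t^-1 (- (h / t))).
  apply: (scalerI t0); rewrite e; apply/coordP; rewrite !coordE; split; field; exact: t0.
have x_wy x y : x = p \/ x = q -> y = a \/ y = b -> ~ under u x w y.
  move=> hx hy [t [h [t01 e]]]; apply: (x_yw x y hx hy); exists (1 - t), h; split; first lra.
  by rewrite e; apply/coordP; rewrite !coordE; split; ring.
have ywpq y : y = a \/ y = b -> seg_disjoint y w p q.
  move=> hy s t s01 t01 e; have [s0|s0] := eqVneq s 0.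
    have [s' [s'01 yE]] : exists s' : R, 0 <= s' <= 1 /\ y = a + s' *: (b - a).
      case: hy => ->; [exists 0|exists 1]; (split; first lra).
        by rewrite scale0r addr0.
      by rewrite scale1r subrKC.
    apply: (abpq s'01 t01); rewrite -yE -e s0 scale0r addr0 //.
  apply: (@off y p q (inab _ hy) _ _ ((1 - t) / s) (t / s)); rewrite ?(in_cons, eqxx, orbT) //.
  apply: (scalerI s0); have -> : s *: w = s *: y + (y + s *: (w - y) - y).
    by apply/coordP; rewrite !coordE; split; ring.
  by rewrite e; apply/coordP; rewrite !coordE; split; field; exact: s0.
have hbw : seg_disjoint b w p q by apply: ywpq; right.
have hwa : seg_disjoint w a p q.
  move=> s t s01 t01 e; apply: (ywpq a (or_introl erefl) (1 - s) t _ t01); first lra.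
  by rewrite -e; apply/coordP; rewrite !coordE; split; ring.
have xabw x : x = p \/ x = q -> ~ in_triangle a b w x.
  move=> hx [s [t [s0 t0 st e]]]; have [t0'|t0'] := eqVneq t 0.
    have [t' [t'01 xE]] : exists t' : R, 0 <= t' <= 1 /\ x = p + t' *: (q - p).
      case: hx => ->; [exists 0|exists 1]; (split; first lra).
        by rewrite scale0r addr0.
      by rewrite scale1r subrKC.
    apply: (abpq _ t'01 (_ : a + s *: (b - a) = _)); first lra.
    by rewrite -xE e t0' scale0r addr0.
  apply: (@off a x b _ (inpq _ hx) _ t^-1 (- (s / t))); rewrite ?(in_cons, eqxx, orbT) //.
  by apply: (scalerI t0'); rewrite e; apply/coordP; rewrite !coordE; split; field; exact: t0'.
have wpq : ~ under u w p q.
  by move=> [t [h [t01]]]; apply: (@off_u p q); rewrite !(in_cons, eqxx, orbT).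
have [D0|D0] := eqVneq (det3 (b - a) (w - a) u) 0; last first.
  apply: triangle_crossing_transversal => //.
    by move=> x [|[]] -> //; apply: seg_genericN.
  move=> x hx; split; [|exact: x_yw (or_intror erefl)|exact: x_wy (or_introl erefl)|exact: xabw].
  exact/seg_genericN/xab.
rewrite /above_sign D0 sgz0 !if_same subrr add0r.
have [[m e]|[s [t e]]] := det3_eq0_span u0 D0; first exact: triangle_crossing_parallel e _ _.
exfalso; apply: (@off_u a b _ _ s t); rewrite ?(in_cons, eqxx, orbT) //.
by rewrite -addrA -e subrKC.
Qed.

End Cone.
End GenericApex.

(** * Closed polygons *)

Lemma sum_ord_mul (m k : nat) (F : nat -> int) :
  \sum_(i < m * k) F i = \sum_(i < m) \sum_(j < k) F (i * k + j)%N.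
Proof.
rewrite -(big_mkord xpredT F) big_nat_mul big_mkord.
apply: eq_bigr => i _; rewrite -{1}[(i * k)%N]add0n big_addn mulSn addnK big_mkord.
by apply: eq_bigr => j _; rewrite addnC.
Qed.

Section Polygons.
Variable R : realType.
Implicit Types (a b c d p q u v w x y z : 'rV[R]_3).
Implicit Types (P Q : nat -> 'rV[R]_3) (m n k : nat).

Definition poly_crossing u P m Q n : int :=
  \sum_(i < m) \sum_(j < n) crossing u (P i) (P i.+1) (Q j) (Q j.+1).

(** This is the second half of [generic_direction] for arbitrary vertex sequences; loops made from
    parts of a sample are needed too. *)
Definition poly_generic u P m Q n : Prop :=
  forall i j (h t : R), (i <= m)%N -> (j <= n)%N -> 0 <= t <= 1 ->
    ((j < n)%N -> P i + h *: u != Q j + t *: (Q j.+1 - Q j)) /\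
    ((i < m)%N -> Q j + h *: u != P i + t *: (P i.+1 - P i)).

Definition poly_disjoint P m Q n : Prop := forall i j, (i < m)%N -> (j < n)%N ->
  seg_disjoint (P i) (P i.+1) (Q j) (Q j.+1).

Definition vertices P m := [seq P i | i <- iota 0 m.+1].

Lemma mem_vertices P m i : (i <= m)%N -> P i \in vertices P m.
Proof. by move=> im; apply: map_f; rewrite mem_iota. Qed.

(** The bound on [|w - c|] allows [poly_crossing_ball] to take the apex in a prescribed ball. *)
Lemma exists_apex (us pts : seq 'rV[R]_3) c (r : R) : 0 < r -> exists w, [/\ `|w - c| < r,
  forall u x y, u \in us -> x \in pts -> y \in pts -> off_plane w x (y - x) u &
  forall x y z, x \in pts -> y \in pts -> z \in pts -> off_plane w x (y - x) (z - x)].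
Proof.
move=> r0.
pose pairs := [seq (x, y) | x <- pts, y <- pts].
have inpairs x y : x \in pts -> y \in pts -> (x, y) \in pairs.
  by move=> xp yp; apply/allpairsP; exists (x, y).
pose S := [seq (xy.1, xy.2 - xy.1, u) | xy <- pairs, u <- us] ++
  [seq (xy.1, xy.2 - xy.1, z - xy.1) | xy <- pairs, z <- pts].
have [w [wr off]] := exists_off_planes S c r0.
exists w; split=> // [u x y uin xin yin|x y z xin yin zin].
  apply: (off (x, y - x, u)); rewrite mem_cat; apply/orP; left.
  by apply/allpairsP; exists ((x, y), u); split=> //=; exact: inpairs.
apply: (off (x, y - x, z - x)); rewrite mem_cat; apply/orP; right.
by apply/allpairsP; exists ((x, y), z); split=> //=; exact: inpairs.
Qed.

Lemma sum_closed (F : nat -> int) m : F m = F 0%N -> \sum_(i < m) (F i - F i.+1) = 0.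
Proof.
move=> Fm; rewrite -(big_mkord xpredT (fun i => F i - F i.+1)).
under eq_bigr do rewrite -opprB.
by rewrite sumrN telescope_sumr // Fm subrr oppr0.
Qed.

(* Cone the first polygon from w: the sides through w cancel in pairs, the terms
   [above_sign] telescope along the second polygon, and what remains does not depend on u. *)
Lemma poly_crossing_piercing u P m Q n w : u != 0 -> P m = P 0%N -> Q n = Q 0%N ->
  poly_generic u P m Q n -> poly_disjoint P m Q n ->
  (forall x y, x \in vertices P m ++ vertices Q n -> y \in vertices P m ++ vertices Q n ->
     off_plane w x (y - x) u) ->
  (forall x y z, x \in vertices P m ++ vertices Q n -> y \in vertices P m ++ vertices Q n ->
     z \in vertices P m ++ vertices Q n -> off_plane w x (y - x) (z - x)) ->
  poly_crossing u P m Q n =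
  \sum_(i < m) \sum_(j < n) piercing (P i) (P i.+1) w (Q j) (Q j.+1).
Proof.
move=> u0 Pm Qn gen dis offu off.
have cone i j : (i < m)%N -> (j < n)%N ->
    crossing u (P i) (P i.+1) (Q j) (Q j.+1) + crossing u (P i.+1) w (Q j) (Q j.+1) +
    crossing u w (P i) (Q j) (Q j.+1) =
    above_sign u (P i) (P i.+1) w (Q j) - above_sign u (P i) (P i.+1) w (Q j.+1) +
    piercing (P i) (P i.+1) w (Q j) (Q j.+1).
  move=> im jn.
  have sub x : x \in [:: P i; P i.+1; Q j; Q j.+1] -> x \in vertices P m ++ vertices Q n.
    move=> hx; rewrite mem_cat; rewrite !in_cons in_nil orbF in hx.
    case/or4P: hx => /eqP ->.
    - by apply/orP; left; apply: mem_vertices; exact: ltnW.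
    - by apply/orP; left; apply: mem_vertices.
    - by apply/orP; right; apply: mem_vertices; exact: ltnW.
    - by apply/orP; right; apply: mem_vertices.
  apply: triangle_crossing_cone => //.
  - by move=> h t t01; apply/eqP; apply: (gen i j h t _ _ t01).1 => //; exact: ltnW.
  - by move=> h t t01; apply/eqP; apply: (gen i.+1 j h t _ _ t01).1 => //; exact: ltnW.
  - by move=> h t t01; apply/eqP; apply: (gen i j h t _ _ t01).2 => //; exact: ltnW.
  - by move=> h t t01; apply/eqP; apply: (gen i j.+1 h t _ _ t01).2 => //; exact: ltnW.
  - exact: dis.
  - by move=> x y /sub hx /sub hy; exact: offu.
  - by move=> x y z /sub hx /sub hy /sub hz; exact: off.
have sides : \sum_(i < m) \sum_(j < n)
    (crossing u (P i.+1) w (Q j) (Q j.+1) + crossing u w (P i) (Q j) (Q j.+1)) = 0.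
  pose F i : int := \sum_(j < n) crossing u w (P i) (Q j) (Q j.+1).
  transitivity (\sum_(i < m) (F i - F i.+1)).
    apply: eq_bigr => i _; rewrite -sumrB; apply: eq_bigr => j _.
    by rewrite addrC (crossing_rev u w (P i.+1)).
  by apply: sum_closed; rewrite /F Pm.
have tops : \sum_(i < m) \sum_(j < n)
    (above_sign u (P i) (P i.+1) w (Q j) - above_sign u (P i) (P i.+1) w (Q j.+1)) = 0.
  by rewrite big1 // => i _; apply: (@sum_closed (fun j => above_sign u (P i) (P i.+1) w (Q j))); rewrite Qn.
pose side i j := crossing u (P i.+1) w (Q j) (Q j.+1) + crossing u w (P i) (Q j) (Q j.+1).
pose top i j := above_sign u (P i) (P i.+1) w (Q j) - above_sign u (P i) (P i.+1) w (Q j.+1).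
transitivity (poly_crossing u P m Q n + \sum_(i < m) \sum_(j < n) side i j).
  by rewrite [X in _ + X]sides addr0.
transitivity (\sum_(i < m) \sum_(j < n) top i j +
    \sum_(i < m) \sum_(j < n) piercing (P i) (P i.+1) w (Q j) (Q j.+1)); last first.
  by rewrite [X in X + _]tops add0r.
rewrite -!big_split /=; apply: eq_bigr => i _; rewrite -!big_split; apply: eq_bigr => j _ /=.
by rewrite addrA cone.
Qed.

Lemma poly_crossing_direction u u' P m Q n : u != 0 -> u' != 0 -> P m = P 0%N -> Q n = Q 0%N ->
  poly_generic u P m Q n -> poly_generic u' P m Q n -> poly_disjoint P m Q n ->
  poly_crossing u P m Q n = poly_crossing u' P m Q n.
Proof.
move=> u0 u0' Pm Qn gen gen' dis.
have [w [_ offu off]] := exists_apex [:: u; u'] (vertices P m ++ vertices Q n) 0 ltr01.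
rewrite !(@poly_crossing_piercing _ P m Q n w) //.
  by move=> x y; apply: offu; rewrite !(in_cons, eqxx, orbT).
by move=> x y; apply: offu; rewrite !(in_cons, eqxx, orbT).
Qed.

Lemma ball_convex3 a b w c (r s t : R) : `|a - c| < r -> `|b - c| < r -> `|w - c| < r ->
  0 <= s -> 0 <= t -> s + t <= 1 -> `|a + s *: (b - a) + t *: (w - a) - c| < r.
Proof.
move=> ar br wr s0 t0 st.
have -> : a + s *: (b - a) + t *: (w - a) - c =
    (1 - s - t) *: (a - c) + s *: (b - c) + t *: (w - c).
  by apply/coordP; rewrite !coordE; split; ring.
apply: le_lt_trans (ler_normD _ _) _.
apply: le_lt_trans (lerD (ler_normD _ _) (lexx _)) _.
rewrite !normrZ (ger0_norm s0) (ger0_norm t0) ger0_norm; last lra.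
pose M := Num.max `|a - c| (Num.max `|b - c| `|w - c|).
have Mr : M < r by rewrite !gt_max ar br wr.
have aM : `|a - c| <= M by rewrite !le_max lexx.
have bM : `|b - c| <= M by rewrite !le_max lexx orbT.
have wM : `|w - c| <= M by rewrite !le_max lexx !orbT.
apply: le_lt_trans Mr; have -> : M = (1 - s - t) * M + s * M + t * M by ring.
by rewrite !lerD // ler_wpM2l //; lra.
Qed.

Lemma ball_convex a b c (r s : R) : `|a - c| < r -> `|b - c| < r -> 0 <= s <= 1 ->
  `|a + s *: (b - a) - c| < r.
Proof.
move=> ar br s01; have := @ball_convex3 a b a c r s 0 ar br ar.
by rewrite scale0r !addr0; apply; lra.
Qed.

(** With the apex in the ball, the whole cone lies in the ball by convexity, so no segment of [Q]
    pierces it. *)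
Lemma poly_crossing_ball u P m Q n c (r : R) : u != 0 -> P m = P 0%N -> Q n = Q 0%N ->
  poly_generic u P m Q n -> (forall i, (i <= m)%N -> `|P i - c| < r) ->
  (forall j (t : R), (j < n)%N -> 0 <= t <= 1 -> r <= `|Q j + t *: (Q j.+1 - Q j) - c|) ->
  poly_crossing u P m Q n = 0.
Proof.
move=> u0 Pm Qn gen near far.
have r0 : 0 < r by apply: le_lt_trans (near 0%N _).
have dis : poly_disjoint P m Q n.
  move=> i j im jn s t s01 t01 e; have := far j t jn t01.
  by rewrite -e leNgt ball_convex //; apply: near => //; exact: ltnW.
have [w [wr offu off]] := exists_apex [:: u] (vertices P m ++ vertices Q n) c r0.
rewrite (@poly_crossing_piercing _ P m Q n w) //; last first.
  by move=> x y; apply: offu; rewrite mem_seq1.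
rewrite big1 // => i _; rewrite big1 // => j _; rewrite /piercing asboolF // => -[t [s [s' [t01 [s0 s0' s1] e]]]].
have t01' : 0 <= t <= 1 by lra.
have ball : `|P i + s *: (P i.+1 - P i) + s' *: (w - P i) - c| < r.
  by apply: ball_convex3 => //; (try lra); apply: near; [exact: ltnW|exact: ltn_ord].
by have := far j t (ltn_ord j) t01'; rewrite e leNgt ball.
Qed.

Lemma poly_crossing_swap u P m Q n : poly_crossing (- u) Q n P m = poly_crossing u P m Q n.
Proof.
by rewrite /poly_crossing exchange_big; apply: eq_bigr => i _; apply: eq_bigr => j _; exact: crossing_swap.
Qed.

Lemma poly_generic_swap u P m Q n : poly_generic u P m Q n -> poly_generic (- u) Q n P m.
Proof.
move=> gen j i h t jn im t01; rewrite scalerN -scaleNr.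
by have [g1 g2] := gen i j (- h) t im jn t01.
Qed.

(** If the projection along [u] maps [x] onto the line [yz] without [x] lying on it, then [u] lies
    in the span of [x - y] and [z - y]. Avoiding these planes for all triples from [pts] makes [u]
    generic for every pair of disjoint polygons with vertices in [pts], so one direction serves
    several samplings. *)
Lemma exists_generic_direction (pts : seq 'rV[R]_3) : exists u, u != 0 /\
  forall P m Q n, (forall i, (i <= m)%N -> P i \in pts) -> (forall j, (j <= n)%N -> Q j \in pts) ->
  (0 < m)%N -> (0 < n)%N -> poly_disjoint P m Q n -> poly_generic u P m Q n.
Proof.
pose pairs := [seq (x, y) | x <- pts, y <- pts].
pose O : 'rV[R]_3 := 0.
(* The first entry is the degenerate plane consisting of the origin; avoiding it makes [u]
   nonzero. *)
pose S := (O, O, O) :: [seq (O, xy.1 - xy.2, z - xy.2) | xy <- pairs, z <- pts].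
have [u [_ off]] := exists_off_planes S 0 ltr01.
exists u; split.
  apply/eqP => u0; apply: (off (O, O, O) (mem_head _ _) 0 0).
  by rewrite u0 !scaler0 !addr0.
have off3 x y z : x \in pts -> y \in pts -> z \in pts -> off_plane u 0 (x - y) (z - y).
  move=> hx hy hz; apply: (off (O, x - y, z - y)); rewrite in_cons; apply/orP; right.
  by apply/allpairsP; exists ((x, y), z); split=> //=; apply/allpairsP; exists (x, y).
move=> P m Q n Ppts Qpts m0 n0 dis.
have vertex_on F k i : (0 < k)%N -> (i <= k)%N -> exists j (s : R),
    [/\ (j < k)%N, 0 <= s <= 1 & F i = F j + s *: (F j.+1 - F j) :> 'rV[R]_3].
  move=> k0; rewrite leq_eqVlt => /predU1P[->|ik].
    exists k.-1, 1; split; [by rewrite prednK|lra|].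
    by rewrite prednK // scale1r subrKC.
  by exists i, 0; split=> //; [lra|rewrite scale0r addr0].
have key x y z h t : x \in pts -> y \in pts -> z \in pts -> x + h *: u = y + t *: (z - y) ->
    x = y + t *: (z - y).
  move=> hx hy hz e; have [h0|h0] := eqVneq h 0; first by rewrite -e h0 scale0r addr0.
  exfalso; apply: (@off3 x y z hx hy hz (- h^-1) (t / h)).
  apply: (scalerI h0); have -> : h *: u = x + h *: u - x by rewrite addrC addKr.
  by rewrite e; apply/coordP; rewrite !coordE; split; field; exact: h0.
move=> i j h t im jn t01; split=> lt; apply/eqP => /key e.
  have [i' [s [i'm s01 Pi]]] := vertex_on P m i m0 im.
  apply: (dis i' j i'm lt s t s01 t01); rewrite -Pi; apply: e; [exact: Ppts|exact: Qpts|exact: Qpts].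
have [j' [s [j'n s01 Qj]]] := vertex_on Q n j n0 jn.
apply: (dis i j' lt j'n t s t01 s01); rewrite -Qj; apply/esym/e; [exact: Qpts|exact: Ppts|exact: Ppts].
Qed.

(** Each block of [k] edges, closed up by its reversed chord, is a loop in a ball away from [Q]. By
    [poly_crossing_ball] its crossing number is 0, so block and chord contribute equally. *)
Lemma poly_crossing_coarsen u P m k Q n : u != 0 -> (0 < k)%N -> Q n = Q 0%N ->
  poly_generic u P (m * k) Q n -> poly_generic u (fun i => P (i * k)%N) m Q n ->
  (forall i, (i < m)%N -> exists c r, (forall j, (j <= k)%N -> `|P (i * k + j)%N - c| < r) /\
     forall j (t : R), (j < n)%N -> 0 <= t <= 1 -> r <= `|Q j + t *: (Q j.+1 - Q j) - c|) ->
  poly_crossing u P (m * k) Q n = poly_crossing u (fun i => P (i * k)%N) m Q n.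
Proof.
move=> u0 k0 Qn gen gen' near.
pose F a b := \sum_(j < n) crossing u a b (Q j) (Q j.+1).
have block i : (i < m)%N ->
    \sum_(j < k) F (P (i * k + j)%N) (P (i * k + j).+1%N) = F (P (i * k)%N) (P (i.+1 * k)%N).
  move=> im.
  (* Beyond index [k] the sequence returns to the start of the block, so edge [k] of the loop is the
     reversed chord. *)
  pose L j := if (j <= k)%N then P (i * k + j)%N else P (i * k)%N.
  have [c [r [nr far]]] := near i im.
  have : poly_crossing u L k.+1 Q n = 0.
    apply: (@poly_crossing_ball _ _ _ _ _ c r) => //.
    - by rewrite /L ltnn leq0n addn0.
    - move=> i' j h t _ jn t01.
      have ikm j' : (j' <= k)%N -> (i * k + j' <= m * k)%N.
        by move=> jk; apply: leq_trans (leq_mul im (leqnn k)); rewrite mulSn addnC leq_add2r.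
      have ikm0 : (i * k <= m * k)%N by rewrite leq_mul2r ltnW ?orbT.
      split=> [lt|lt]; rewrite /L.
        by case: ifP => ik; apply: (gen _ j h t _ jn t01).1 => //; exact: ikm.
      have [ik|ik] := ltnP i' k.
        rewrite (ltnW ik) addnS; apply: (gen _ j h t _ jn t01).2; first exact/ikm/ltnW.
        by rewrite -addnS; exact: ikm.
      have {ik lt} -> : i' = k by apply/eqP; rewrite eqn_leq ik -ltnS lt.
      have t01' : 0 <= 1 - t <= 1 by lra.
      have kk : (i * k + k = i.+1 * k)%N by rewrite mulSn addnC.
      rewrite leqnn kk.
      have := (gen' i j h (1 - t) (ltnW im) jn t01').2 im.
      congr (_ != _); apply/coordP; rewrite !coordE; split; ring.
    - move=> j _; rewrite /L; case: ifP => jk; first exact: nr.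
      by rewrite -[(i * k)%N]addn0; exact: nr.
  rewrite /poly_crossing big_ord_recr /= => /eqP; rewrite addr_eq0 => /eqP e.
  transitivity (\sum_(j < k) F (L j) (L j.+1)).
    by apply: eq_bigr => j _; rewrite /L (ltnW (ltn_ord j)) ltn_ord addnS.
  rewrite [LHS]e /L leqnn ltnn -sumrN; apply: eq_bigr => j _.
  by rewrite -crossing_rev mulSn addnC.
have -> : poly_crossing u P (m * k) Q n = \sum_(i < m) \sum_(j < k) F (P (i * k + j)%N) (P (i * k + j).+1%N).
  exact: (sum_ord_mul m k (fun i => F (P i) (P i.+1))).
by apply: eq_bigr => i _; rewrite block.
Qed.

End Polygons.

(** * Linking numbers of closed curves *)

Section Curves.
Variable R : realType.
Implicit Types (u v w x y z : 'rV[R]_3) (f g : R -> 'rV[R]_3) (m n k : nat).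

Definition unit_ucont f : Prop := forall e : R, 0 < e -> exists2 d : R, 0 < d &
  forall s t, 0 <= s <= 1 -> 0 <= t <= 1 -> `|s - t| < d -> `|f s - f t| < e.

Definition curves_apart f g (d : R) : Prop :=
  forall s t, 0 <= s <= 1 -> 0 <= t <= 1 -> d <= `|f s - g t|.

Definition fine f (e : R) N : Prop := forall s t, 0 <= s <= 1 -> 0 <= t <= 1 ->
  `|s - t| <= N%:R^-1 -> `|f s - f t| < e.

Lemma ucont_fine f (e : R) : unit_ucont f -> 0 < e ->
  exists N, forall n, (N <= n)%N -> (0 < n)%N /\ fine f e n.
Proof.
move=> fc e0; have [d d0 fd] := fc e e0.
exists (Num.truncn d^-1).+1 => n Nn; split; first exact: leq_trans Nn.
move=> s t s01 t01 st; apply: fd => //; apply: le_lt_trans st _.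
have n0 : 0 < n%:R :> R by rewrite ltr0n; exact: leq_trans Nn.
rewrite -[d]invrK ltf_pV2 ?posrE ?invr_gt0 //.
by apply: lt_le_trans (truncnS_gt _) _; rewrite ler_nat.
Qed.

Section Fine.
Variables (f g : R -> 'rV[R]_3) (d : R) (N : nat).
Hypotheses (N0 : forall n, (N <= n)%N -> (0 < n)%N).
Hypothesis d0 : 0 < d.
Hypothesis ff : forall n, (N <= n)%N -> fine f (d / 4) n.
Hypothesis gf : forall n, (N <= n)%N -> fine g (d / 4) n.
Hypothesis fg : curves_apart f g d.
Hypothesis g1 : g 1 = g 0.

Lemma unit_ratio i m : (i <= m)%N -> 0 <= (i%:R / m%:R : R) <= 1.
Proof.
case: m => [|m] im.
  by rewrite invr0 mulr0 lexx ler01.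
by rewrite divr_ge0 ?ler0n // ler_pdivrMr ?ltr0n // mul1r ler_nat.
Qed.

Lemma sample_closed n : (0 < n)%N -> sample g n n = sample g n 0.
Proof. by move=> n0; rewrite /sample mul0r divff ?pnatr_eq0 -?lt0n. Qed.

Lemma fine_sample f' m k i j : (forall n, (N <= n)%N -> fine f' (d / 4) n) ->
  (N <= m)%N -> (0 < k)%N -> (i < m)%N -> (j <= k)%N ->
  `|sample f' (m * k) (i * k + j) - sample f' m i| < d / 4.
Proof.
move=> fn Nm k0 im jk; have m0 := N0 Nm.
have mR : m%:R != 0 :> R by rewrite pnatr_eq0 -lt0n.
have kR : k%:R != 0 :> R by rewrite pnatr_eq0 -lt0n.
apply: (fn m Nm).
- apply: unit_ratio; apply: leq_trans (leq_mul im (leqnn k)).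
  by rewrite mulSn addnC leq_add2r.
- exact/unit_ratio/ltnW.
have -> : (i * k + j)%:R / (m * k)%:R - i%:R / m%:R = (j%:R / k%:R) / m%:R :> R.
  by rewrite natrD !natrM; field; rewrite mR kR.
have /andP[r0 r1] := unit_ratio jk.
rewrite ger0_norm ?divr_ge0 ?ler0n // -[leRHS]mul1r ler_wpM2r // invr_ge0 ler0n //.
Qed.

Lemma fine_segment f' m i (t : R) : (forall n, (N <= n)%N -> fine f' (d / 4) n) ->
  (N <= m)%N -> (i < m)%N -> 0 <= t <= 1 ->
  `|sample f' m i + t *: (sample f' m i.+1 - sample f' m i) - sample f' m i| < d / 4.
Proof.
move=> fn Nm im t01; apply: ball_convex => //; first by rewrite subrr normr0 divr_gt0.
have := @fine_sample f' m 1 i 1 fn Nm isT im isT.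
by rewrite !muln1 addn1.
Qed.

(** A chord of [g] stays within [d / 4] of its own vertex, hence at least [3 d / 4] from every
    sample of [f]. The samples and chords of [f] following such a sample stay within [d / 4] of it,
    so a ball of radius [d / 4] separates them from [g]. *)
Lemma fine_far m n i j (t : R) : (N <= m)%N -> (N <= n)%N -> (i < m)%N -> (j < n)%N ->
  0 <= t <= 1 ->
  d / 4 <= `|sample g n j + t *: (sample g n j.+1 - sample g n j) - sample f m i|.
Proof.
move=> Nm Nn im jn t01; have := fine_segment gf Nn jn t01.
have := fg (unit_ratio (ltnW im)) (unit_ratio (ltnW jn)).
rewrite -/(sample f m i) -/(sample g n j).
set x := sample f m i; set y := sample g n j; set z := y + _ => xy zy.
have := ler_normD (x - z) (z - y); rewrite addrA subrK (distrC x z) => h.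
have {}h : d <= `|z - x| + `|z - y| := le_trans xy h.
by move: d0 zy h; move: `|z - x| `|z - y| => A B; lra.
Qed.

Lemma fine_disjoint m n : (N <= m)%N -> (N <= n)%N ->
  poly_disjoint (sample f m) m (sample g n) n.
Proof.
move=> Nm Nn i j im jn s t s01 t01 e; have := fine_far Nm Nn im jn t01.
by rewrite -e leNgt fine_segment.
Qed.

Lemma fine_coarsen m n k u : (N <= m)%N -> (N <= n)%N -> (0 < k)%N -> u != 0 ->
  poly_generic u (sample f (m * k)) (m * k) (sample g n) n ->
  poly_generic u (sample f m) m (sample g n) n ->
  poly_crossing u (sample f (m * k)) (m * k) (sample g n) n =
  poly_crossing u (sample f m) m (sample g n) n.
Proof.
move=> Nm Nn k0 u0 gen gen'; have m0 := N0 Nm.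
have coarse : (fun i => sample f (m * k) (i * k)) = sample f m.
  apply/funext => i; rewrite /sample !natrM invfM mulrACA divff ?mulr1 //.
  by rewrite pnatr_eq0 -lt0n.
have := @poly_crossing_coarsen R u (sample f (m * k)) m k (sample g n) n.
rewrite coarse; apply=> //; first by apply/sample_closed/N0.
move=> i im; exists (sample f m i), (d / 4); split=> [j jk|j t jn t01].
  exact: fine_sample.
exact: fine_far.
Qed.
End Fine.

Lemma curves_apart_sym f g (d : R) : curves_apart f g d -> curves_apart g f d.
Proof. by move=> fg s t s01 t01; rewrite distrC; exact: fg. Qed.

(** Any two samplings beyond the bound have a common refinement, obtained by multiplying the numbers
    of sample points, and crossing numbers do not change on passing to it. *)
Lemma linking_number_crossing f g (d : R) : unit_ucont f -> unit_ucont g -> f 1 = f 0 ->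
  g 1 = g 0 -> 0 < d -> curves_apart f g d ->
  exists N, (0 < N)%N /\ forall m n, (N <= m)%N -> (N <= n)%N ->
   poly_disjoint (sample f m) m (sample g n) n /\ forall u,
   u != 0 -> poly_generic u (sample f m) m (sample g n) n ->
   standard_linking_number f g = poly_crossing u (sample f m) m (sample g n) n.
Proof.
move=> fc gc f1 g1 d0 fg; have d4 : 0 < d / 4 by rewrite divr_gt0.
have [Nf fN] := ucont_fine fc d4.
have [Ng gN] := ucont_fine gc d4.
pose N := maxn Nf Ng.
have N0 n : (N <= n)%N -> (0 < n)%N by rewrite geq_max => /andP[/fN[]].
have ff n : (N <= n)%N -> fine f (d / 4) n by rewrite geq_max => /andP[/fN[]].
have gf n : (N <= n)%N -> fine g (d / 4) n by rewrite geq_max => /andP[_ /gN[]].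
have dis m n : (N <= m)%N -> (N <= n)%N -> poly_disjoint (sample f m) m (sample g n) n.
  exact: (@fine_disjoint f g d N).
have step m n k l u v : (N <= m)%N -> (N <= n)%N -> (0 < k)%N -> (0 < l)%N ->
   u != 0 -> v != 0 -> poly_generic u (sample f m) m (sample g n) n ->
   poly_generic v (sample f (m * k)) (m * k) (sample g (n * l)) (n * l) ->
   poly_crossing u (sample f m) m (sample g n) n =
   poly_crossing v (sample f (m * k)) (m * k) (sample g (n * l)) (n * l).
  move=> Nm Nn k0 l0 u0 v0 ugen vgen.
  have Nmk : (N <= m * k)%N by apply: leq_trans Nm _; rewrite leq_pmulr.
  have Nnl : (N <= n * l)%N by apply: leq_trans Nn _; rewrite leq_pmulr.
  (* One direction generic for the coarse and the fine samples of both curves, so that each step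
     below changes only the direction, only [f] or only [g]. *)
  have [w [w0 wgen]] := exists_generic_direction
    (vertices (sample f m) m ++ vertices (sample f (m * k)) (m * k) ++
     vertices (sample g n) n ++ vertices (sample g (n * l)) (n * l)).
  have gen m' n' : m' = m \/ m' = (m * k)%N -> n' = n \/ n' = (n * l)%N ->
      poly_generic w (sample f m') m' (sample g n') n'.
    move=> hm hn; have Nm' : (N <= m')%N by case: hm => ->.
    have Nn' : (N <= n')%N by case: hn => ->.
    apply: wgen; rewrite ?N0 //; last exact: dis.
      by move=> i im; rewrite !mem_cat; case: hm im => -> im; rewrite mem_vertices ?orbT.
    by move=> i im; rewrite !mem_cat; case: hn im => -> im;
      rewrite (@mem_vertices _ (sample g _)) ?orbT.
  transitivity (poly_crossing w (sample f m) m (sample g n) n).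
    apply: poly_crossing_direction; rewrite ?(sample_closed f1) ?(sample_closed g1) ?N0 //.
      by apply: gen; left.
    exact: dis.
  transitivity (poly_crossing w (sample f (m * k)) (m * k) (sample g n) n).
    by rewrite (@fine_coarsen f g d N) //; apply: gen; auto.
  transitivity (poly_crossing w (sample f (m * k)) (m * k) (sample g (n * l)) (n * l)).
    rewrite -!(@poly_crossing_swap _ w) (@fine_coarsen g f d N) ?oppr_eq0 //.
    - exact: curves_apart_sym.
    - by apply/poly_generic_swap/gen; auto.
    - by apply/poly_generic_swap/gen; auto.
  apply: poly_crossing_direction; rewrite ?(sample_closed f1) ?(sample_closed g1) ?N0 //.
    by apply: gen; right.
  exact: dis.
have const m n m' n' u u' : (N <= m)%N -> (N <= n)%N -> (N <= m')%N -> (N <= n')%N ->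
   u != 0 -> u' != 0 -> poly_generic u (sample f m) m (sample g n) n ->
   poly_generic u' (sample f m') m' (sample g n') n' ->
   poly_crossing u (sample f m) m (sample g n) n =
   poly_crossing u' (sample f m') m' (sample g n') n'.
  move=> Nm Nn Nm' Nn' u0 u0' ugen ugen'.
  have [v [v0 vgen]] := exists_generic_direction
    (vertices (sample f (m * m')) (m * m') ++ vertices (sample g (n * n')) (n * n')).
  have {}vgen : poly_generic v (sample f (m * m')) (m * m') (sample g (n * n')) (n * n').
    apply: vgen; rewrite ?muln_gt0 ?N0 //.
    - by move=> i im; rewrite mem_cat mem_vertices.
    - by move=> i im; rewrite mem_cat (@mem_vertices _ (sample g _)) ?orbT.
    - by apply: dis; [apply: leq_trans Nm _|apply: leq_trans Nn _]; rewrite leq_pmulr ?N0.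
  rewrite (step m n m' n' u v) ?N0 //; rewrite (mulnC m) (mulnC n) in vgen *.
  by rewrite (step m' n' m n u' v) ?N0.
exists (maxn N 1); split; first by rewrite leq_max orbT.
move=> m n; rewrite geq_max => /andP[Nm _]; rewrite geq_max => /andP[Nn _]; split; first exact: dis.
move=> u u0 ugen.
have ex : exists k : int, exists N, forall m n u, (N <= m)%N -> (N <= n)%N ->
    generic_direction f g m n u -> crossing_number f g m n u = k.
  exists (poly_crossing u (sample f m) m (sample g n) n), N => m' n' u' Nm' Nn' [u0' ugen'].
  exact: const.
have [M hM] := xgetPex 0 ex.
have MN : (N <= maxn N M)%N by rewrite leq_max leqnn.
have MM : (M <= maxn N M)%N by rewrite leq_max leqnn orbT.
pose L := maxn N M.
(* The property selected by [xget] could hold vacuously at a level without generic directions; [v]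
   shows that it determines the value at level [L], which is beyond both bounds. *)
have [v [v0 vgen]] := exists_generic_direction
    (vertices (sample f L) L ++ vertices (sample g L) L).
have {}vgen : poly_generic v (sample f L) L (sample g L) L.
  apply: vgen; rewrite ?N0 //.
  - by move=> i im; rewrite mem_cat mem_vertices.
  - by move=> i im; rewrite mem_cat (@mem_vertices _ (sample g _)) ?orbT.
  - exact: dis.
rewrite (const m n L L u v) // /standard_linking_number; apply/esym.
exact: hM.
Qed.
End Curves.

(** * Compactness of the unit interval *)

Section UnitInterval.
Local Open Scope classical_set_scope.
Variable R : realType.
Implicit Types (f g : R -> 'rV[R]_3).

(** Compactness in its near-covering form. Locally the property is required for all small [d], so
    that finitely many local bounds have a common one. *)
Lemma unit_interval_cover (P : R -> R -> Prop) :
  (forall x, 0 <= x <= 1 -> exists2 e, 0 < e & forall y d, 0 <= y <= 1 -> `|y - x| < e ->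
     0 < d -> d < e -> P d y) ->
  exists2 d, 0 < d & forall x, 0 <= x <= 1 -> P d x.
Proof.
move=> cover.
have /compact_near_coveringP/near_covering_withinP cov := @segment_compact R 0 1.
have : \forall d \near (0 : R)^'+, `[0, 1]%classic `<=` P d.
  apply: cov.
  move=> x /=; rewrite in_itv /= => x01; have [e e0 eP] := cover x x01.
  exists ([set y | `|y - x| < e], [set d | 0 < d < e]) => /=.
    split.
      by apply/nbhs_ballP; exists e => //= y; rewrite /ball /= distrC.
    by near=> d; apply/andP; split; near: d; [exact: nbhs_right_gt|exact: nbhs_right_lt].
  by move=> [y d] /= [ye /andP[d0 de]]; rewrite in_itv /= => y01; exact: eP.
move=> /nbhs_ballP[e e0 eP]; exists (e / 2); first by rewrite divr_gt0.
move=> x x01; apply: (eP (e / 2)) => //=.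
- by rewrite -ball_normE /= sub0r normrN ger0_norm ?divr_ge0 ?ltW // ltr_pdivrMr // ltr_pMr // ltr1n.
- by rewrite divr_gt0.
Unshelve. all: by end_near. Qed.

Lemma within_unit_continuous f x (e : R) : {within `[0, 1], continuous f} ->
  0 <= x <= 1 -> 0 < e ->
  exists2 d, 0 < d & forall y, 0 <= y <= 1 -> `|y - x| < d -> `|f y - f x| < e.
Proof.
move=> /subspace_continuousP fc x01 e0.
have x01' : `[0, 1]%classic x by rewrite /= in_itv.
have /cvgrPdist_lt fx := fc x x01'.
have := fx e e0.
move=> /nbhs_ballP[d d0 dP]; exists d => // y y01 yx; rewrite distrC; apply: dP => //=.
by rewrite /ball /= distrC.
Qed.

Lemma continuous_ucont f : {within `[0, 1], continuous f} -> unit_ucont f.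
Proof.
move=> fc e e0.
suff [d d0 dP] : exists2 d, 0 < d & forall s, 0 <= s <= 1 ->
    forall t, 0 <= t <= 1 -> `|s - t| < d -> `|f s - f t| < e.
  by exists d => // s t s01 t01; exact: dP.
apply: (@unit_interval_cover (fun d s => forall t, 0 <= t <= 1 -> `|s - t| < d -> `|f s - f t| < e)) => x x01.
have [d d0 dP] := within_unit_continuous fc x01 (divr_gt0 e0 (ltr0n _ 2)).
exists (d / 2); first by rewrite divr_gt0.
move=> y k y01 yx k0 kd t t01 yt.
have ty : `|t - x| < d.
  have := ler_normD (t - y) (y - x); rewrite addrA subrK (distrC t y) => h.
  apply: le_lt_trans h _; move: yx yt kd; move: `|y - x| `|y - t| => A B; lra.
have := dP t t01 ty; have := dP y y01.
have yx' : `|y - x| < d by move: yx; move: `|y - x| => A; lra.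
move=> /(_ yx').
have := ler_normD (f y - f x) (f x - f t); rewrite addrA subrK (distrC (f x)).
move: `|f y - f x| `|f t - f x| `|f y - f t| => A B C; lra.
Qed.

(** Compactness is used twice: along [g] for a fixed point [f s], then along [f], where continuity
    preserves half of the distance found for [s] at nearby parameters. *)
Lemma disjoint_curves_apart f g : {within `[0, 1], continuous f} -> {within `[0, 1], continuous g} ->
  (forall s t, 0 <= s <= 1 -> 0 <= t <= 1 -> f s <> g t) ->
  exists2 d, 0 < d & curves_apart f g d.
Proof.
move=> fc gc fg.
have key s : 0 <= s <= 1 -> exists2 d, 0 < d & forall t, 0 <= t <= 1 -> d <= `|f s - g t|.
  move=> s01; apply: (@unit_interval_cover (fun d t => d <= `|f s - g t|)) => x x01.
  have a0 : 0 < `|f s - g x| / 2.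
    by rewrite divr_gt0 // normr_gt0 subr_eq0; apply/eqP/fg.
  have [d d0 dP] := within_unit_continuous gc x01 a0.
  exists (Num.min d (`|f s - g x| / 2)); first by rewrite lt_min d0.
  move=> y k y01; rewrite lt_min => /andP[yx _] k0; rewrite lt_min => /andP[_ ka].
  have := dP y y01 yx; have := ler_normD (f s - g y) (g y - g x); rewrite addrA subrK.
  move: ka; move: `|f s - g x| `|f s - g y| `|g y - g x| => A B C; lra.
suff [d d0 dP] : exists2 d, 0 < d & forall s, 0 <= s <= 1 -> forall t, 0 <= t <= 1 -> d <= `|f s - g t|.
  by exists d => // s t s01 t01; exact: dP.
apply: (@unit_interval_cover (fun d s => forall t, 0 <= t <= 1 -> d <= `|f s - g t|)) => s s01.
have [d d0 dP] := key s s01.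
have d2 : 0 < d / 2 by rewrite divr_gt0.
have [e e0 eP] := within_unit_continuous fc s01 d2.
exists (Num.min e (d / 2)); first by rewrite lt_min e0.
move=> y k y01; rewrite lt_min => /andP[ys _] k0; rewrite lt_min => /andP[_ kd] t t01.
have := dP t t01; have := eP y y01 ys.
have := ler_normD (f s - f y) (f y - g t); rewrite addrA subrK (distrC (f s) (f y)).
move: kd; move: `|f s - g t| `|f y - f s| `|f y - g t| => A B C; lra.
Qed.

End UnitInterval.

(** * Linking numbers of cycles *)

Lemma finite_common_bound (R : realFieldType) (T : finType) (P : T -> R -> Prop) :
  (forall x d e, 0 < e -> e <= d -> P x d -> P x e) ->
  (forall x, exists2 d, 0 < d & P x d) -> exists2 d, 0 < d & forall x, P x d.
Proof.
move=> mono ex; suff [d d0 dP] : exists2 d, 0 < d & forall x, x \in enum T -> P x d.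
  by exists d => // x; apply: dP; rewrite mem_enum.
elim: (enum T) => [|x s [d d0 dP]]; first by exists 1.
have [e e0 eP] := ex x; have m0 : 0 < Num.min d e by rewrite lt_min d0.
exists (Num.min d e) => // y; rewrite in_cons => /predU1P[->|ys].
  by apply: mono m0 _ eP; rewrite ge_min lexx orbT.
by apply: mono m0 _ (dP y ys); rewrite ge_min lexx.
Qed.

Lemma finite_common_rank (T : finType) (P : T -> nat -> Prop) :
  (forall x m n, (m <= n)%N -> P x m -> P x n) ->
  (forall x, exists n, P x n) -> exists n, forall x, P x n.
Proof.
move=> mono /choice[f fP]; exists (\max_x f x) => x.
by apply: mono (fP x); exact: leq_bigmax.
Qed.

Fixpoint path_sum (T : Type) (w : T -> T -> int) x s : int :=
  if s is y :: s' then w x y + path_sum w y s' else 0.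

Definition cycle_sum (T : Type) (w : T -> T -> int) (c : seq T) : int :=
  if c is x :: s then path_sum w x (rcons s x) else 0.

Lemma path_sumE (T : Type) (w : T -> T -> int) x0 x s :
  path_sum w x s = \sum_(i < size s) w (nth x0 (x :: s) i) (nth x0 (x :: s) i.+1).
Proof.
elim: s x => [|y s IHs] x /=; first by rewrite big_ord0.
by rewrite big_ord_recl /= IHs.
Qed.

Lemma cycle_sumE (T : Type) (w : T -> T -> int) x0 (c : seq T) :
  cycle_sum w c = \sum_(i < size c) w (nth x0 c i) (nth x0 c (i.+1 %% size c)).
Proof.
case: c => [|x s]; first by rewrite big_ord0.
rewrite /cycle_sum (path_sumE w x0) size_rcons; apply: eq_bigr => -[i /= ik] _.
have -> : nth x0 (x :: rcons s x) i = nth x0 (x :: s) i.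
  by rewrite -rcons_cons nth_rcons ik.
congr (w _ _); move: ik; rewrite ltnS leq_eqVlt => /predU1P[->|ik].
  by rewrite modnn nth_rcons ltnn eqxx.
by rewrite modn_small //= nth_rcons ik.
Qed.

Lemma cycle_next_neq (V : finType) (c : seq V) x0 i : is_cycle c -> (i < size c)%N ->
  nth x0 c i != nth x0 c (i.+1 %% size c).
Proof.
move=> /andP[uc c2] ic; rewrite nth_uniq ?ltn_mod //; last exact: leq_trans c2.
move: ic; rewrite leq_eqVlt => /predU1P[ic|ic]; last by rewrite modn_small // neq_ltn leqnn.
by rewrite ic modnn -(eqn_add2r 1) !addn1 ic; apply: contraTneq c2 => ->.
Qed.

(** * The curve of a cycle, edge by edge *)

Section CycleCurve.
Variables (R : realType) (V : finType) (E : complete_graph_embedding R V).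

Lemma cycle_curve_edge (c : seq V) x0 i (s : R) : is_cycle c -> (i < size c)%N -> 0 <= s <= 1 ->
  nth x0 c i != nth x0 c (i.+1 %% size c) /\
  cycle_curve E c ((i%:R + s) / (size c)%:R) =
    edge E (nth x0 c i) (nth x0 c (i.+1 %% size c)) s.
Proof.
move=> cc ic s01; have /andP[uc c2] := cc.
have k0 : (0 < size c)%N by exact: leq_trans c2.
have next_neq j : (j < size c)%N -> nth x0 c j != nth x0 c (j.+1 %% size c).
  by move=> jc; exact: cycle_next_neq cc jc.
split; first exact: next_neq.
have kR : (size c)%:R != 0 :> R by rewrite pnatr_eq0 -lt0n.
case: c cc uc c2 ic k0 next_neq kR => // p c cc uc c2 ic k0 next_neq kR.
have nthE j : nth p (p :: c) (j %% size (p :: c)) = nth x0 (p :: c) (j %% size (p :: c)).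
  by apply: set_nth_default; rewrite ltn_mod.
rewrite /cycle_curve mulrC divfK // !nthE.
have [s1|s1] := ltP s 1.
  have -> : Num.truncn (i%:R + s) = i.
    by apply: truncn_def; rewrite lerDl -natr1 ltrD2l; lra.
  by rewrite modn_small // addrC addKr.
(* At the end of an edge the truncation has already moved on to the next edge, at parameter 0; both
   edges take the value of the common vertex. *)
have {s1} -> : s = 1 by lra.
have -> : Num.truncn (i%:R + 1 : R) = i.+1 by rewrite natr1 natrK.
rewrite natr1 subrr edge_source.
  by rewrite edge_target ?next_neq.
set j := (i.+1 %% _)%N.
have -> : (i.+2 %% size (p :: c) = j.+1 %% size (p :: c))%N.
  by rewrite /j -[X in _ = (X %% _)%N]addn1 modnDml addn1.
by apply: next_neq; rewrite ltn_mod.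
Qed.

Lemma unit_param k (t : R) : (0 < k)%N -> 0 <= t <= 1 -> exists i (s : R),
  [/\ (i < k)%N, 0 <= s <= 1 & t = (i%:R + s) / k%:R].
Proof.
move=> k0 t01; have kR : 0 < k%:R :> R by rewrite ltr0n.
have [t1|t1] := ltP t 1; last first.
  exists k.-1, 1; split; [by rewrite prednK|lra|].
  by rewrite natr1 prednK // divff ?gt_eqF //; lra.
have t0 : 0 <= t by lra.
have /andP[h1 h2] := truncn_itv (mulr_ge0 (ler0n _ k) t0).
exists (Num.truncn (k%:R * t)), (k%:R * t - (Num.truncn (k%:R * t))%:R); split.
- by rewrite truncn_lt_nat ?mulr_ge0 ?ler0n // gtr_pMr.
- by rewrite subr_ge0 h1 lerBlDl natr1 ltW.
- by rewrite subrKC mulrAC divff ?mul1r ?gt_eqF.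
Qed.

Lemma cycle_curve_closed (c : seq V) : is_cycle c -> cycle_curve E c 1 = cycle_curve E c 0.
Proof.
move=> cc; have /andP[_ c2] := cc; have k0 : (0 < size c)%N by exact: leq_trans c2.
have [x0 _] : exists x0, x0 \in c by case: c k0 {cc c2} => // x c _; exists x; rewrite mem_head.
have kR : (size c)%:R != 0 :> R by rewrite pnatr_eq0 -lt0n.
have lastc : ((size c).-1 < size c)%N by rewrite prednK.
have one01 : 0 <= (1 : R) <= 1 by lra.
have zero01 : 0 <= (0 : R) <= 1 by lra.
have [n1 e1] := cycle_curve_edge x0 cc lastc one01.
have [n0 e0] := cycle_curve_edge x0 cc k0 zero01.
have <- : ((size c).-1%:R + 1) / (size c)%:R = 1 :> R by rewrite natr1 prednK // divff.
rewrite e1 edge_target // prednK // modnn -(edge_source E n0) -e0.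
by rewrite addr0 mul0r.
Qed.

(** The finitely many edges share a modulus of continuity for [e / 2]. Parameters closer than the
    length of one edge interval lie on the same or on consecutive edges, and in the second case the
    values are compared through the common vertex. *)
Lemma cycle_curve_ucont (c : seq V) : is_cycle c -> unit_ucont (cycle_curve E c).
Proof.
move=> cc e e0; have /andP[_ c2] := cc; have k0 : (0 < size c)%N by exact: leq_trans c2.
have [x0 _] : exists x0, x0 \in c by case: c k0 {cc c2} => // x c _; exists x; rewrite mem_head.
have kR : 0 < (size c)%:R :> R by rewrite ltr0n.
have e2 : 0 < e / 2 by rewrite divr_gt0.
have [d d0 dP] : exists2 d : R, 0 < d & forall pq : V * V, pq.1 != pq.2 ->
    forall s t, 0 <= s <= 1 -> 0 <= t <= 1 -> `|s - t| < d ->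
    `|edge E pq.1 pq.2 s - edge E pq.1 pq.2 t| < e / 2.
  pose close (pq : V * V) (d : R) := pq.1 != pq.2 -> forall s t, 0 <= s <= 1 -> 0 <= t <= 1 ->
    `|s - t| < d -> `|edge E pq.1 pq.2 s - edge E pq.1 pq.2 t| < e / 2.
  refine (@finite_common_bound R (V * V)%type close _ _) => [pq d d' _ d'd h ne s t s01 t01 st|pq].
    by apply: h => //; exact: lt_le_trans d'd.
  have [pq12|ne] := eqVneq pq.1 pq.2; first by exists 1; rewrite // /close pq12 eqxx.
  have [d d0 dP] := continuous_ucont (@edge_continuous R V E _ _ ne) e2.
  by exists d => // _; exact: dP.
exists (Num.min d 1 / (size c)%:R); first by rewrite divr_gt0 // lt_min d0 ltr01.
move=> t t' t01 t01' tt'.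
have [i [s [ik s01 tE]]] := unit_param k0 t01.
have [i' [s' [ik' s01' tE']]] := unit_param k0 t01'.
have {tt'} : `|(i%:R + s) - (i'%:R + s')| < Num.min d 1.
  have -> : i%:R + s - (i'%:R + s') = (t - t') * (size c)%:R.
    by rewrite tE tE'; field; rewrite gt_eqF.
  by rewrite normrM [`|_%:R|]ger0_norm ?ler0n // -ltr_pdivlMr.
rewrite lt_min => /andP[ttd tt1]; rewrite tE tE' {t t' t01 t01' tE tE'}.
wlog ii' : i i' s s' ik ik' s01 s01' ttd tt1 / (i <= i')%N => [W|].
  case/orP: (leq_total i i') => h; first exact: W.
  by rewrite distrC; apply: W => //; rewrite distrC.
have [ne eE] := cycle_curve_edge x0 cc ik s01.
have [ne' eE'] := cycle_curve_edge x0 cc ik' s01'.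
rewrite eE eE'; move: ii'; rewrite leq_eqVlt => /predU1P[ii|ii].
  rewrite -{}ii in ne' eE' ttd *; apply: lt_trans (_ : e / 2 < e); last by lra.
  apply: (dP (_, _)) => //=; apply: le_lt_trans ttd; rewrite le_eqVlt; apply/orP; left; apply/eqP.
  by congr `|_|; ring.
have iiE : i' = i.+1.
  apply/eqP; rewrite eqn_leq ii andbT leqNgt; apply/negP => ii2.
  have : i.+2%:R <= i'%:R :> R by rewrite ler_nat.
  rewrite -natr1 -natr1; move: tt1; rewrite ltr_norml => /andP[]; lra.
rewrite {}iiE -natr1 in ne' eE' ttd ik' *.
rewrite modn_small // in ne *.
have d1 : `|s - 1| < d by move: ttd; rewrite !ltr_norml => /andP[? ?]; apply/andP; split; lra.
have d2 : `|0 - s'| < d by move: ttd; rewrite !ltr_norml => /andP[? ?]; apply/andP; split; lra.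
have := dP (_, _) ne s 1 s01 _ d1; have := dP (_, _) ne' 0 s' _ s01' d2.
rewrite /= edge_target // edge_source //.
set v := vertex _ _; set x := edge _ _ _ _; set y := edge _ _ _ _.
have := ler_normD (y - v) (v - x); rewrite addrA subrK.
rewrite !lexx !ler01; move: `|y - v| `|v - x| `|y - x| => A B C ABC /(_ isT) h /(_ isT) h'; lra.
Qed.

Lemma cycle_curve_image (c : seq V) t : is_cycle c -> 0 <= t <= 1 ->
  exists p q (s : R), [/\ p != q, 0 <= s <= 1 & cycle_curve E c t = edge E p q s].
Proof.
move=> cc t01; have /andP[_ c2] := cc; have k0 : (0 < size c)%N by exact: leq_trans c2.
have [x0 _] : exists x0, x0 \in c by case: c k0 {cc c2} => // x c _; exists x; rewrite mem_head.
have [i [s [ik s01 ->]]] := unit_param k0 t01.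
have [ne e] := cycle_curve_edge x0 cc ik s01.
by exists (nth x0 c i), (nth x0 c (i.+1 %% size c)), s.
Qed.

Lemma sample_cycle_curve (c : seq V) x0 M i a : is_cycle c -> (0 < M)%N -> (i < size c)%N ->
  (a <= M)%N -> sample (cycle_curve E c) (size c * M) (i * M + a) =
    sample (edge E (nth x0 c i) (nth x0 c (i.+1 %% size c))) M a.
Proof.
move=> cc M0 ic aM; rewrite /sample; have [_ <-] := cycle_curve_edge x0 cc ic (unit_ratio R aM).
rewrite natrD !natrM; congr cycle_curve; field.
by rewrite !pnatr_eq0 -!lt0n M0 (leq_ltn_trans _ ic).
Qed.

End CycleCurve.

(** * Linking numbers as sums over pairs of edges *)

Section LinkingForm.
Local Open Scope classical_set_scope.
Variables (R : realType) (V W : finType).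
Variables (G : complete_graph_embedding R V) (H : complete_graph_embedding R W).

Lemma edges_apart : disjointly_embedded G H -> exists2 d : R, 0 < d &
  forall c e, is_cycle c -> is_cycle e -> curves_apart (cycle_curve G c) (cycle_curve H e) d.
Proof.
move=> GH.
pose apart (x : (V * V) * (W * W)) (d : R) := x.1.1 != x.1.2 -> x.2.1 != x.2.2 ->
  curves_apart (edge G x.1.1 x.1.2) (edge H x.2.1 x.2.2) d.
have [d d0 dP] : exists2 d : R, 0 < d & forall x, apart x d.
  apply: finite_common_bound => [x d e _ ed h n1 n2 s t s01 t01|x].
    by apply: le_trans ed _; exact: h.
  have [e1|n1] := eqVneq x.1.1 x.1.2; first by exists 1; rewrite // /apart e1 eqxx.
  have [e2|n2] := eqVneq x.2.1 x.2.2; first by exists 1; rewrite // /apart e2 eqxx.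
  have [||s t s01 t01 st|d d0 dP] := @disjoint_curves_apart R (edge G x.1.1 x.1.2) (edge H x.2.1 x.2.2).
  - exact: edge_continuous.
  - exact: edge_continuous.
  - have : (embedded_image G `&` embedded_image H) (edge G x.1.1 x.1.2 s).
      split; right; first by exists x.1.1, x.1.2, s.
      by exists x.2.1, x.2.2, t; rewrite st.
    by rewrite GH.
  by exists d.
exists d => // c e cc ce s t s01 t01.
have [p [q [s' [pq s01' ->]]]] := cycle_curve_image G cc s01.
have [p' [q' [t' [pq' t01' ->]]]] := cycle_curve_image H ce t01.
exact: (dP ((p, q), (p', q'))).
Qed.

(** A cycle repeats no vertex, so it belongs to the finite type of sequences bounded by the number
    of vertices. *)
Lemma common_rank_cycles (P : seq V -> seq W -> nat -> Prop) :
  (forall c e m n, (m <= n)%N -> P c e m -> P c e n) ->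
  (forall c e, is_cycle c -> is_cycle e -> exists n, P c e n) ->
  exists n, forall c e, is_cycle c -> is_cycle e -> P c e n.
Proof.
move=> mono ex.
pose Q (x : {bseq #|V| of V} * {bseq #|W| of W}) n :=
  is_cycle x.1 -> is_cycle x.2 -> P x.1 x.2 n.
have [n nP] : exists n, forall x, Q x n.
  apply: finite_common_rank => [x m n mn h c1 c2|x]; first by apply: mono mn _; exact: h.
  have [c1|c1] := boolP (is_cycle x.1); last by exists 0%N; rewrite /Q (negbTE c1).
  have [c2|c2] := boolP (is_cycle x.2); last by exists 0%N; rewrite /Q (negbTE c2).
  by have [n nP] := ex _ _ c1 c2; exists n.
have short (T : finType) (c : seq T) : is_cycle c -> (size c <= #|T|)%N.
  by move=> /andP[uc _]; rewrite -(card_uniqP uc) max_card.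
exists n => c e cc ce.
exact: (nP (Bseq (short _ _ cc), Bseq (short _ _ ce))).
Qed.

Definition edge_crossing u M (p q : V) (p' q' : W) : int :=
  \sum_(i < M) \sum_(j < M) crossing u (sample (edge G p q) M i) (sample (edge G p q) M i.+1)
     (sample (edge H p' q') M j) (sample (edge H p' q') M j.+1).

Lemma sample_edge_rev (U : finType) (E : complete_graph_embedding R U) M p q i :
  p != q -> (i <= M)%N -> (0 < M)%N -> sample (edge E q p) M i = sample (edge E p q) M (M - i).
Proof.
move=> pq iM M0; rewrite /sample edge_reverse ?unit_ratio // natrB // mulrBl divff //.
by rewrite pnatr_eq0 -lt0n.
Qed.

Lemma edge_crossing_revl u M p q p' q' : p != q ->
  edge_crossing u M q p p' q' = - edge_crossing u M p q p' q'.
Proof.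
move=> pq; rewrite /edge_crossing (reindex_inj rev_ord_inj) -sumrN; apply: eq_bigr => -[i iM] _ /=.
have M0 : (0 < M)%N by apply: leq_ltn_trans iM.
rewrite -sumrN; apply: eq_bigr => j _; rewrite !(@sample_edge_rev _ _ _ p q) ?leq_subr //; last first.
  by rewrite -subSn ?subSS ?leq_subr // ltnW.
by rewrite -crossing_rev -subSn // subSS !subKn // ltnW.
Qed.

Lemma crossing_revr u (a b c d : 'rV[R]_3) : crossing u a b d c = - crossing u a b c d.
Proof. by rewrite -!(crossing_swap u a b) crossing_rev. Qed.

Lemma edge_crossing_revr u M p q p' q' : p' != q' ->
  edge_crossing u M p q q' p' = - edge_crossing u M p q p' q'.
Proof.
move=> pq; rewrite /edge_crossing -sumrN; apply: eq_bigr => i _.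
rewrite (reindex_inj rev_ord_inj) -sumrN; apply: eq_bigr => -[j jM] _ /=.
have M0 : (0 < M)%N by apply: leq_ltn_trans jM.
rewrite !(@sample_edge_rev _ _ _ p' q') ?leq_subr //; last first.
  by rewrite -subSn ?subSS ?leq_subr // ltnW.
by rewrite -crossing_revr -subSn // subSS !subKn // ltnW.
Qed.

(** A single [M], fine enough for all pairs of cycles, and a single direction [u], generic for all
    samples of edges, make the contribution of a pair of edges independent of the cycles that
    contain them. A cycle [c] is sampled at [size c * M] points, so that each edge receives its own
    [M]-gon. *)
Lemma linking_form : disjointly_embedded G H -> exists w : V -> V -> W -> W -> int,
  [/\ forall p q p' q', p != q -> w q p p' q' = - w p q p' q',
      forall p q p' q', p' != q' -> w p q q' p' = - w p q p' q' &
      forall c e, is_cycle c -> is_cycle e ->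
        standard_linking_number (cycle_curve G c) (cycle_curve H e) =
        cycle_sum (fun p q => cycle_sum (w p q) e) c].
Proof.
move=> /edges_apart[d d0 dP].
pose good c e N := (0 < N)%N /\ forall m n, (N <= m)%N -> (N <= n)%N ->
   poly_disjoint (sample (cycle_curve G c) m) m (sample (cycle_curve H e) n) n /\ forall u,
   u != 0 -> poly_generic u (sample (cycle_curve G c) m) m (sample (cycle_curve H e) n) n ->
   standard_linking_number (cycle_curve G c) (cycle_curve H e) =
   poly_crossing u (sample (cycle_curve G c) m) m (sample (cycle_curve H e) n) n.
have [N NP] : exists N, forall c e, is_cycle c -> is_cycle e -> good c e N.
  apply: common_rank_cycles => [c e m n mn [m0 h]|c e cc ce].
    by split=> [|k l nk nl]; [exact: leq_trans mn|apply: h; exact: leq_trans mn _].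
  apply: (linking_number_crossing _ _ _ _ d0); first exact: cycle_curve_ucont.
  - exact: cycle_curve_ucont.
  - exact: cycle_curve_closed.
  - exact: cycle_curve_closed.
  - exact: dP.
pose M := maxn N 1.
have M0 : (0 < M)%N by rewrite leq_max orbT.
pose pts := [seq sample (edge G x.1 x.2) M i | x <- enum {: V * V}, i <- iota 0 M.+1] ++
  [seq sample (edge H x.1 x.2) M i | x <- enum {: W * W}, i <- iota 0 M.+1].
have [u [u0 ugen]] := exists_generic_direction pts.
exists (edge_crossing u M); split.
- by move=> *; exact: edge_crossing_revl.
- by move=> *; exact: edge_crossing_revr.
move=> c e cc ce.
have big (T : finType) (s : seq T) : is_cycle s -> (0 < size s * M)%N /\ (N <= size s * M)%N.
  move=> /andP[_ s2]; have s0 : (0 < size s)%N by exact: leq_trans s2.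
  rewrite muln_gt0 s0 M0; split=> //.
  by apply: leq_trans (leq_maxl N 1) _; rewrite -/M leq_pmull.
have [m0 Nm] := big _ _ cc; have [n0 Nn] := big _ _ ce.
have [_ /(_ _ _ Nm Nn)[dis val]] := NP c e cc ce.
have split_index k i : (0 < k)%N -> (i <= k * M)%N -> exists i' a,
    [/\ (i' < k)%N, (a <= M)%N & i = (i' * M + a)%N].
  move=> k0; rewrite leq_eqVlt => /predU1P[->|ik].
    by exists k.-1, M; split; rewrite ?prednK // addnC -mulSn prednK.
  exists (i %/ M)%N, (i %% M)%N; split; first by rewrite ltn_divLR.
    by apply: ltnW; rewrite ltn_mod.
  exact: divn_eq.
have [x0 _] : exists x0, x0 \in c by case: c m0 {cc Nm dis val} => // x c _; exists x; rewrite mem_head.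
have [y0 _] : exists y0, y0 \in e by case: e n0 {ce Nn dis val} => // x e _; exists x; rewrite mem_head.
have sizes : (0 < size c)%N /\ (0 < size e)%N.
  by move: m0 n0; rewrite !muln_gt0 => /andP[-> _] /andP[-> _].
rewrite (val u u0); last first.
  apply: ugen => // i.
    move=> /(split_index _ _ sizes.1)[i' [a [ic aM ->]]].
    rewrite (sample_cycle_curve G x0) // mem_cat; apply/orP; left.
    apply/allpairsP; exists ((nth x0 c i', nth x0 c (i'.+1 %% size c)), a).
    by split; rewrite ?mem_enum ?mem_iota.
  move=> /(split_index _ _ sizes.2)[i' [a [ic aM ->]]].
  rewrite (sample_cycle_curve H y0) // mem_cat; apply/orP; right.
  apply/allpairsP; exists ((nth y0 e i', nth y0 e (i'.+1 %% size e)), a).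
  by split; rewrite ?mem_enum ?mem_iota.
rewrite (cycle_sumE _ x0) /poly_crossing.
pose F i := \sum_(j < size e * M) crossing u (sample (cycle_curve G c) (size c * M) i)
  (sample (cycle_curve G c) (size c * M) i.+1)
  (sample (cycle_curve H e) (size e * M) j) (sample (cycle_curve H e) (size e * M) j.+1).
rewrite (sum_ord_mul _ _ F); apply: eq_bigr => i _.
rewrite (cycle_sumE _ y0) /edge_crossing [RHS]exchange_big /=; apply: eq_bigr => a _.
pose F' i' j := crossing u (sample (cycle_curve G c) (size c * M) i')
  (sample (cycle_curve G c) (size c * M) i'.+1)
  (sample (cycle_curve H e) (size e * M) j) (sample (cycle_curve H e) (size e * M) j.+1).
rewrite /F (sum_ord_mul _ _ (F' _)); apply: eq_bigr => j _; apply: eq_bigr => b _.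
rewrite /F' -!addnS (sample_cycle_curve G x0) ?(sample_cycle_curve G x0) //.
  by rewrite !(sample_cycle_curve H y0) // ltnW.
exact: ltnW.
Qed.

End LinkingForm.

(** * Stars *)

Section Stars.
Variable W : finType.
Implicit Types (a b c d e q x y z : W) (w : W -> W -> int).

Definition antisym w := forall x y, w x y = - w y x.

Definition cycle_bounded w := forall d : seq W, is_cycle d -> -1 <= cycle_sum w d <= 1.

Definition tri w x y z : int := w x y + w y z + w z x.

Definition common w v := forall x y z, x != v -> y != v -> z != v -> tri w x y z = 0.

(* In the notation of the paper, [f] is the indicator function of the set I. *)
Definition star w q (f : pred W) :=
  forall x y, x != q -> y != q -> tri w q x y = (f y)%:Z - (f x)%:Z.

Section Antisym.
Variable w : W -> W -> int.
Hypothesis anti : antisym w.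

Lemma tri_rot x y z : tri w x y z = tri w y z x.
Proof. rewrite /tri; lia. Qed.

Lemma tri_rev x y z : tri w x z y = - tri w x y z.
Proof. have := anti x y; have := anti y z; have := anti z x; rewrite /tri; lia. Qed.

(** The boundary of a tetrahedron has value 0. *)
Lemma tri_cone q x y z : tri w x y z = tri w q x y + tri w q y z + tri w q z x.
Proof. have := anti q x; have := anti q y; have := anti q z; rewrite /tri; lia. Qed.

Lemma tri_xx x y : tri w x x y = 0.
Proof. have := anti x x; have := anti x y; rewrite /tri; lia. Qed.

Lemma tri_xyy x y : tri w x y y = 0.
Proof. by rewrite tri_rot tri_xx. Qed.

Lemma tri_xyx x y : tri w x y x = 0.
Proof. by rewrite tri_rot tri_xyy. Qed.

Lemma star_common q f : star w q f -> common w q.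
Proof. by move=> st x y z xq yq zq; rewrite (tri_cone q) !st //; lia. Qed.

Hypothesis bounded : cycle_bounded w.

Lemma tri_bounded x y z : -1 <= tri w x y z <= 1.
Proof.
have [->|xy] := eqVneq x y; first by rewrite tri_xx.
have [->|yz] := eqVneq y z; first by rewrite tri_xyy.
have [->|zx] := eqVneq z x; first by rewrite tri_xyx.
have := bounded (_ : is_cycle [:: x; y; z]); rewrite /is_cycle /= !in_cons !in_nil !orbF !negb_or.
rewrite xy yz (eq_sym x z) zx => /(_ isT); rewrite /tri; lia.
Qed.

Lemma quad_bounded x y z t : uniq [:: x; y; z; t] -> -1 <= w x y + w y z + w z t + w t x <= 1.
Proof. by move=> u; have := bounded (_ : is_cycle [:: x; y; z; t]); rewrite /is_cycle u /= => /(_ isT); lia. Qed.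

(** The three triangles at [d] add up to [abc], and [abc] minus any one of them is a 4-cycle, of
    value at most 1; hence none of the three is negative. *)
Lemma attached_edge a b c d : tri w a b c = 1 -> d \notin [:: a; b; c] ->
  [/\ 0 <= tri w a b d, 0 <= tri w b c d, 0 <= tri w c a d &
      tri w a b d + tri w b c d + tri w c a d = 1].
Proof.
move=> abc dn.
have [e|ab] := eqVneq a b; first by move: abc; rewrite e tri_xx.
have [e|bc] := eqVneq b c; first by move: abc; rewrite e tri_xyy.
have [e|ca] := eqVneq c a; first by move: abc; rewrite e tri_xyx.
move: dn; rewrite !in_cons in_nil orbF !negb_or => /and3P[da db dc].
have U x y z t : x != y -> y != z -> z != x -> t != x -> t != y -> t != z -> uniq [:: x; y; z; t].
  move=> xy yz zx tx ty tz; rewrite /= !in_cons !in_nil !orbF !negb_or.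
  by rewrite xy yz (eq_sym x z) zx (eq_sym x t) tx (eq_sym y t) ty (eq_sym z t) tz.
have := quad_bounded (U a b c d ab bc ca da db dc).
have := quad_bounded (U b c a d bc ca ab db dc da).
have := quad_bounded (U c a b d ca ab bc dc da db).
have := anti a b; have := anti b c; have := anti c a.
have := anti a d; have := anti b d; have := anti c d.
by move: abc; rewrite /tri => *; split; lia.
Qed.

(* Otherwise the five positive triangles form a Moebius band, whose core pentagon
   has value 2. *)
Lemma attached_two a b c d e : tri w a b c = 1 -> d \notin [:: a; b; c] -> e \notin [:: a; b; c] ->
  tri w a b d = 1 -> tri w b c e = 1 -> tri w b d e = 1.
Proof.
move=> abc dn en abd bce.
have de : d != e.
  by apply/eqP => h; have [] := attached_edge abc dn; rewrite -h in bce; lia.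
have [h|ab] := eqVneq a b; first by move: abc; rewrite h tri_xx.
have [h|bc] := eqVneq b c; first by move: abc; rewrite h tri_xyy.
have [h|ca] := eqVneq c a; first by move: abc; rewrite h tri_xyx.
move: dn en; rewrite !in_cons in_nil !orbF !negb_or => /and3P[da db dc] /and3P[ea eb ec].
have := bounded (_ : is_cycle [:: a; b; c; e; d]); rewrite /is_cycle /= !in_cons !in_nil !orbF !negb_or.
rewrite ab bc (eq_sym a c) ca (eq_sym a e) ea (eq_sym a d) da (eq_sym b e) eb (eq_sym b d) db.
rewrite (eq_sym c e) ec (eq_sym c d) dc (eq_sym e d) de => /(_ isT).
have := tri_bounded b d e.
have : w a b + w b c + w c e + w e d + w d a = tri w a b d + tri w b c e - tri w b d e.
  by rewrite /tri (anti e d) (anti e b); ring.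
by rewrite abd bce; clear; lia.
Qed.

(** The hexagon [a d b e c f] is [abc] minus the three attached triangles and would have value 1 - 3
    = -2. *)
Lemma attached_three a b c d e f : tri w a b c = 1 -> d \notin [:: a; b; c] ->
  e \notin [:: a; b; c] -> f \notin [:: a; b; c] ->
  tri w a b d = 1 -> tri w b c e = 1 -> tri w c a f = 1 -> False.
Proof.
move=> abc dn en fn abd bce caf.
have [??? sd] := attached_edge abc dn.
have [??? se] := attached_edge abc en.
have [??? sf] := attached_edge abc fn.
have de : d != e by apply/eqP => h; rewrite h in abd; lia.
have ef : e != f by apply/eqP => h; rewrite h in bce; lia.
have fd : f != d by apply/eqP => h; rewrite h in caf; lia.
have [h|ab] := eqVneq a b; first by move: abc; rewrite h tri_xx.
have [h|bc] := eqVneq b c; first by move: abc; rewrite h tri_xyy.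
have [h|ca] := eqVneq c a; first by move: abc; rewrite h tri_xyx.
move: dn en fn; rewrite !in_cons in_nil !orbF !negb_or.
move=> /and3P[da db dc] /and3P[ea eb ec] /and3P[fa fb fc].
have := bounded (_ : is_cycle [:: a; d; b; e; c; f]); rewrite /is_cycle /= !in_cons !in_nil !orbF !negb_or.
rewrite ab (eq_sym a c) ca (eq_sym a e) ea (eq_sym a d) da (eq_sym a f) fa.
rewrite db de dc (eq_sym d f) fd (eq_sym b e) eb bc (eq_sym b f) fb ec ef (eq_sym c f) fc => /(_ isT).
have : w a d + w d b + w b e + w e c + w c f + w f a =
    tri w a b c - tri w a b d - tri w b c e - tri w c a f.
  by rewrite /tri (anti b d) (anti d a) (anti c e) (anti e b) (anti a f) (anti f c); ring.
by rewrite abc abd bce caf; clear; lia.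
Qed.

(** The centre is the common end [b] of the two edges that may carry attached triangles. Two
    vertices attached to the same edge are compared by [attached_edge], two attached to different
    edges by [attached_two]. *)
Lemma star_two_edges a b c : tri w a b c = 1 ->
  (forall d, d \notin [:: a; b; c] -> tri w c a d = 0) -> exists f, star w b f.
Proof.
move=> abc ca0.
have [h|ab] := eqVneq a b; first by move: abc; rewrite h tri_xx.
have [h|bc] := eqVneq b c; first by move: abc; rewrite h tri_xyy.
have [h|ca] := eqVneq c a; first by move: abc; rewrite h tri_xyx.
(* The values are forced: [b c a] has value 1, so [f c] is 0 and [f a] is 1, and a vertex attached
   to [bc] gets 1, one attached to [ab] gets 0. *)
pose f x := (x == a) || (x \notin [:: a; b; c]) && (tri w b c x == 1).
exists f.
have fa : f a = true by rewrite /f eqxx.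
have fc : f c = false by rewrite /f (negbTE ca) !in_cons eqxx !orbT.
have cls x : x != b -> [\/ x = a, x = c,
    [/\ x \notin [:: a; b; c], f x = false, tri w a b x = 1, tri w b c x = 0 & tri w c a x = 0] |
    [/\ x \notin [:: a; b; c], f x = true, tri w a b x = 0, tri w b c x = 1 & tri w c a x = 0]].
  move=> xb; have [->|xa] := eqVneq x a; first exact: Or41.
  have [->|xc] := eqVneq x c; first exact: Or42.
  have xn : x \notin [:: a; b; c] by rewrite !in_cons in_nil !negb_or xa xb xc.
  have [p1 p2 p3 s] := attached_edge abc xn; have x0 := ca0 x xn.
  have [h|h] := eqVneq (tri w b c x) 1.
    apply: Or44; split=> //; last by move: p1 p2 p3 s h; clear; lia.
    by rewrite /f xn h eqxx orbT.
  apply: Or43; split=> //; try (move: p1 p2 p3 s x0 h; clear; lia).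
  by rewrite /f (negbTE xa) (negbTE h) andbF.
suff half x y : x != b -> y != b -> (f x <= f y)%N -> tri w b x y = (f y)%:Z - (f x)%:Z.
  move=> x y xb yb; case/orP: (leq_total (f x) (f y)) => h; first exact: half.
  by rewrite tri_rev half //; clear; lia.
move=> xb yb.
have inb : b \in [:: a; b; c] by rewrite !in_cons eqxx !orbT.
case: (cls x xb) => [->|->|[xn fx x1 x2 x3]|[xn fx x1 x2 x3]];
 case: (cls y yb) => [->|->|[yn fy y1 y2 y3]|[yn fy y1 y2 y3]]; rewrite ?fa ?fc ?fx ?fy //= => _;
 rewrite ?tri_xyy ?subrr //.
- by rewrite tri_rot tri_rev y1.
- by rewrite -tri_rot abc.
- by rewrite -tri_rot x1.
- by rewrite tri_rev x2.
- have [->|yx] := eqVneq y x; first by rewrite tri_xyy.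
  have yn' : y \notin [:: a; b; x].
    by move: yn; rewrite !in_cons !in_nil !orbF !negb_or yx => /and3P[-> -> _].
  have [p1 p2 p3 s] := attached_edge x1 yn'; move: p1 p2 p3 s y1; clear; lia.
- exact: (attached_two abc).
- by rewrite -tri_rot x1.
- have [->|yx] := eqVneq y x; first by rewrite tri_xyy.
  have yn' : y \notin [:: b; c; x].
    by move: yn; rewrite !in_cons !in_nil !orbF !negb_or yx => /and3P[_ -> ->].
  have [p1 p2 p3 s] := attached_edge x2 yn'.
  by have := tri_rot x b y; have := tri_rev b x y; move: p1 p2 p3 s y2; clear; rewrite (tri_rot b y x); lia.
Qed.

(** If all triangles vanish, any centre will do. Otherwise [attached_three] leaves an edge of a
    positive triangle without attached triangle, and a rotation makes it the third edge in
    [star_two_edges]. *)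
Lemma star_exists (x0 : W) : exists q f, star w q f.
Proof.
have [z|/existsNP[a /existsNP[b /existsNP[c abc0]]]] := pselect (forall x y z, tri w x y z = 0).
  by exists x0, pred0 => x y _ _; rewrite z.
wlog abc : b c abc0 / tri w a b c = 1.
  move=> W'; have := tri_bounded a b c; have [h|h] := eqVneq (tri w a b c) 1 => ?; first exact: (W' b c).
  apply: (W' c b); rewrite tri_rev; lia.
have free d1 d2 d3 : ~ [/\ d1 \notin [:: a; b; c], d2 \notin [:: a; b; c], d3 \notin [:: a; b; c] &
    [/\ tri w a b d1 = 1, tri w b c d2 = 1 & tri w c a d3 = 1]].
  by move=> [n1 n2 n3 [h1 h2 h3]]; exact: (attached_three abc n1 n2 n3).
have val01 x y d : tri w x y d <> 1 -> 0 <= tri w x y d -> tri w x y d = 0.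
  by have := tri_bounded x y d; lia.
have pick x y : (forall d, d \notin [:: a; b; c] -> 0 <= tri w x y d) ->
    (forall d, d \notin [:: a; b; c] -> tri w x y d = 0) \/
    exists d, d \notin [:: a; b; c] /\ tri w x y d = 1.
  move=> p; have [h|h] := pselect (exists d, d \notin [:: a; b; c] /\ tri w x y d = 1); [by right|left].
  move=> d dn; apply: val01; last exact: p.
  by move=> e; apply: h; exists d.
have [ab0|[d1 [n1 h1]]] := pick a b (fun d dn => let: And4 p _ _ _ := attached_edge abc dn in p).
  have bca : tri w b c a = 1 by rewrite -tri_rot.
  exists c; apply: (star_two_edges bca) => d dn; apply: ab0.
  by move: dn; rewrite !in_cons !in_nil; do !case: eqP.
have [bc0|[d2 [n2 h2]]] := pick b c (fun d dn => let: And4 _ p _ _ := attached_edge abc dn in p).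
  have cab : tri w c a b = 1 by rewrite tri_rot.
  exists a; apply: (star_two_edges cab) => d dn; apply: bc0.
  by move: dn; rewrite !in_cons !in_nil; do !case: eqP.
have [ca0|[d3 [n3 h3]]] := pick c a (fun d dn => let: And4 _ _ p _ := attached_edge abc dn in p).
  by exists b; exact: (star_two_edges abc).
by case: (free d1 d2 d3).
Qed.

End Antisym.
End Stars.

Lemma exists_notin (W : finType) (s : seq W) : (size s < #|W|)%N -> exists x, x \notin s.
Proof.
move=> h; apply/existsP; apply: contraLR h => /existsPn h; rewrite -leqNgt.
apply: leq_trans (card_size s); apply: subset_leq_card; apply/fintype.subsetP => x _.
by have := h x; rewrite negbK.
Qed.

Lemma uniq3 (T : eqType) (x y z : T) : x != y -> y != z -> z != x -> uniq [:: x; y; z].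
Proof. by move=> xy yz zx; rewrite /= !in_cons !in_nil !orbF negb_or xy yz eq_sym zx. Qed.

(** * Three stars with sum zero *)

Section Triangular.
Variable W : finType.
Implicit Types (a b c d e q r x y z : W) (w : W -> W -> int).

(* Up to the sign [o], the star q O I with O = s - q and I the complement of s. *)
Definition star_off w q (s : seq W) (o : bool) := forall x y, x != q -> y != q ->
  (-1) ^+ o * tri w q x y = (y \notin s)%:Z - (x \notin s)%:Z.

Lemma star_off_common w q s o : antisym w -> star_off w q s o -> common w q.
Proof.
move=> anti st x y z xq yq zq; rewrite (tri_cone anti q).
have := st x y xq yq; have := st y z yq zq; have := st z x zq xq.
by clear st xq yq zq; case: o; rewrite ?expr0 ?expr1; clear; lia.
Qed.

Lemma common_neq0 w v x y z : common w v -> tri w x y z != 0 -> v \in [:: x; y; z].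
Proof.
move=> cv; apply: contraR; rewrite !in_cons in_nil orbF !negb_or => /and3P[vx vy vz].
by rewrite cv // eq_sym.
Qed.

(** A vertex common to two of the forms is common to the third, so the centres differ. The triangle
    [q1 r x] avoids the centres [q2] and [q3], whence [f1] is constant off the centres. It differs
    from this constant at [q2], since otherwise [q3] would be common to [w1] as well as [w3]. The
    triangles [q1 q2 r] and [q1 q3 r] show that the three signs agree. *)
Lemma three_stars w1 w2 w3 q1 q2 q3 f1 f2 f3 : (3 < #|W|)%N ->
  antisym w1 -> antisym w2 -> antisym w3 ->
  star w1 q1 f1 -> star w2 q2 f2 -> star w3 q3 f3 ->
  (forall x y z, tri w1 x y z + tri w2 x y z + tri w3 x y z = 0) ->
  ~ (exists v, [/\ common w1 v, common w2 v & common w3 v]) ->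
  exists o, [/\ uniq [:: q1; q2; q3], (4 < #|W|)%N, star_off w1 q1 [:: q1; q2; q3] o,
     star_off w2 q2 [:: q1; q2; q3] o & star_off w3 q3 [:: q1; q2; q3] o].
Proof.
move=> n4 A1 A2 A3 S1 S2 S3 sum0 nc.
have K1 := star_common A1 S1; have K2 := star_common A2 S2; have K3 := star_common A3 S3.
have two v : common w1 v -> common w2 v -> False.
  move=> c1 c2; apply: nc; exists v; split=> // x y z xv yv zv.
  by have := sum0 x y z; rewrite c1 // c2 // !add0r.
have two' v : common w2 v -> common w3 v -> False.
  move=> c1 c2; apply: nc; exists v; split=> // x y z xv yv zv.
  by have := sum0 x y z; rewrite c1 // c2 // !addr0.
have two'' v : common w1 v -> common w3 v -> False.
  move=> c1 c2; apply: nc; exists v; split=> // x y z xv yv zv.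
  by have := sum0 x y z; rewrite c1 // c2 // add0r addr0.
have n12 : q1 != q2 by apply/eqP => h; apply: (two q1) => //; rewrite h.
have n23 : q2 != q3 by apply/eqP => h; apply: (two' q2) => //; rewrite h.
have n31 : q3 != q1 by apply/eqP => h; apply: (two'' q3) => //; rewrite h.
have n21 := n12; rewrite eq_sym in n21; have n32 := n23; rewrite eq_sym in n32.
have n13 := n31; rewrite eq_sym in n13.
have [r] := @exists_notin W [:: q1; q2; q3] n4.
rewrite !in_cons in_nil orbF !negb_or => /and3P[r1 r2 r3].
have F1 x : x != q1 -> x != q2 -> x != q3 -> f1 x = f1 r.
  move=> x1 x2 x3; have := sum0 q1 r x; by rewrite K2 // K3 // S1 // !addr0 => /eqP; rewrite subr_eq0; do 2!case: (f1 _).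
have F2 x : x != q1 -> x != q2 -> x != q3 -> f2 x = f2 r.
  move=> x1 x2 x3; have := sum0 q2 r x; by rewrite K1 // K3 // S2 // addr0 add0r => /eqP; rewrite subr_eq0; do 2!case: (f2 _).
have F3 x : x != q1 -> x != q2 -> x != q3 -> f3 x = f3 r.
  move=> x1 x2 x3; have := sum0 q3 r x; by rewrite K1 // K2 // S3 // !add0r => /eqP; rewrite subr_eq0; do 2!case: (f3 _).
have from w q f q' : antisym w -> star w q f -> q != q' ->
    (forall x, x != q -> x != q' -> f x = f r) -> common w q'.
  move=> A st qq' Fr x y z xq' yq' zq'; have K := star_common A st.
  have st' u v : u != q' -> v != q' -> tri w q u v = 0.
    move=> uq' vq'; have [->|uq] := eqVneq u q; first by rewrite tri_xx.
    have [->|vq] := eqVneq v q; first by rewrite tri_xyx.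
    by rewrite st // !Fr // subrr.
  by rewrite (tri_cone A q) !st' // !addr0.
have e12 : f1 q2 != f1 r.
  apply/eqP => e; apply: (two'' q3) => //; apply: (from w1 q1 f1) => // x x1 x3.
  by have [->|x2] := eqVneq x q2; last exact: F1.
have e13 : f1 q3 != f1 r.
  apply/eqP => e; apply: (two q2) => //; apply: (from w1 q1 f1) => // x x1 x2.
  by have [->|x3] := eqVneq x q3; last exact: F1.
have e21 : f2 q1 != f2 r.
  apply/eqP => e; apply: (two' q3) => //; apply: (from w2 q2 f2) => // x x2 x3.
  by have [->|x1] := eqVneq x q1; last exact: F2.
have e23 : f2 q3 != f2 r.
  apply/eqP => e; apply: (two q1) => //; apply: (from w2 q2 f2) => // x x2 x1.
  by have [->|x3] := eqVneq x q3; last exact: F2.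
have e31 : f3 q1 != f3 r.
  apply/eqP => e; apply: (two' q2) => //; apply: (from w3 q3 f3) => // x x3 x2.
  by have [->|x1] := eqVneq x q1; last exact: F3.
have e32 : f3 q2 != f3 r.
  apply/eqP => e; apply: (two'' q1) => //; apply: (from w3 q3 f3) => // x x3 x1.
  by have [->|x2] := eqVneq x q2; last exact: F3.
have s12 : f1 r = f2 r.
  have := sum0 q1 q2 r; rewrite (K3 q1 q2 r) // S1 // (tri_rot w2) S2 //.
  by move: e12 e21; case: (f1 q2); case: (f1 r); case: (f2 q1); case: (f2 r).
have s13 : f1 r = f3 r.
  have := sum0 q1 q3 r; rewrite (K2 q1 q3 r) // S1 // (tri_rot w3) S3 //.
  by move: e13 e31; case: (f1 q3); case: (f1 r); case: (f3 q1); case: (f3 r).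
have off w q f : star w q f ->
    (forall x, x != q -> f x = ((x \notin [:: q1; q2; q3]) == f1 r)) ->
    star_off w q [:: q1; q2; q3] (~~ f1 r).
  by move=> st fE x y xq yq; rewrite st // !fE //; case: (f1 r); do 2!case: (_ \notin _).
have in_s : [/\ q1 \in [:: q1; q2; q3], q2 \in [:: q1; q2; q3] & q3 \in [:: q1; q2; q3]].
  by rewrite !in_cons !eqxx !orbT.
have [in1 in2 in3] := in_s.
have out x : x != q1 -> x != q2 -> x != q3 -> x \notin [:: q1; q2; q3].
  by move=> x1 x2 x3; rewrite !in_cons in_nil orbF !negb_or x1 x2 x3.
exists (~~ f1 r); split; first exact: uniq3.
(* With four vertices, each potential takes equal values at the two vertices other than [r] and its
   centre, so [r] would be common to all three forms. *)
- rewrite ltnNge; apply/negP => n4'.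
  apply: nc; exists r.
  have only_r x : x != q1 -> x != q2 -> x != q3 -> x = r.
    move=> x1 x2 x3; apply/eqP/negPn/negP => xr; move: n4'; rewrite leqNgt => /negP; apply.
    have u : uniq [:: x; r; q1; q2; q3].
      by rewrite /= !in_cons !in_nil !orbF !negb_or xr x1 x2 x3 r1 r2 r3 n12 n13 n23.
    by have := max_card (mem [:: x; r; q1; q2; q3]); rewrite (card_uniqP u).
  have cr w q f p p' : antisym w -> star w q f -> [/\ p != q, p' != q & f p = f p'] ->
     (forall x, x != r -> x != q -> x = p \/ x = p') -> r != q -> common w r.
    move=> A st [pq pq' pp'] dich rq x y z xr yr zr.
    have fE u : u != r -> u != q -> f u = f p by move=> ur /(dich u ur)[] ->.
    have st' u v : u != r -> v != r -> tri w q u v = 0.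
      move=> ur vr; have [->|uq] := eqVneq u q; first by rewrite tri_xx.
      have [->|vq] := eqVneq v q; first by rewrite tri_xyx.
      by rewrite st // !fE // subrr.
    by rewrite (tri_cone A q) !st' // !addr0.
  split.
  + apply: (cr w1 q1 f1 q2 q3) => //; first by split=> //; move: e12 e13; case: (f1 q2); case: (f1 q3); case: (f1 r).
    move=> x xr x1; have [->|x2] := eqVneq x q2; [by left|right].
    by apply/eqP/negPn/negP => x3; rewrite (only_r x) ?eqxx in xr.
  + apply: (cr w2 q2 f2 q1 q3) => //; first by split=> //; move: e21 e23; case: (f2 q1); case: (f2 q3); case: (f2 r).
    move=> x xr x2; have [->|x1] := eqVneq x q1; [by left|right].
    by apply/eqP/negPn/negP => x3; rewrite (only_r x) ?eqxx in xr.
  + apply: (cr w3 q3 f3 q1 q2) => //; first by split=> //; move: e31 e32; case: (f3 q1); case: (f3 q2); case: (f3 r).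
    move=> x xr x3; have [->|x1] := eqVneq x q1; [by left|right].
    by apply/eqP/negPn/negP => x2; rewrite (only_r x) ?eqxx in xr.
- apply: off S1 _ => x x1; have [->|x2] := eqVneq x q2.
    by rewrite in2; move: e12; case: (f1 q2); case: (f1 r).
  have [->|x3] := eqVneq x q3; first by rewrite in3; move: e13; case: (f1 q3); case: (f1 r).
  by rewrite F1 // out // eq_sym eqb_id.
- apply: off S2 _ => x x2; have [->|x1] := eqVneq x q1.
    by rewrite in1 s12; move: e21; case: (f2 q1); case: (f2 r).
  have [->|x3] := eqVneq x q3; first by rewrite in3 s12; move: e23; case: (f2 q3); case: (f2 r).
  by rewrite F2 // out // s12 eq_sym eqb_id.
- apply: off S3 _ => x x3; have [->|x1] := eqVneq x q1.
    by rewrite in1 s13; move: e31; case: (f3 q1); case: (f3 r).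
  have [->|x2] := eqVneq x q2; first by rewrite in2 s13; move: e32; case: (f3 q2); case: (f3 r).
  by rewrite F3 // out // s13 eq_sym eqb_id.
Qed.
End Triangular.

(** * Four forms with sum zero *)

Lemma uniq_notin (T : eqType) (s : seq T) x : uniq s -> x \notin s -> uniq (x :: s).
Proof. by move=> us xs /=; rewrite xs us. Qed.

Section Four.
Variables (W : finType) (w : 'I_4 -> W -> W -> int).
Hypothesis card4 : (3 < #|W|)%N.
Hypothesis anti : forall i, antisym (w i).
Hypothesis bounded : forall i, cycle_bounded (w i).
Hypothesis bounded2 : forall i j, i != j -> cycle_bounded (fun x y => w i x y + w j x y).
Hypothesis sum0 : forall x y, \sum_i w i x y = 0.

Lemma mem_four_indices (i j k l : 'I_4) : uniq [:: i; j; k; l] -> [:: i; j; k; l] =i predT.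
Proof.
move=> u; apply/subset_cardP; first by rewrite (card_uniqP u) card_ord.
exact/fintype.subsetP.
Qed.

Lemma four_indices (F : 'I_4 -> int) i j k l : uniq [:: i; j; k; l] ->
  \sum_m F m = F i + F j + F k + F l.
Proof.
move=> u.
transitivity (\sum_(m <- [:: i; j; k; l]) F m); last first.
  by rewrite !big_cons big_nil addr0 !addrA.
by rewrite [RHS]big_uniq //=; apply: eq_bigl => m; rewrite (mem_four_indices u).
Qed.

Lemma tri_sum0 i j k l x y z : uniq [:: i; j; k; l] ->
  tri (w i) x y z + tri (w j) x y z + tri (w k) x y z + tri (w l) x y z = 0.
Proof.
move=> u; have := sum0 x y; have := sum0 y z; have := sum0 z x.
rewrite !(four_indices _ u) /tri => e1 e2 e3.
transitivity ((w i x y + w j x y + w k x y + w l x y) + (w i y z + w j y z + w k y z + w l y z)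
  + (w i z x + w j z x + w k z x + w l z x)); first by ring.
by rewrite e1 e2 e3.
Qed.

Lemma complete_indices (s : seq 'I_4) : uniq s -> (size s < 4)%N -> exists i, uniq (i :: s).
Proof.
move=> us s4; have [|i si] := @exists_notin _ s; first by rewrite card_ord.
by exists i; exact: uniq_notin.
Qed.

Definition vanishes i := forall x y z, tri (w i) x y z = 0.

Lemma antisymD i j : antisym (fun x y => w i x y + w j x y).
Proof. by move=> x y; rewrite (anti i x y) (anti j x y) opprD. Qed.

Lemma triD i j x y z : tri (fun x y => w i x y + w j x y) x y z = tri (w i) x y z + tri (w j) x y z.
Proof. rewrite /tri; ring. Qed.

Lemma star_off_at (q : W) s o u x y : star_off u q s o -> x \in s -> y \notin s -> x != q -> y != q ->
  tri u q x y = (-1) ^+ o.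
Proof.
move=> st xs ys xq yq; have := st x y xq yq; rewrite xs ys.
by case: o {st}; rewrite ?expr0 ?expr1; clear; lia.
Qed.

(** The triangles [q p r], [q p' r] and [q p r'] have nonzero value and only [q] in common. *)
Lemma star_off_center (q : W) s o u p p' r r' v : star_off u q s o -> p \in s -> p' \in s ->
  r \notin s -> r' \notin s -> uniq [:: q; p; p'] -> q \in s -> r != r' -> common u v -> v = q.
Proof.
move=> st ps ps' rs rs' U qs rr' cv.
have neq_s x y : x \in s -> y \notin s -> y != x by move=> xs; apply: contraNneq => ->.
move: U; rewrite /= !in_cons !in_nil !orbF negb_or => /and3P[/andP[qp qp'] pp' _].
have at_ x y : x \in s -> y \notin s -> x != q -> v \in [:: q; x; y].
  move=> xs ys xq; apply: (common_neq0 cv).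
  by rewrite (star_off_at st xs ys xq (neq_s _ _ qs ys)) signr_eq0.
have := at_ p r ps rs; have := at_ p' r ps' rs; have := at_ p r' ps rs'.
rewrite ![_ == q]eq_sym qp qp' !in_cons !in_nil !orbF => /(_ isT) h1 /(_ isT) h2 /(_ isT) h3.
apply/eqP; move: h1 h2 h3; case: (eqVneq v q) => //= _.
case: (eqVneq v p) => [->|_] /=.
  by rewrite (negbTE pp') eq_sym (negbTE (neq_s _ _ ps rs)).
by move=> /eqP -> _; rewrite eq_sym (negbTE rr').
Qed.

(* Otherwise w i and w m have no common vertex, and [three_stars] applies to them too. The
   two descriptions of w i agree, up to exchanging O and I (possible with five vertices);
   either way w j + w m takes a value +-2, or w m' vanishes. *)
Lemma shared_center i j m m' a b c s o : uniq [:: i; j; m; m'] -> ~ vanishes m' ->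
  uniq [:: a; b; c] -> (forall x, (x \in s) = (x \in [:: a; b; c])) -> (4 < #|W|)%N ->
  star_off (w i) a s o -> star_off (w j) b s o ->
  star_off (fun x y => w m x y + w m' x y) c s o -> common (w m) a.
Proof.
move=> u nz uabc sE n5 Oi Oj Or.
have [r rs] := @exists_notin W [:: a; b; c] card4.
have [r'] := @exists_notin W [:: r; a; b; c] n5.
rewrite in_cons negb_or => /andP[r'r r's]; rewrite -sE in rs; rewrite -sE in r's.
have [as_ [bs cs]] : a \in s /\ b \in s /\ c \in s by rewrite !sE !in_cons !eqxx !orbT.
have neq_s x y : x \in s -> y \notin s -> y != x by move=> xs; apply: contraNneq => ->.
have centre v : common (w i) v -> v = a.
  by move=> cv; apply: (star_off_center Oi bs cs rs r's uabc as_ _ cv); rewrite eq_sym.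
apply: contrapT => nca.
have nc v : common (w i) v -> common (w m) v -> False by move=> /centre ->.
move: (u); rewrite /= !in_cons !in_nil !orbF !negb_or => /and4P[/and3P[ij im im'] /andP[jm jm'] mm' _].
have [q1 [f1 S1]] := star_exists (@anti i) (@bounded i) r.
have [b' [f2 S2]] := star_exists (@anti m) (@bounded m) r.
have [c' [f3 S3]] := star_exists (@antisymD j m') (bounded2 jm') r.
have [||o' [us' _ O1 O2 O3]] := three_stars card4 (@anti i) (@anti m) (@antisymD j m') S1 S2 S3 _ _.
- move=> x y z; rewrite triD -(tri_sum0 x y z u); ring.
- by move=> [v [c1 c2 _]]; exact: nc c1 c2.
have q1a : q1 = a by apply/centre/(star_common (@anti i)); exact: S1.
rewrite {q1 S1}q1a in us' O1 O2 O3.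
have inj_sign (o1 o2 : bool) : (-1) ^+ o1 = (-1) ^+ o2 :> int -> o1 = o2 by case: o1 o2 => -[].
move: (uabc); rewrite /= !in_cons !in_nil !orbF negb_or => /and3P[/andP[ab ac] bc _].
have [ba ca cb] : [/\ b != a, c != a & c != b] by rewrite ![_ == a]eq_sym [c == b]eq_sym.
have [ra rb rc] : [/\ r != a, r != b & r != c] by split; apply: neq_s rs.
set s' := [:: a; b'; c'] in us' O1 O2 O3.
have as' : a \in s' by rewrite mem_head.
have eb := O1 b r ba ra; rewrite (star_off_at Oi bs rs ba ra) in eb.
have ec := O1 c r ca ra; rewrite (star_off_at Oi cs rs ca ra) in ec.
move: us'; rewrite /= !in_cons !in_nil !orbF negb_or => /and3P[/andP[ab' ac'] b'c' _].
have jm_bounded := tri_bounded (@antisymD j m) (bounded2 jm).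
(* The two descriptions of [w i] are compared on [a b r] and [a c r]. If [b] lies in [s'], their
   signs agree, and [c] lies in [s'] too. *)
have [bs'|bs'] := boolP (b \in s').
  rewrite bs' in eb.
  have oo : o' = o by move: eb; case: (o'); case: (o); case: (r \in s').
  have rs' : r \notin s' by move: eb; rewrite oo; case: (o); case: (r \in s').
  have cs' : c \in s' by move: ec; rewrite oo rs'; case: (o); case: (c \in s').
  rewrite oo in O2 O3.
  (* If [b' = b], then [w j + w m] has value 2 or -2 on [b a r]. Otherwise [b' = c] and [c' = b], so
     [w m] and [w m + w m'] are the same star and [w m'] vanishes. *)
  have [e|b'b] := eqVneq b' b.
    rewrite e in O2; have := jm_bounded b a r; rewrite triD.
    rewrite (star_off_at Oj as_ rs ab rb) (star_off_at O2 as' rs' ab rb).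
    by case: (o).
  move: bs' cs'; rewrite !in_cons !in_nil !orbF (negbTE ba) (negbTE ca) eq_sym (negbTE b'b) /=.
  move=> /eqP bc'; rewrite -bc' (negbTE cb) orbF => /eqP cb'.
  rewrite /s' -cb' -bc' in O2.
  case: nz; suff cone x y : tri (w m') c x y = 0.
    by move=> x y z; rewrite (tri_cone (@anti m') c) !cone.
  have [->|xc] := eqVneq x c; first exact/tri_xx/anti.
  have [->|yc] := eqVneq y c; first exact/tri_xyx/anti.
  have := Or x y xc yc; have := O2 x y xc yc; rewrite triD !sE ![in X in X -> _]in_cons !in_cons.
  by rewrite !(orbC (_ == c)) !orbF => <-; case: (o); rewrite ?expr0 ?expr1; clear; lia.
(* Here the signs are opposite and [O] and [I] are exchanged, so [b] and [c] lie outside [s']; [w j]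
   and [w m] take the same value 1 or -1 on [b a b']. *)
rewrite bs' in eb.
have [rs' oo] : r \in s' /\ o' = ~~ o by move: eb; case: (o'); case: (o); case: (r \in s').
have cs' : c \notin s' by move: ec; rewrite rs' oo; case: (o); case: (c \in s').
have bs'n : b' \in s' by rewrite !in_cons eqxx orbT.
have b'b : b' != b by apply: contraNneq bs' => <-.
have b's : b' \notin s.
  rewrite sE !in_cons in_nil orbF !negb_or eq_sym ab' b'b /=.
  by apply: contraNneq cs' => <-.
have := jm_bounded b a b'; rewrite triD (star_off_at Oj as_ b's ab b'b).
rewrite -(tri_rot (w m)) (tri_rev (@anti m)) (star_off_at O2 as' bs') ?oo //; last by rewrite eq_sym.
by case: (o).
Qed.

(** Otherwise [three_stars] applies to [w i], [w j] and [w l + w k], and [shared_center] makes [b]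
    common to both [w k] and [w l]. Yet their sum is nonzero on [c a r], which avoids [b]. *)
Lemma pair_common i j : i != j -> (forall k, ~ vanishes k) ->
  exists v, common (w i) v /\ common (w j) v.
Proof.
move=> ij nz; apply: contrapT => nc.
have uij : uniq [:: i; j] by rewrite /= in_cons in_nil orbF ij.
have [k uk] := complete_indices uij isT.
have [l ul] := complete_indices uk isT.
have [x0 _] := @exists_notin W [::] (ltn_trans (isT : (0 < 3)%N) card4).
have lk : l != k by move: ul; rewrite /= in_cons negb_or => /andP[/andP[]].
have [a [f1 S1]] := star_exists (@anti i) (@bounded i) x0.
have [b [f2 S2]] := star_exists (@anti j) (@bounded j) x0.
have [c [f3 S3]] := star_exists (@antisymD l k) (bounded2 lk) x0.
have [||o [uabc n5 Oi Oj Or]] := three_stars card4 (@anti i) (@anti j) (@antisymD l k) S1 S2 S3 _ _.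
- by move=> x y z; rewrite triD -(tri_sum0 x y z ul); ring.
- by move=> [v [c1 c2 _]]; apply: nc; exists v.
have u_ijlk : uniq [:: i; j; l; k] by rewrite -(rot_uniq 2).
have swap_lk s : uniq (s ++ [:: l; k]) = uniq (s ++ [:: k; l]).
  by apply: perm_uniq; rewrite perm_cat2l (permEl (perm_catC [:: l] [:: k])).
have swap_ij s : uniq ([:: i; j] ++ s) = uniq ([:: j; i] ++ s).
  by apply: perm_uniq; rewrite perm_cat2r (permEl (perm_catC [:: i] [:: j])).
have u_ijkl : uniq [:: i; j; k; l] by rewrite -(swap_lk [:: i; j]).
have u_jilk : uniq [:: j; i; l; k] by rewrite -(swap_ij [:: l; k]).
have u_jikl : uniq [:: j; i; k; l] by rewrite -(swap_ij [:: k; l]).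
have Or' : star_off (fun x y => w k x y + w l x y) c [:: a; b; c] o.
  by move=> x y xc yc; rewrite -Or // !triD addrC.
have ubac : uniq [:: b; a; c].
  by move: uabc; rewrite /= !in_cons !in_nil !orbF !negb_or => /and3P[/andP[ab ac] bc _]; rewrite eq_sym ab bc ac.
have sE x : (x \in [:: a; b; c]) = (x \in [:: b; a; c]) by rewrite !in_cons orbCA.
have la := shared_center u_ijlk (nz k) uabc (fun=> erefl) n5 Oi Oj Or.
have ka := shared_center u_ijkl (nz l) uabc (fun=> erefl) n5 Oi Oj Or'.
have lb := shared_center u_jilk (nz k) ubac sE n5 Oj Oi Or.
have kb := shared_center u_jikl (nz l) ubac sE n5 Oj Oi Or'.
have [r rs] := @exists_notin W [:: a; b; c] card4.
have abc_in : [/\ a \in [:: a; b; c], b \in [:: a; b; c] & c \in [:: a; b; c]].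
  by rewrite !in_cons !eqxx !orbT.
have [ia ib ic] := abc_in.
move: uabc; rewrite /= !in_cons !in_nil !orbF negb_or => /and3P[/andP[ab ac] bc _].
move: (rs); rewrite !in_cons in_nil orbF !negb_or => /and3P[ra rb rc].
have := star_off_at Or ia rs ac rc; rewrite triD lb // ?kb //; last by rewrite eq_sym.
  by move/eqP; rewrite addr0 eq_sym signr_eq0.
by rewrite eq_sym.
Qed.

(** A triangle through a fourth vertex misses one of [a], [b], [c], so it has value 0; coning from
    the fourth vertex gives all other triangles. *)
Lemma three_common i a b c : uniq [:: a; b; c] -> common (w i) a -> common (w i) b ->
  common (w i) c -> vanishes i.
Proof.
move=> u ca cb cc; have [z0 z0n] := @exists_notin W [:: a; b; c] card4.
have cone x y : tri (w i) z0 x y = 0.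
  move: z0n; rewrite !in_cons in_nil orbF !negb_or => /and3P[za zb zc].
  move: u; rewrite /= !in_cons !in_nil !orbF negb_or => /and3P[/andP[ab ac] bc _].
  have [xa|xa] := eqVneq x a; have [ya|ya] := eqVneq y a.
  - by apply: cb; rewrite ?xa ?ya.
  - have [yb|yb] := eqVneq y b; first by apply: cc; rewrite ?xa ?yb.
    by apply: cb; rewrite ?xa.
  - have [xb|xb] := eqVneq x b; first by apply: cc; rewrite ?ya ?xb.
    by apply: cb; rewrite ?ya.
  - exact: ca.
by move=> x y z; rewrite (tri_cone (@anti i) z0) !cone.
Qed.

(* The sets of common vertices of the w i meet pairwise and have at most two elements, so
   without a point shared by all of them they would form a triangle abc. *)
Lemma all_common : (forall k, ~ vanishes k) -> exists v, forall i, common (w i) v.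
Proof.
move=> nz; apply: contrapT => nc.
have miss v : exists i, ~ common (w i) v.
  by apply/existsNP => h; apply: nc; exists v.
have [a [a0 _]] := pair_common (isT : 0 != 1 :> 'I_4) nz.
have [i ai] := miss a.
have i0 : 0 != i by apply/eqP => h; apply: ai; rewrite -h.
have [b [b0 bi]] := pair_common i0 nz.
have ab : a != b by apply/eqP => h; apply: ai; rewrite h.
have [j bj] := miss b.
have j0 : 0 != j by apply/eqP => h; apply: bj; rewrite -h.
have ij : i != j by apply/eqP => h; apply: bj; rewrite -h.
have [c [ci cj]] := pair_common ij nz.
have ca : c != a by apply/eqP => h; apply: ai; rewrite -h.
have bc : b != c by apply/eqP => h; apply: bj; rewrite h.
have aj : common (w j) a.
  have [d [d0 dj]] := pair_common j0 nz.
  have [<- //|da] := eqVneq d a.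
  have db : d != b by apply/eqP => h; apply: bj; rewrite -h.
  case: (nz 0); apply: (three_common (_ : uniq [:: a; b; d])) => //.
  by apply: uniq3; rewrite // eq_sym.
have j0' := j0; rewrite eq_sym in j0'.
have [l ul] := @complete_indices [:: 0; i; j] (uniq3 i0 ij j0') isT.
have [lz li lj] : [/\ l != 0, l != i & l != j].
  by move: ul; rewrite /= !in_cons in_nil orbF !negb_or => /andP[/and3P[-> -> ->]].
(* If [c] were common to [w l] as well, the zero sum would make it a third common vertex of [w 0].
   So [w l] shares [b] with [w i] and [a] with [w j], and the zero sum makes [a] common to [w i],
   against the choice of [i]. *)
have [cl|cl] := pselect (common (w l) c).
  case: (nz 0); apply: (three_common (_ : uniq [:: a; b; c])) => //; first exact: uniq3.
  move=> x y z xc yc zc; have := tri_sum0 x y z ul.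
  by rewrite ci // cj // cl // !addr0 add0r.
have bl : common (w l) b.
  have [d [dl di]] := pair_common li nz.
  have [<- //|db] := eqVneq d b.
  have dc : d != c by apply/eqP => h; apply: cl; rewrite -h.
  case: (nz i); apply: (three_common (_ : uniq [:: b; c; d])) => //.
  by apply: uniq3; rewrite // eq_sym.
have al : common (w l) a.
  have [d [dl dj]] := pair_common lj nz.
  have [<- //|da] := eqVneq d a.
  have dc : d != c by apply/eqP => h; apply: cl; rewrite -h.
  case: (nz j); apply: (three_common (_ : uniq [:: a; c; d])) => //.
  by apply: uniq3; rewrite // eq_sym.
apply: ai => x y z xa ya za; have := tri_sum0 x y z ul.
by rewrite al // a0 // aj // addr0 !add0r.
Qed.

Lemma no_common_four : ~ (exists v, forall i, common (w i) v) ->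
  exists2 i0, vanishes i0 & forall i1 i2 i3, uniq [:: i0; i1; i2; i3] ->
  exists q1 q2 q3 o, [/\ uniq [:: q1; q2; q3], (4 < #|W|)%N,
    star_off (w i1) q1 [:: q1; q2; q3] o, star_off (w i2) q2 [:: q1; q2; q3] o &
    star_off (w i3) q3 [:: q1; q2; q3] o].
Proof.
move=> nc; have [i0 z0] : exists i, vanishes i.
  by apply: contrapT => /forallNP h; apply/nc/all_common.
exists i0 => // i1 i2 i3 u.
have [x0 _] := @exists_notin W [::] (ltn_trans (isT : (0 < 3)%N) card4).
have [q1 [f1 S1]] := star_exists (@anti i1) (@bounded i1) x0.
have [q2 [f2 S2]] := star_exists (@anti i2) (@bounded i2) x0.
have [q3 [f3 S3]] := star_exists (@anti i3) (@bounded i3) x0.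
have [||o [uq n5 O1 O2 O3]] := three_stars card4 (@anti i1) (@anti i2) (@anti i3) S1 S2 S3 _ _.
- by move=> x y z; have := tri_sum0 x y z u; rewrite z0 add0r.
- move=> [v [c1 c2 c3]]; apply: nc; exists v => i.
  have : i \in [:: i0; i1; i2; i3] by rewrite (mem_four_indices u).
  rewrite !in_cons in_nil orbF => /or4P[] /eqP -> // x y z _ _ _; exact: z0.
by exists q1, q2, q3, o; split.
Qed.

(** Each [x] gives the pair of indices [i] with [g i x = 1]. By the bound on sums no two of these
    pairs are complementary, so as edges of [K_4] they meet pairwise: they share an index or lie in
    a triangle. In the first case some [g i] is constantly 1, in the second some [g i] is constantly
    0. *)
Lemma no_balanced_potentials (q : W) (g : 'I_4 -> W -> int) :
  (forall i x, x != q -> 0 <= g i x <= 1) ->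
  (forall x, x != q -> \sum_i g i x = 2) ->
  (forall i j x y, i != j -> x != q -> y != q -> g i x + g j x - (g i y + g j y) <= 1) ->
  (forall i, exists2 x, x != q & g i x = 0) -> (forall i, exists2 x, x != q & g i x = 1) -> False.
Proof.
move=> g01 gsum gpair gz gp.
(* Here [x], [z] and [y] give the pairs [0a], [0b] and [ab]; any pair containing [c], such as that
   of [p], is complementary to one of them. *)
have key a b c x z : uniq [:: 0; a; b; c] -> x != q -> z != q -> g 0 x = 1 -> g a x = 1 ->
    g a z = 0 -> g b z = 1 -> False.
  move=> u xq zq g0x gax gaz gbz.
  move: (u); rewrite /= !in_cons !in_nil !orbF !negb_or => /and4P[/and3P[na nb nc] _ _ _].
  have [y yq g0y] := gz 0; have [p pq gcp] := gp c.
  have := gsum x xq; have := gsum z zq; have := gsum y yq; have := gsum p pq.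
  rewrite !(four_indices _ u).
  have B i v : v != q -> 0 <= g i v /\ g i v <= 1 by move=> vq; apply/andP/g01.
  have [? ?] := B 0 p pq; have [? ?] := B a p pq; have [? ?] := B b p pq.
  have [? ?] := B a y yq; have [? ?] := B b y yq; have [? ?] := B c y yq.
  have [? ?] := B 0 z zq; have [? ?] := B c z zq.
  have := gpair 0 a x z na xq zq; have := gpair 0 a x y na xq yq; have := gpair 0 a x p na xq pq.
  have := gpair 0 b z y nb zq yq; have := gpair 0 b z p nb zq pq.
  have := gpair 0 c p y nc pq yq.
  move: g0x gax gaz gbz g0y gcp; repeat match goal with h : is_true (_ <= _) |- _ => move: h end; clear.
  move: (g 0 p) (g a p) (g b p) (g c p) (g 0 y) (g a y) (g b y) (g c y).
  move: (g 0 z) (g a z) (g b z) (g c z) (g 0 x) (g a x) (g b x) (g c x) => *; lia.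
have [x xq g0x] := gp 0.
have one_of a b c : uniq [:: 0; a; b; c] -> uniq [:: 0; a; c; b] -> g a x = 1 -> False.
  move=> u1 u2 gax; have [z zq gaz] := gz a.
  have [gb|gb] := eqVneq (g b z) 1; first exact: (key a b c x z).
  have [gc|gc] := eqVneq (g c z) 1; first exact: (key a c b x z).
  have := gsum z zq; rewrite (four_indices _ u1) gaz.
  have := g01 0 z zq; have := g01 b z zq; have := g01 c z zq; move: gb gc; clear.
  by move: (g 0 z) (g b z) (g c z) => *; lia.
have := gsum x xq; rewrite (@four_indices _ 0 1 2 3) // g0x.
have [g1|g1] := eqVneq (g 1 x) 1; first by case: (one_of 1 2 3).
have [g2|g2] := eqVneq (g 2 x) 1; first by case: (one_of 2 1 3).
have [g3|g3] := eqVneq (g 3 x) 1; first by case: (one_of 3 1 2).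
have := g01 1 x xq; have := g01 2 x xq; have := g01 3 x xq; move: g1 g2 g3; clear.
by move: (g 1 x) (g 2 x) (g 3 x) => *; lia.
Qed.

(* In the link of q, the w i are the differences of potentials g i with minimum 0 and maximum
   at most 1, and the sum C of the g i is constant. If C = 1 they are indicators of a
   partition; otherwise the complements of the
   nonconstant ones are, unless C = 2 and no g i is constant. *)
Lemma common_four (q : W) : (forall i, common (w i) q) -> (exists i, ~ vanishes i) ->
  exists (e : 'I_4 -> W -> int) (o : bool),
  [/\ forall i x y, x != q -> y != q -> (-1) ^+ o * tri (w i) q x y = e i y - e i x,
      forall i x, x != q -> 0 <= e i x <= 1, forall x, x != q -> \sum_i e i x = 1 &
      forall i, exists2 x, x != q & e i x = 0].
Proof.
move=> cq [i0 nz].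
have [r] := @exists_notin W [:: q] (ltn_trans (isT : (1 < 3)%N) card4).
rewrite in_cons in_nil orbF => rq.
pose h i x := tri (w i) q r x.
(* Minus the minimum of [h i] off [q]: [h i] has values in -1, 0, 1 and vanishes at [r]. *)
pose m i : int := (`[<exists2 y, y != q & h i y = -1>] : nat)%:Z.
pose g i x := h i x + m i.
have T i x y : x != q -> y != q -> tri (w i) q x y = g i y - g i x.
  move=> xq yq; have := tri_cone (@anti i) q r x y; rewrite (cq i) //.
  by rewrite (tri_rev (@anti i) q r y) /g /h; clear; lia.
have hr i : h i r = 0 by rewrite /h tri_xyy.
have m01 i : m i = 0 \/ m i = 1 by rewrite /m; case: asboolP => _; [right|left].
have mP i : m i = 1 -> exists2 y, y != q & h i y = -1 by rewrite /m; case: asboolP.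
have mN i x : m i = 0 -> x != q -> h i x <> -1.
  by rewrite /m; case: asboolP => // nex _ xq hx; apply: nex; exists x.
have g01 i x : x != q -> 0 <= g i x <= 1.
  move=> xq; have := tri_bounded (@anti i) (@bounded i) q r x.
  rewrite -/(h i x) /g; case: (m01 i) => mi; rewrite mi.
    by have := mN i x mi xq; clear; lia.
  have [y yq hy] := mP i mi.
  have := tri_bounded (@anti i) (@bounded i) q y x; rewrite T // /g hy; clear; lia.
have gz i : exists2 x, x != q & g i x = 0.
  case: (m01 i) => mi; first by exists r; rewrite // /g hr mi.
  by have [y yq hy] := mP i mi; exists y; rewrite // /g hy mi.
have u : uniq [:: 0; 1; 2; 3 : 'I_4] by [].
pose C := \sum_i m i.
have gsum x : x != q -> \sum_i g i x = C.
  move=> xq; rewrite /g big_split /= (four_indices _ u) /h.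
  by rewrite tri_sum0 // add0r.
have gpair i j x y : i != j -> x != q -> y != q -> g i x + g j x - (g i y + g j y) <= 1.
  move=> ij xq yq; have := tri_bounded (antisymD i j) (bounded2 ij) q y x.
  by rewrite triD !T //; clear; lia.
have [C1|C1] := eqVneq C 1.
  exists g, false; split=> // [i x y xq yq|x xq]; first by rewrite expr0 mul1r T.
  by rewrite gsum.
(* The maximum of [g i] off [q]; it is 0 exactly when [g i] vanishes there. *)
pose n i : int := (`[<exists2 x, x != q & g i x = 1>] : nat)%:Z.
have n01 i : 0 <= n i <= 1 by rewrite /n; case: asboolP.
have nP i : n i = 1 -> exists2 x, x != q & g i x = 1 by rewrite /n; case: asboolP.
have g_n i x : x != q -> g i x <= n i.
  move=> xq; rewrite /n; case: asboolP => [_|nex]; first by have /andP[] := g01 i x xq.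
  have := g01 i x xq; have : g i x <> 1 by move=> e; apply: nex; exists x.
  clear; lia.
have Cn i : C <= \sum_j n j - n i.
  have [z zq giz] := gz i; rewrite -(gsum z zq) (bigD1 i) //= giz add0r.
  rewrite (bigD1 i (F := n)) //= addrAC subrr add0r.
  by apply: ler_sum => j _; exact: g_n.
have C_pos : 0 < C.
  rewrite lt_neqAle; apply/andP; split; last by rewrite -(gsum r rq) sumr_ge0 // => i _; case/andP: (g01 i r rq).
  apply/eqP => C0; apply: nz.
  have g0 x : x != q -> g i0 x = 0.
    move=> xq; have := gsum x xq; rewrite -C0 => /eqP; rewrite psumr_eq0; last first.
      by move=> i _; case/andP: (g01 i x xq).
    by move=> /allP/(_ i0); rewrite mem_index_enum => /(_ isT) /eqP.
  have cone x y : tri (w i0) q x y = 0.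
    have [->|xq] := eqVneq x q; first exact/tri_xx/anti.
    have [->|yq] := eqVneq y q; first exact/tri_xyx/anti.
    by rewrite T // !g0.
  by move=> x y z; rewrite (tri_cone (@anti i0) q) !cone.
have notbal : ~ (C = 2 /\ \sum_j n j = 4).
  move=> [C2 n4]; apply: (@no_balanced_potentials q g) => //.
    by move=> x xq; rewrite gsum.
  move=> i; apply: nP; have : \sum_(j | j != i) n j <= \sum_(j | j != i) 1.
    by apply: ler_sum => j _; have /andP[] := n01 j.
  rewrite sumr_const cardC1 card_ord; move: n4; rewrite (bigD1 i) //=.
  have := n01 i; move: (n i) (\sum_(j | j != i) n j) => a b; clear; lia.
(* Now [C] is at least 2, so some [n i] is 1, and at a zero of that [g i] the others add up to [C];
   hence the sum of the [n i] exceeds [C]. As it is at most 4, the excess is 1 unless [C = 2] and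
   all four [n i] are 1. The functions [n i - g i] then add up to 1. *)
have nsum : \sum_j n j = C + 1.
  have := Cn 0; have := Cn 1; have := Cn 2; have := Cn 3; move: C_pos C1 notbal.
  have := n01 0; have := n01 1; have := n01 2; have := n01 3.
  rewrite (four_indices _ u).
  by move: (C) (n 0) (n 1) (n 2) (n 3) => C' n0 n1 n2 n3; clear; lia.
exists (fun i x => n i - g i x), true; split.
- by move=> i x y xq yq; rewrite T // expr1; clear; lia.
- by move=> i x xq; have := g_n i x xq; have := g01 i x xq; have := n01 i; clear; lia.
- by move=> x xq; rewrite sumrB gsum // nsum addrC addKr.
- move=> i; have := n01 i; have [ni|ni] := eqVneq (n i) 1.
    by have [x xq gx] := nP i ni; exists x; rewrite // ni gx subrr.
  move=> n01i; exists r => //; have := g_n i r rq; have := g01 i r rq; move: ni n01i; clear; lia.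
Qed.
End Four.

(** * The faces of K_4 *)

Lemma eq_cycle_sum (V : finType) (w w' : V -> V -> int) (c : seq V) : is_cycle c ->
  (forall x y, x != y -> w x y = w' x y) -> cycle_sum w c = cycle_sum w' c.
Proof.
move=> cc e; case: c cc => // x0 c cc; rewrite !(cycle_sumE _ x0).
by apply: eq_bigr => i _; rewrite e // cycle_next_neq.
Qed.

Lemma cycle_sumN (T : Type) (w : T -> T -> int) (c : seq T) :
  cycle_sum (fun x y => - w x y) c = - cycle_sum w c.
Proof. by case: c => [|x c]; rewrite ?oppr0 // !(cycle_sumE _ x) -sumrN. Qed.

Lemma cycle_sum_exchange (T U : Type) (w : T -> T -> U -> U -> int) (c : seq T) (d : seq U) :
  cycle_sum (fun p q => cycle_sum (w p q) d) c =
  cycle_sum (fun x y => cycle_sum (fun p q => w p q x y) c) d.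
Proof.
case: c => [|p c]; case: d => [|x d] //.
- by rewrite (cycle_sumE _ x) big1.
- by rewrite (cycle_sumE _ p) big1.
rewrite (cycle_sumE _ p) (cycle_sumE _ x).
under eq_bigr do rewrite (cycle_sumE _ x).
by rewrite exchange_big; apply: eq_bigr => j _; rewrite (cycle_sumE _ p).
Qed.

Lemma cycle_sum_tri (W : finType) (w : W -> W -> int) x y z :
  cycle_sum w [:: x; y; z] = tri w x y z.
Proof. by rewrite /= /tri addr0 addrA. Qed.

(** When all triangles vanish, [w x] is a potential for [w], and sums along paths telescope. *)
Lemma cycle_sum_eq0 (W : finType) (w : W -> W -> int) (c : seq W) : antisym w ->
  (forall x y z, tri w x y z = 0) -> cycle_sum w c = 0.
Proof.
move=> anti w0; case: c => //= x c.
have path y s : path_sum w y s = w x (last y s) - w x y.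
  elim: s y => [|z s IHs] y /=; first by rewrite subrr.
  by rewrite IHs; have := w0 x y z; have := anti z x; rewrite /tri; clear; lia.
by rewrite path last_rcons subrr.
Qed.

Lemma faceE (w : 'I_4 -> 'I_4 -> int) (p : 'I_4 -> 'I_4) :
  [/\ cycle_sum w (face p 0) = tri w (p 1) (p 2) (p 3),
      cycle_sum w (face p 1) = tri w (p 3) (p 2) (p 0),
      cycle_sum w (face p 2) = tri w (p 0) (p 1) (p 3) &
      cycle_sum w (face p 3) = tri w (p 2) (p 1) (p 0)].
Proof. by split; rewrite -cycle_sum_tri. Qed.

Section Faces.
Variable w : 'I_4 -> 'I_4 -> int.
Hypothesis anti : antisym w.

(** Each edge of [K_4] lies in two faces, which traverse it in opposite directions. *)
Lemma sum_faces : \sum_i cycle_sum w (face id i) = 0.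
Proof.
have [e0 e1 e2 e3] := faceE w id.
rewrite (@four_indices _ 0 1 2 3) // e0 e1 e2 e3 /tri.
rewrite (anti 3 2) (anti 0 3) (anti 1 3) (anti 2 1) (anti 1 0) (anti 0 2); ring.
Qed.

Lemma faces_eq0 : (forall i, cycle_sum w (face id i) = 0) -> forall x y z, tri w x y z = 0.
Proof.
move=> f0; have [] := faceE w id; rewrite !f0 => e0 e1 e2 e3.
suff cone x y : tri w 0 x y = 0 by move=> x y z; rewrite (tri_cone anti 0) !cone.
have [->|->|->|->] := ord4P x; have [->|->|->|->] := ord4P y;
  rewrite ?(tri_xx anti) ?(tri_xyy anti) ?(tri_xyx anti) //.
- by rewrite tri_rot (tri_rev anti) -tri_rot -e3 oppr0.
- by rewrite tri_rot -e3.
- by rewrite (tri_rev anti) tri_rot -e1 oppr0.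
- by rewrite (tri_rev anti) -e2 oppr0.
- by rewrite tri_rot -e1.
Qed.

End Faces.

(** The common edge of the two faces cancels, and the other four edges form the 4-cycle. *)
Lemma two_faces i j : i != j -> exists2 c : seq 'I_4, is_cycle c & forall (w : 'I_4 -> 'I_4 -> int),
  antisym w -> cycle_sum w c = cycle_sum w (face id i) + cycle_sum w (face id j).
Proof.
suff H (a b : 'I_4) : (a < b)%N -> exists2 c : seq 'I_4, is_cycle c & forall (w : 'I_4 -> 'I_4 -> int),
    antisym w -> cycle_sum w c = cycle_sum w (face id a) + cycle_sum w (face id b).
  rewrite neq_ltn => /orP[/H //|/H[c cc e]]; exists c => // w aw; rewrite addrC; exact: e.
have up (w : 'I_4 -> 'I_4 -> int) : antisym w -> [/\ w 1 0 = - w 0 1, w 2 0 = - w 0 2 & w 3 0 = - w 0 3] /\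
    [/\ w 2 1 = - w 1 2, w 3 1 = - w 1 3 & w 3 2 = - w 2 3].
  by move=> aw; split; split; exact: aw.
case: (ord4P a) => ->; case: (ord4P b) => -> // _;
  [exists [:: 1; 2; 0; 3] | exists [:: 0; 1; 2; 3] | exists [:: 0; 2; 3; 1] |
   exists [:: 0; 1; 3; 2] | exists [:: 0; 3; 2; 1] | exists [:: 0; 2; 1; 3]] => // w aw;
  have [e0 e1 e2 e3] := faceE w id; have [[h1 h2 h3] [h4 h5 h6]] := up w aw;
  rewrite ?e0 ?e1 ?e2 ?e3 /cycle_sum /= /tri ?h1 ?h2 ?h3 ?h4 ?h5 ?h6; ring.
Qed.

(* An even permutation with [p 0 = i], so that the faces keep their orientation. *)
Definition klein (i x : 'I_4) : 'I_4 :=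
  nth 0 (nth [::] [:: [:: 0; 1; 2; 3]; [:: 1; 0; 3; 2]; [:: 2; 3; 0; 1]; [:: 3; 2; 1; 0]] i) x.

Lemma klein_inj i : injective (klein i).
Proof.
apply: (can_inj (g := klein i)) => x.
by case: (ord4P i) => ->; case: (ord4P x) => ->.
Qed.

Lemma klein0 i : klein i 0 = i.
Proof. by case: (ord4P i) => ->. Qed.

Lemma klein_face (w : 'I_4 -> 'I_4 -> int) i k :
  cycle_sum w (face (klein i) k) = cycle_sum w (face id (klein i k)).
Proof.
have [e0 e1 e2 e3] := faceE w id; have [f0 f1 f2 f3] := faceE w (klein i).
have E (a b c d : 'I_4) : [/\ klein i 0 = a, klein i 1 = b, klein i 2 = c & klein i 3 = d] ->
  [/\ cycle_sum w (face (klein i) 0) = tri w b c d, cycle_sum w (face (klein i) 1) = tri w d c a,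
      cycle_sum w (face (klein i) 2) = tri w a b d & cycle_sum w (face (klein i) 3) = tri w c b a].
  by move=> [<- <- <- <-].
case: (ord4P i) E => -> E.
- by have [] := E 0 1 2 3; rewrite // => g0 g1 g2 g3;
    case: (ord4P k) => ->; rewrite ?g0 ?g1 ?g2 ?g3 ?e0 ?e1 ?e2 ?e3 /tri; ring.
- have [//|g0 g1 g2 g3] := E 1 0 3 2 _.
  by case: (ord4P k) => ->; rewrite ?g0 ?g1 ?g2 ?g3 ?e0 ?e1 ?e2 ?e3 /tri; ring.
- have [//|g0 g1 g2 g3] := E 2 3 0 1 _.
  by case: (ord4P k) => ->; rewrite ?g0 ?g1 ?g2 ?g3 ?e0 ?e1 ?e2 ?e3 /tri; ring.
- have [//|g0 g1 g2 g3] := E 3 2 1 0 _.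
  by case: (ord4P k) => ->; rewrite ?g0 ?g1 ?g2 ?g3 ?e0 ?e1 ?e2 ?e3 /tri; ring.
Qed.

(** * Linking in stars *)

Lemma linking_antisym_form (R : realType) (V W : finType) (G : complete_graph_embedding R V)
    (H : complete_graph_embedding R W) : disjointly_embedded G H ->
  exists w : V -> V -> W -> W -> int,
  [/\ forall x y, antisym (fun p q => w p q x y), forall p q, antisym (w p q) &
      forall o c d, is_cycle c -> is_cycle d ->
        Lk G H o c d = (-1) ^+ o * cycle_sum (fun x y => cycle_sum (fun p q => w p q x y) c) d].
Proof.
move=> /linking_form[w [wl wr wE]].
(* The form is antisymmetric only off the diagonals, where edges are not junk. Diagonal values are
   set to 0; no cycle uses them. *)
exists (fun p q x y => if (p == q) || (x == y) then 0 else w p q x y); split.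
- move=> x y p q; rewrite (eq_sym q p); case: eqVneq => [|pq] /=; first by rewrite oppr0.
  by case: eqVneq => [|xy]; rewrite ?oppr0 // [in RHS]wl // opprK.
- move=> p q x y; rewrite (eq_sym y x); case: (p == q) => /=; first by rewrite oppr0.
  by case: eqVneq => [|xy]; rewrite ?oppr0 // [in RHS]wr // opprK.
move=> o c d cc cd; rewrite /Lk /linking_number wE //; congr (_ * _).
rewrite -cycle_sum_exchange; apply: eq_cycle_sum => // p q pq.
by apply: eq_cycle_sum => // x y xy; rewrite (negbTE pq) (negbTE xy).
Qed.

Lemma triangleP (V : finType) (T : seq V) : is_triangle T -> exists x y z,
  [/\ T = [:: x; y; z], x != y, y != z & z != x].
Proof.
case: T => [|x [|y [|z [|t T]]]] /andP[u] // _; exists x, y, z.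
move: u; rewrite /= !in_cons !in_nil !orbF negb_or => /and3P[/andP[xy xz] yz _].
by split; rewrite // eq_sym.
Qed.

Lemma is_triangle3 (V : finType) (x y z : V) : x != y -> y != z -> z != x -> is_triangle [:: x; y; z].
Proof. by move=> xy yz zx; rewrite /is_triangle uniq3. Qed.

Lemma triangle_cycle (V : finType) (T : seq V) : is_triangle T -> is_cycle T.
Proof. by rewrite /is_cycle => /andP[-> /eqP ->]. Qed.

Lemma rot_triangle (V : finType) k (x y z a b c : V) : rot k [:: x; y; z] = [:: a; b; c] ->
  [\/ [:: x; y; z] = [:: a; b; c], [:: x; y; z] = [:: c; a; b] | [:: x; y; z] = [:: b; c; a]].
Proof.
case: k => [|[|[|k]]].
- by rewrite rot0; exact: Or31.
- by case=> -> -> ->; apply: Or32.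
- by case=> -> -> ->; apply: Or33.
- by rewrite rot_oversize //; exact: Or31.
Qed.

Section Stars.
Variables (W : finType) (w : W -> W -> int) (q : W) (O I : {set W}) (o : bool).
Hypothesis anti : antisym w.
Hypothesis qOI : q \notin O /\ q \notin I.
Hypothesis OIE : forall x, x != q -> (x \in O) = (x \notin I).
Hypothesis wq : common w q.
Hypothesis wE : forall x y, x != q -> y != q ->
  (-1) ^+ o * tri w q x y = (y \in I)%:Z - (x \in I)%:Z.

Lemma in_star_tri (x y z : W) : in_star q O I [:: x; y; z] -> (-1) ^+ o * tri w x y z = 1.
Proof.
move=> [r [s [k [rO sI e]]]]; have [qO qI] := qOI.
have rq : r != q by apply: contraNneq qO => <-.
have sq : s != q by apply: contraNneq qI => <-.
have val : (-1) ^+ o * tri w q r s = 1.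
  by rewrite wE // sI; move: rO; rewrite OIE // => /negbTE ->.
by case: (rot_triangle e) => -[-> -> ->]; rewrite // ?[tri w s q r]tri_rot // -tri_rot.
Qed.

(** On a triangle through [q] the potential difference is 1, -1 or 0 according to whether the other
    two vertices lie in [O] and [I], in [I] and [O], or on the same side. Triangles avoiding [q]
    vanish by [wq]. *)
Lemma star_links (f : seq W -> int) :
  (forall x y z, x != y -> y != z -> z != x -> f [:: x; y; z] = (-1) ^+ o * tri w x y z) ->
  forall T, is_triangle T ->
    [/\ in_star q O I T -> f T = 1, in_star q O I (rev T) -> f T = -1 &
        ~ in_star q O I T -> ~ in_star q O I (rev T) -> f T = 0].
Proof.
move=> fE T /triangleP[x [y [z [-> xy yz zx]]]]; rewrite fE //.
have revE : rev [:: x; y; z] = [:: z; y; x] by [].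
split; rewrite ?revE; first exact: in_star_tri.
  move/in_star_tri; rewrite (_ : tri w z y x = - tri w x y z); last first.
    by rewrite tri_rev // tri_rot tri_rot.
  by rewrite mulrN => /eqP; rewrite eqr_oppLR => /eqP.
have zero r s k k' (t : seq W) : r != q -> s != q -> rot k t = [:: q; r; s] ->
   rot k' (rev t) = [:: q; s; r] ->
   ~ in_star q O I t -> ~ in_star q O I (rev t) -> (-1) ^+ o * tri w q r s = 0.
  move=> rq sq e e' n n'; rewrite wE //.
  have [rI|rI] := boolP (r \in I); have [sI|sI] := boolP (s \in I) => //.
    by case: n'; exists s, r, k'; rewrite OIE.
  by case: n; exists r, s, k; rewrite OIE.
have [e|xq] := eqVneq x q.
  by rewrite e in xy zx *; apply: (@zero y z 0 2); rewrite // eq_sym.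
have [e|yq] := eqVneq y q.
  by rewrite e in xy yz *; rewrite tri_rot; apply: (@zero z x 1 1); rewrite // eq_sym.
have [e|zq] := eqVneq z q.
  by rewrite e in yz zx *; rewrite -tri_rot; apply: (@zero x y 2 0); rewrite // eq_sym.
by move=> _ _; rewrite wq ?mulr0.
Qed.
End Stars.

(** * Common edges of two triangles *)

Lemma cycle_edges3 (V : finType) (a b c : V) : a != b -> b != c -> c != a ->
  cycle_edges [:: a; b; c] = [set a; b] |: ([set b; c] |: [set [set c; a]]).
Proof.
move=> ab bc ca; have ba := ab; rewrite eq_sym in ba; have cb := bc; rewrite eq_sym in cb.
have [na nb nc] : [/\ next [:: a; b; c] a = b, next [:: a; b; c] b = c & next [:: a; b; c] c = a].
  by rewrite /= !eqxx (negbTE ba) (negbTE ca) (negbTE cb).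
apply/finset.setP => E; rewrite !finset.in_setU1 finset.in_set1; apply/imsetP/or3P => [[x]|].
  rewrite !in_cons in_nil orbF => /or3P[] /eqP -> ->; rewrite ?na ?nb ?nc;
    [exact: Or31|exact: Or32|exact: Or33].
by case=> /eqP ->; [exists a|exists b|exists c]; rewrite ?na ?nb ?nc // !in_cons eqxx ?orbT.
Qed.

Lemma mem_cycle_edges3 (V : finType) (a b c u v : V) : a != b -> b != c -> c != a -> u != v ->
  ([set u; v]%SET \in cycle_edges [:: a; b; c]) = (u \in [:: a; b; c]) && (v \in [:: a; b; c]).
Proof.
move=> ab bc ca uv; rewrite cycle_edges3 // !finset.in_setU1 finset.in_set1.
apply/idP/idP => [/or3P[] /eqP/finset.setP e|].
- by have := e u; have := e v; rewrite !finset.in_set2 !eqxx !orbT !in_cons => /esym/orP[] -> /esym/orP[] ->; rewrite ?orbT.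
- by have := e u; have := e v; rewrite !finset.in_set2 !eqxx !orbT !in_cons => /esym/orP[] -> /esym/orP[] ->; rewrite ?orbT.
- by have := e u; have := e v; rewrite !finset.in_set2 !eqxx !orbT !in_cons => /esym/orP[] -> /esym/orP[] ->; rewrite ?orbT.
rewrite !in_cons !in_nil !orbF => /andP[/or3P[] /eqP eu /or3P[] /eqP ev]; move: uv; rewrite eu ev ?eqxx // => _;
  by rewrite ?eqxx ?orbT // finset.setUC eqxx ?orbT.
Qed.

(** An edge of [xyz] is an edge of [abc] exactly when both its ends lie in [abc]. *)
Lemma card_common_edges (V : finType) (x y z a b c : V) (s := [:: a; b; c]) :
  x != y -> y != z -> z != x -> a != b -> b != c -> c != a ->
  #|(cycle_edges [:: x; y; z] :&: cycle_edges s)%SET| =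
    ((x \in s) && (y \in s) + (y \in s) && (z \in s) + (z \in s) && (x \in s))%N.
Proof.
move=> xy yz zx ab bc ca.
rewrite -sum1_card (eq_bigl (fun E => (E \in cycle_edges [:: x; y; z]) && (E \in cycle_edges s))).
  rewrite big_mkcondr cycle_edges3 // big_setU1 ?big_setU1 ?big_set1 /=.
  - by rewrite !mem_cycle_edges3 // -/s; do 3!case: (_ \in s).
  - rewrite finset.in_set1; apply/eqP => /finset.setP/(_ y).
    by rewrite !finset.in_set2 eqxx (negbTE yz) eq_sym (negbTE xy).
  - rewrite finset.in_setU1 finset.in_set1; apply/norP; split; apply/eqP => /finset.setP.
      by move/(_ x); rewrite !finset.in_set2 eqxx (negbTE xy) eq_sym (negbTE zx).
    by move/(_ y); rewrite !finset.in_set2 eqxx (negbTE yz) orbT eq_sym (negbTE xy).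
by move=> E; rewrite finset.in_setI.
Qed.

(** A triangle of nonzero value contains [q] and, of its other two vertices, exactly one in [s]; so
    exactly one of its edges lies inside [s]. *)
Lemma star_off_two (W : finType) (w : W -> W -> int) q s o x y z : antisym w ->
  star_off w q s o -> q \in s -> tri w x y z != 0 ->
  ((x \in s) && (y \in s) + (y \in s) && (z \in s) + (z \in s) && (x \in s) = 1)%N.
Proof.
move=> anti st qs.
have key a b : tri w q a b != 0 -> (a \in s) (+) (b \in s).
  have [->|aq] := eqVneq a q; first by rewrite tri_xx ?eqxx.
  have [->|bq] := eqVneq b q; first by rewrite tri_xyx ?eqxx.
  have := st a b aq bq; case: (a \in s); case: (b \in s) => //=; rewrite subrr => /eqP;
    by rewrite mulf_eq0 signr_eq0 => /= ->.
move=> nz; have := common_neq0 (star_off_common anti st) nz.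
rewrite !in_cons in_nil orbF => /or3P[] /eqP e; move: nz; rewrite -{}e ?qs => nz.
- by have := key _ _ nz; case: (y \in s); case: (z \in s).
- by rewrite tri_rot in nz; have := key _ _ nz; case: (x \in s); case: (z \in s).
- by rewrite -tri_rot in nz; have := key _ _ nz; case: (x \in s); case: (y \in s).
Qed.

Lemma tri_three (W : finType) (u : W -> W -> int) a b c x y z : antisym u -> tri u a b c = 0 ->
  x \in [:: a; b; c] -> y \in [:: a; b; c] -> z \in [:: a; b; c] -> tri u x y z = 0.
Proof.
move=> au abc.
have cone v v' : v \in [:: a; b; c] -> v' \in [:: a; b; c] -> tri u a v v' = 0.
  rewrite !in_cons !in_nil !orbF => /or3P[] /eqP -> /or3P[] /eqP ->;
    rewrite ?(tri_xx au) ?(tri_xyy au) ?(tri_xyx au) //.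
  by rewrite (tri_rev au) abc oppr0.
by move=> xs ys zs; rewrite (tri_cone au a) !cone.
Qed.

(** * The two cases for embedded graphs *)

Section Main.
Variables (R : realType) (n : nat).
Variables (G : complete_graph_embedding R 'I_4) (H : complete_graph_embedding R 'I_n).
Hypothesis n4 : (4 <= n)%N.
Hypothesis GH : weakly_linked G H.
Variable w : 'I_4 -> 'I_4 -> 'I_n -> 'I_n -> int.
Hypothesis antil : forall x y, antisym (fun p q => w p q x y).
Hypothesis antir : forall p q, antisym (w p q).
Hypothesis wE : forall o c d, is_cycle c -> is_cycle d ->
  Lk G H o c d = (-1) ^+ o * cycle_sum (fun x y => cycle_sum (fun p q => w p q x y) c) d.

Definition cycle_form (c : seq 'I_4) (x y : 'I_n) : int := cycle_sum (fun p q => w p q x y) c.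

Lemma antisym_cycle_form c : antisym (cycle_form c).
Proof.
move=> x y; rewrite /cycle_form -cycle_sumN; case: c => // p c.
by rewrite !(cycle_sumE _ p); apply: eq_bigr => i _; rewrite antir.
Qed.

Lemma cycle_form_bounded c : is_cycle c -> cycle_bounded (cycle_form c).
Proof.
move=> cc d cd; have [_ /(_ c d cc cd)] := GH.
rewrite /strongly_linked wE // expr0 mul1r -/(cycle_form c).
move: (cycle_sum _ _) => k /negP; rewrite -ltNge; clear; lia.
Qed.

Definition face_form i := cycle_form (face id i).

Lemma face_cycle i : is_cycle (face id i).
Proof. by case: (ord4P i) => ->. Qed.

Lemma face_form_bounded i : cycle_bounded (face_form i).
Proof. exact/cycle_form_bounded/face_cycle. Qed.

Lemma face_form_bounded2 i j : i != j -> cycle_bounded (fun x y => face_form i x y + face_form j x y).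
Proof.
move=> /two_faces[c cc cE] d cd.
rewrite (_ : cycle_sum _ d = cycle_sum (cycle_form c) d); first exact: cycle_form_bounded.
by apply: eq_cycle_sum => // x y _; rewrite /cycle_form cE //; exact: antil.
Qed.

Lemma face_form_sum0 x y : \sum_i face_form i x y = 0.
Proof. exact/sum_faces/antil. Qed.

Lemma card4 : (3 < #|'I_n|)%N.
Proof. by rewrite card_ord. Qed.

Lemma Lk_triangle o c x y z : is_cycle c -> x != y -> y != z -> z != x ->
  Lk G H o c [:: x; y; z] = (-1) ^+ o * tri (cycle_form c) x y z.
Proof. by move=> cc xy yz zx; rewrite wE ?cycle_sum_tri // triangle_cycle ?is_triangle3. Qed.

Lemma tri_exchange c x y z : tri (cycle_form c) x y z =
  cycle_sum (fun p q => tri (w p q) x y z) c.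
Proof.
rewrite -cycle_sum_tri /cycle_form -(cycle_sum_exchange (fun p q x y => w p q x y) c [:: x; y; z]).
by case: c => // p c; rewrite !(cycle_sumE _ p); apply: eq_bigr => i _; rewrite cycle_sum_tri.
Qed.

Lemma antisym_tri x y z : antisym (fun p q => tri (w p q) x y z).
Proof. by move=> p q; rewrite /tri !(antil _ _ p q) -!opprD. Qed.

(** The faces span the cycle space of [K_4], so a triangle of [H] that links no face links no cycle
    of [G]. *)
Lemma faces_vanish c x y z : (forall i, tri (face_form i) x y z = 0) -> tri (cycle_form c) x y z = 0.
Proof.
move=> f0; rewrite tri_exchange; apply: cycle_sum_eq0; first exact: antisym_tri.
by apply: faces_eq0; [exact: antisym_tri|move=> i; rewrite -tri_exchange; exact: f0].
Qed.

Lemma links_left_face x y z : x != y -> y != z -> z != x ->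
  links_left G H [:: x; y; z] <-> exists i, tri (face_form i) x y z != 0.
Proof.
move=> xy yz zx; split=> [[c cc]|[i nz]]; last first.
  by exists (face id i); rewrite ?face_cycle // /linked Lk_triangle ?face_cycle // expr0 mul1r.
rewrite /linked Lk_triangle // expr0 mul1r => nz.
apply: contrapT => /forallNP h; case/eqP: nz; apply: faces_vanish => i.
by apply/eqP/negPn/negP/h.
Qed.

Lemma common_linking_vertexP q : common_linking_vertex G H q <-> forall i, common (face_form i) q.
Proof.
split=> [cq i x y z xq yq zq|cq T /triangleP[x [y [z [-> xy yz zx]]]] /links_left_face-/(_ xy yz zx)].
  apply/eqP/negPn/negP => nz.
  have [e|xy] := eqVneq x y; first by move: nz; rewrite e (tri_xx (@antisym_cycle_form _)) eqxx.
  have [e|yz] := eqVneq y z; first by move: nz; rewrite e (tri_xyy (@antisym_cycle_form _)) eqxx.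
  have [e|zx] := eqVneq z x; first by move: nz; rewrite e (tri_xyx (@antisym_cycle_form _)) eqxx.
  have := cq _ (is_triangle3 xy yz zx) ((links_left_face xy yz zx).2 (ex_intro _ i nz)).
  by rewrite !in_cons in_nil ![q == _]eq_sym (negbTE xq) (negbTE yq) (negbTE zq).
by move=> [i]; exact: common_neq0.
Qed.

Lemma some_face_links : exists i, ~ vanishes face_form i.
Proof.
have [[c [d [cc cd nz]]] _] := GH; move: nz; rewrite /linked wE // expr0 mul1r -/(cycle_form c) => nz.
apply: contrapT => /forallNP h; case/eqP: nz; apply: cycle_sum_eq0; first exact: antisym_cycle_form.
by move=> x y z; apply: faces_vanish => i; move: (h i) => /contrapT; apply.
Qed.

Lemma common_vertex q : common_linking_vertex G H q ->
    exists I : 'I_4 -> {set 'I_n},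
      [/\ forall i j, i != j -> (I i :&: I j)%SET = finset.set0,
          (#|[set i | I i == finset.set0]%SET| <= 2)%N,
          (\bigcup_i I i)%SET = [set~ q]%SET &
          exists o : bool, forall i,
            links_in_star G H o (face id i) q ([set~ q] :\: I i)%SET (I i)].
Proof.
move=> /common_linking_vertexP cq.
have [e [sgn [eE e01 esum ez]]] := common_four card4 (fun i => @antisym_cycle_form _)
  face_form_bounded face_form_bounded2 face_form_sum0 cq some_face_links.
pose I i : {set 'I_n} := [set x | (x != q) && (e i x == 1)]%SET.
have inI i x : (x \in I i) = (x != q) && (e i x == 1) by rewrite inE.
have ge_two x i j : x != q -> i != j -> e i x + e j x <= 1.
  move=> xq ij; rewrite -(esum x xq) (bigD1 i) //= (bigD1 j) /=; last by rewrite eq_sym.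
  by rewrite addrA lerDl sumr_ge0 // => k _; case/andP: (e01 k x xq).
have some x : x != q -> exists i, e i x = 1.
  move=> xq; apply: contrapT => /forallNP h; have := esum x xq.
  rewrite big1 // => i _; have := e01 i x xq; have := h i; move: (e i x) => k; clear; lia.
exists I; split.
- move=> i j ij; apply/finset.setP => x; rewrite finset.in_setI !inI finset.in_set0.
  apply/negP => /andP[/andP[xq /eqP ei] /andP[_ /eqP ej]].
  by have := ge_two x i j xq ij; rewrite ei ej.
(* Some [I i] is nonempty; since [e i] also takes the value 0, it does not cover everything, and a
   second set is nonempty. *)
- have [r] := @exists_notin 'I_n [:: q] (ltn_trans (isT : (1 < 3)%N) card4).
  rewrite in_cons in_nil orbF => rq.
  have [i ei] := some r rq; have [z zq eiz] := ez i; have [j ej] := some z zq.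
  have ij : i != j by apply/eqP => h; rewrite -h eiz in ej.
  have nonempty k x : x != q -> e k x = 1 -> I k != finset.set0.
    by move=> xq ek; apply/finset.set0Pn; exists x; rewrite inI xq ek eqxx.
  have sub : ([set k | I k == finset.set0] \subset ~: [set i; j])%SET.
    apply/fintype.subsetP => k; rewrite inE finset.in_setC finset.in_set2.
    by move/eqP => Ik; apply/norP; split; apply/eqP => ki; move: Ik; rewrite ki; apply/eqP;
      [exact: nonempty ei | exact: nonempty ej].
  apply: leq_trans (subset_leq_card sub) _.
  by rewrite cardsCs finset.setCK card_ord cards2 ij.
- apply/finset.setP => x; rewrite finset.in_setC1; apply/bigcupP/idP => [[i _]|xq].
    by rewrite inI => /andP[].
  by have [i ei] := some x xq; exists i; rewrite // inI xq ei eqxx.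
exists sgn => i; apply: (@star_links _ (face_form i)).
- exact: antisym_cycle_form.
- by rewrite finset.in_setD finset.in_setC1 inI eqxx andbF.
- by move=> x xq; rewrite finset.in_setD finset.in_setC1 xq andbT.
- exact: cq.
- move=> x y xq yq; transitivity (e i y - e i x); first exact: eE.
  rewrite !inI xq yq /=.
  have := e01 i x xq; have := e01 i y yq; move: (e i x) (e i y) => a b.
  by case: eqVneq; case: eqVneq; clear; lia.
- by move=> x y z xy yz zx; rewrite Lk_triangle ?face_cycle.
Qed.

Lemma no_common_vertex : ~ (exists q, common_linking_vertex G H q) -> no_common_vertex_case G H.
Proof.
move=> nc; split=> //.
have nc' : ~ exists v, forall i, common (face_form i) v.
  by move=> [v cv]; apply: nc; exists v; apply/common_linking_vertexP.
have [i0 z0 stars] := no_common_four card4 (fun i => @antisym_cycle_form _)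
  face_form_bounded face_form_bounded2 face_form_sum0 nc'.
(* The vertex opposite the face that does not link [H] becomes [p 0]. *)
pose p : {perm 'I_4} := perm (@klein_inj i0).
have pE k : p k = klein i0 k by rewrite permE.
have p0 : p 0 = i0 by rewrite pE klein0.
have faceP k : face p k = face (klein i0) k.
  by case: (ord4P k) => ->; rewrite /face /tnth /= !pE.
have form k : cycle_form (face p k) =2 face_form (p k).
  by move=> x y; rewrite faceP /cycle_form klein_face pE.
have up : uniq [:: i0; p 1; p 2; p 3].
  rewrite -p0; exact: (map_inj_uniq (@perm_inj _ p) [:: 0; 1; 2; 3]).
have [q1 [q2 [q3 [sgn [uq n5 S1 S2 S3]]]]] := stars _ _ _ up.
split; first by rewrite card_ord in n5.
exists q1, q2, q3; split=> //; exists p, sgn => I.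
have fcycle k : is_cycle (face p k).
  by rewrite faceP; case: (ord4P i0) => ->; case: (ord4P k) => ->.
have tri_form k x y z : tri (cycle_form (face p k)) x y z = tri (face_form (p k)) x y z.
  by rewrite /tri !form.
have off_form k q s : star_off (face_form (p k)) q s sgn -> star_off (cycle_form (face p k)) q s sgn.
  by move=> st x y xq yq; rewrite tri_form st.
set s := [:: q1; q2; q3] in uq S1 S2 S3.
have IE x : (x \in I) = (x \notin s).
  by rewrite finset.in_setC finset.in_setU finset.in_set2 finset.in_set1 !in_cons in_nil orbF orbA.
have s1 : q1 \in s by rewrite !in_cons eqxx.
have s2 : q2 \in s by rewrite !in_cons eqxx orbT.
have s3 : q3 \in s by rewrite !in_cons eqxx !orbT.
move: (uq); rewrite /= !in_cons !in_nil !orbF negb_or => /and3P[/andP[q12 q13] q23 _].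
have links k q (O : {set 'I_n}) : q \in s -> q \notin O ->
    (forall x, x != q -> (x \in O) = (x \in s)) ->
    star_off (face_form (p k)) q s sgn -> links_in_star G H sgn (face p k) q O I.
  move=> qs qO OE st; have anti := @antisym_cycle_form (face p k).
  apply: (@star_links _ (cycle_form (face p k))) => //.
  - by rewrite IE qs.
  - by move=> x xq; rewrite IE negbK OE.
  - exact/star_off_common/off_form/st.
  - by move=> x y xq yq; rewrite !IE; exact: (off_form _ _ _ st).
  - by move=> x y z xy yz zx; rewrite Lk_triangle.
(* The vertex [u] is the centre of one of the three stars, and there [v] and [t] lie on opposite
   sides. *)
have some_tri u v t : u \in s -> v \in s -> t \notin s -> u != v ->
    exists i, tri (face_form i) u v t != 0.
  move=> us vs ts uv; have tu : t != u by apply: contraNneq ts => ->.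
  have vu : v != u by rewrite eq_sym.
  move: (us); rewrite !in_cons in_nil orbF => /or3P[] /eqP e; rewrite e in vu tu *.
  - by exists (p 1); rewrite (star_off_at S1 vs ts vu tu) signr_eq0.
  - by exists (p 2); rewrite (star_off_at S2 vs ts vu tu) signr_eq0.
  - by exists (p 3); rewrite (star_off_at S3 vs ts vu tu) signr_eq0.
have anti i := @antisym_cycle_form (face id i).
split; first split.
- move=> [d cd]; rewrite /linked wE // expr0 mul1r -/(cycle_form _) => /eqP; apply.
  apply: cycle_sum_eq0 => [|x y z]; first exact: antisym_cycle_form.
  by rewrite tri_form p0 z0.
- apply: links => // [|x xq]; first by rewrite finset.in_set2 negb_or q12 q13.
  by rewrite finset.in_set2 !in_cons in_nil (negbTE xq) !orbF.
- apply: links => // [|x xq]; first by rewrite finset.in_set2 negb_or eq_sym q12 q23.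
  by rewrite finset.in_set2 !in_cons in_nil (negbTE xq) !orbF.
- apply: links => // [|x xq]; first by rewrite finset.in_set2 negb_or !(eq_sym q3) q13 q23.
  by rewrite finset.in_set2 !in_cons in_nil (negbTE xq) !orbF.
- move=> T /[dup] /triangle_cycle cT /triangleP[a [b [c [e _ _ _]]]] [d cd].
  rewrite /linked wE // expr0 mul1r -/(cycle_form _) => nz; apply: contraNT nz => p0T.
  apply/eqP/cycle_sum_eq0 => [|x y z]; first exact: antisym_cycle_form.
  (* A triangle avoiding [p 0] is [face p 0] up to orientation, and that face has zero form on all
     triangles of [H]. *)
  have mem k : k \in T -> k \in [:: p 1; p 2; p 3].
    move=> kT; have : k \in [:: i0; p 1; p 2; p 3] by rewrite (mem_four_indices up).
    by rewrite in_cons => /predU1P[ki|//]; rewrite p0 -ki kT in p0T.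
  rewrite tri_exchange e cycle_sum_tri; apply: (@tri_three _ _ (p 1) (p 2) (p 3)).
  - exact: antisym_tri.
  - have := tri_form 0 x y z; rewrite p0 z0 tri_exchange.
    by have [-> _ _ _] := faceE (fun p q => tri (w p q) x y z) p.
  - by apply: mem; rewrite e !in_cons eqxx.
  - by apply: mem; rewrite e !in_cons eqxx orbT.
  - by apply: mem; rewrite e !in_cons eqxx !orbT.
move=> T /triangleP[x [y [z [-> xy yz zx]]]].
have q31 : q3 != q1 by rewrite eq_sym.
rewrite card_common_edges // -/s; split=> [/links_left_face-/(_ xy yz zx)[i nz]|].
  have : i \in [:: i0; p 1; p 2; p 3] by rewrite (mem_four_indices up).
  rewrite !in_cons in_nil orbF => /or4P[] /eqP ie; move: nz; rewrite ie.
  - by rewrite z0.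
  - exact: (star_off_two (anti _) S1 s1).
  - exact: (star_off_two (anti _) S2 s2).
  - exact: (star_off_two (anti _) S3 s3).
(* Exactly one common edge means that exactly two of the three vertices lie in [s]. *)
move=> two; apply/links_left_face => //.
have [xs|xs] := boolP (x \in s); have [ys|ys] := boolP (y \in s);
  have [zs|zs] := boolP (z \in s); move: two; rewrite ?xs ?ys ?zs ?(negbTE xs) ?(negbTE ys) ?(negbTE zs) // => _.
- exact: some_tri.
- by have [i nz] := some_tri z x y zs xs ys zx; exists i; rewrite -tri_rot in nz; rewrite tri_rot.
- by have [i nz] := some_tri y z x ys zs xs yz; exists i; rewrite tri_rot.
Qed.
End Main.

Theorem theorem4p1 (R : realType) (n : nat)
    (G : complete_graph_embedding R 'I_4)
    (H : complete_graph_embedding R 'I_n) :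
  (4 <= n)%N -> disjointly_embedded G H -> weakly_linked G H ->
  exactly_one (common_vertex_case G H) (no_common_vertex_case G H).
Proof.
move=> n4 /linking_antisym_form[w [wl wr wE]] GH.
have [ex|nex] := pselect (exists q, common_linking_vertex G H q).
  left; split=> [|[]//]; split=> // q; exact: (common_vertex n4 GH wl wr wE).
right; split=> [[]//|]; exact: (no_common_vertex n4 GH wl wr wE).
Qed.
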